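(* Let $G/N$ and $H/M$ be groups with a real Lie cover, and let $\varphi:G/N\to H/M$ be a group homomorphism. Then the following assertions are equivalent: (1) $\varphi$ is Borel-definable; (2) $\varphi$ has an approximately multiplicative Borel lift $G\to H$ that is real analytic on an open identity neighborhood in $G$.
   Context: A subgroup $N$ of a Polish group $G$ is a Polish subgroup if it carries a (necessarily unique) Polish group topology for which the inclusion $N\to G$ is continuous. A group with a Polish cover is a quotient group $G/N$ where $G$ is a Polish group and $N$ is a normal Polish subgroup of $G$ (the pair $(G,N)$ is part of the data). It is a group with a real Lie cover if both $G$ and $N$, with their Polish group topologies, are (finite-dimensional) real Lie groups. A lift of a group homomorphism $\varphi:G/N\to H/M$ is a function $f:G\to H$ with $\varphi(gN)=f(g)M$ for all $g\in G$; $\varphi$ is Borel-definable if it has a Borel lift. For a Borel lift $f$ of $\varphi$, the multiplicative defect is $\delta f:G\times G\to M$, $\delta f(x,y)=f(x)f(y)f(xy)^{-1}$. The lift $f$ is approximately multiplicative if $f(1)=1$ and $\delta f:G\times G\to M$ is continuous at $(1,1)$ with respect to the Polish group topology of $M$. *)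

(* Defs.v *)
From HB Require Import structures.
From mathcomp Require Import all_boot all_order all_algebra finmap.
From mathcomp Require Import all_classical all_reals all_analysis.
From mathcomp.analysis.showcase Require Import summability.
Import numFieldNormedType.Exports.

Set Implicit Arguments.
Unset Strict Implicit.
Unset Printing Implicit Defensive.

Import Order.TTheory GRing.Theory Num.Theory.
Local Open Scope classical_set_scope.
Local Open Scope quotient_scope.
Local Open Scope group_scope.

Definition separable_space (T : topologicalType) : Prop :=
  exists2 D : set T, countable D & dense D.

Definition completely_metrizable (R : realType) (T : topologicalType) : Prop :=
  exists d : T -> T -> R,
    [/\ (forall x y, (d x y = 0)%R <-> x = y),
        (forall x y, d x y = d y x),
        (forall x y z, (d x z <= d x y + d y z)%R),
        (forall x (A : set T), nbhs x A <->
           exists2 e : R, (0 < e)%R & [set y | (d x y < e)%R] `<=` A) &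
        (forall u : nat -> T,
           (forall e : R, (0 < e)%R -> \forall i & j \near \oo, (d (u i) (u j) < e)%R) ->
           exists l : T, u @ \oo --> l)].

Definition polish (R : realType) (T : topologicalType) : Prop :=
  separable_space T /\ completely_metrizable R T.

HB.mixin Record isTopologicalGroup G & Topological G & Group G := {
  mulg_continuous : continuous (fun p : G * G => p.1 * p.2);
  invg_continuous : continuous (fun x : G => x^-1)
}.

#[short(type="topologicalGroupType")]
HB.structure Definition TopologicalGroup :=
  {G of isTopologicalGroup G & Topological G & Group G}.

HB.mixin Record isPolish (R : realType) T & Topological T := {
  polishP : polish R T
}.

#[short(type="polishGroupType")]
HB.structure Definition PolishGroup (R : realType) :=
  {G of TopologicalGroup G & isPolish R G}.

HB.mixin Record hasContinuousVal (G : topologicalType) (S : pred G) N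
    & SubType G S N & Topological N := {
  val_continuous : continuous (val : N -> G)
}.

(* The topology of [N] is its own Polish group topology; it may be
   strictly finer than the subspace topology. *)
#[short(type="polishSubgroupType")]
HB.structure Definition PolishSubgroup (R : realType) (G : polishGroupType R)
    (S : pred G) :=
  {N of SubGroup G S N & PolishGroup R N & hasContinuousVal G S N}.

Record polish_cover (R : realType) := PolishCover {
  cover_group : polishGroupType R;
  cover_pred : pred cover_group;
  cover_sub : polishSubgroupType cover_pred;
  cover_normal : forall x g, x \in cover_pred -> x ^ g \in cover_pred
}.

Arguments cover_pred {R} p _.

Section Quotient.
Context {R : realType} (C : polish_cover R).
Notation G := (cover_group C).
Notation S := (cover_pred C).
Implicit Types x y z : G.

Lemma cover_pred1 : (1 : G) \in S.
Proof. by rewrite -(val1 (cover_sub C)); exact: valP. Qed.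

Lemma cover_predM x y : x \in S -> y \in S -> x * y \in S.
Proof.
move=> Sx Sy; pose u : cover_sub C := Sub x Sx; pose v : cover_sub C := Sub y Sy.
have -> : x * y = val (u * v) by rewrite valM !SubK.
exact: valP.
Qed.

Lemma cover_predV x : x \in S -> x^-1 \in S.
Proof.
move=> Sx; pose u : cover_sub C := Sub x Sx.
have -> : x^-1 = val (u^-1).
  by apply: (@mulgI _ x); rewrite mulgV -[x in x * _](SubK (cover_sub C) Sx)
    -valM mulgV val1.
exact: valP.
Qed.

Definition coset_rel x y : bool := (x^-1 * y) \in S.

Lemma coset_rel_refl : reflexive coset_rel.
Proof. by move=> x; rewrite /coset_rel mulVg cover_pred1. Qed.

Lemma coset_rel_sym : symmetric coset_rel.
Proof.
by move=> x y; apply/idP/idP => /cover_predV; rewrite invgM invgK.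
Qed.

Lemma coset_rel_trans : transitive coset_rel.
Proof.
move=> y x z xy yz; have := cover_predM xy yz.
by rewrite mulgA mulgK.
Qed.

Canonical coset_equiv :=
  EquivRel coset_rel coset_rel_refl coset_rel_sym coset_rel_trans.

Definition cover_quotient := {eq_quot coset_equiv}.
HB.instance Definition _ := Choice.on cover_quotient.

Definition coset_proj (x : G) : cover_quotient := \pi_{eq_quot coset_equiv} x.
Definition coset_repr (a : cover_quotient) : G := repr (a : {eq_quot coset_equiv}).

Lemma coset_reprK : cancel coset_repr coset_proj.
Proof. exact: reprK. Qed.

Lemma coset_eq x y : coset_proj x = coset_proj y <-> x^-1 * y \in S.
Proof. by split=> [/eqmodP//|h]; apply/eqmodP. Qed.

Definition quotient_one : cover_quotient := coset_proj 1.
Definition quotient_mul (a b : cover_quotient) : cover_quotient :=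
  coset_proj (coset_repr a * coset_repr b).
Definition quotient_inv (a : cover_quotient) : cover_quotient :=
  coset_proj (coset_repr a)^-1.

Lemma proj_quotient_mul x y :
  quotient_mul (coset_proj x) (coset_proj y) = coset_proj (x * y).
Proof.
apply/coset_eq.
have /coset_eq := coset_reprK (coset_proj x).
have /coset_eq := coset_reprK (coset_proj y).
set a := coset_repr _; set b := coset_repr _ => hx hy.
have -> : (b * a)^-1 * (x * y) = (a^-1 * y) * (b^-1 * x) ^ y.
  by rewrite invgM /conjg !mulgA mulgK.
by apply: cover_predM => //; exact: cover_normal.
Qed.

Lemma proj_quotient_inv x : quotient_inv (coset_proj x) = coset_proj x^-1.
Proof.
apply/coset_eq.
have /coset_eq := coset_reprK (coset_proj x).
set a := coset_repr _ => hx.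
have -> : (a^-1)^-1 * x^-1 = ((a^-1 * x)^-1) ^ (a^-1).
  by rewrite /conjg !invgM !invgK !mulgA mulgK.
by apply: cover_normal; exact: cover_predV.
Qed.

Lemma quotient_mulA : associative quotient_mul.
Proof.
move=> a b c; rewrite -[a]coset_reprK -[b]coset_reprK -[c]coset_reprK.
by rewrite !proj_quotient_mul mulgA.
Qed.

Lemma quotient_mul1 : left_id quotient_one quotient_mul.
Proof. by move=> a; rewrite -[a]coset_reprK proj_quotient_mul mul1g. Qed.

Lemma quotient_1mul : right_id quotient_one quotient_mul.
Proof. by move=> a; rewrite -[a]coset_reprK proj_quotient_mul mulg1. Qed.

Lemma quotient_mulV : left_inverse quotient_one quotient_inv quotient_mul.
Proof.
by move=> a; rewrite -[a]coset_reprK proj_quotient_inv proj_quotient_mul mulVg.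
Qed.

Lemma quotient_mulVr : right_inverse quotient_one quotient_inv quotient_mul.
Proof.
by move=> a; rewrite -[a]coset_reprK proj_quotient_inv proj_quotient_mul mulgV.
Qed.

HB.instance Definition _ := isGroup.Build cover_quotient
  quotient_mulA quotient_mul1 quotient_1mul quotient_mulV quotient_mulVr.

Lemma coset_projM x y : coset_proj (x * y) = coset_proj x * coset_proj y.
Proof. exact: esym (proj_quotient_mul x y). Qed.

End Quotient.

Definition borel_fun (S T : topologicalType) (f : S -> T) : Prop :=
  forall B, <<s [set U : set T | open U] >> B ->
            <<s [set U : set S | open U] >> (f @^-1` B).

Section Lifts.
Context {R : realType} {C D : polish_cover R}.
Variable phi : {multiplicative cover_quotient C -> cover_quotient D}.
Implicit Type f : cover_group C -> cover_group D.

Definition is_lift f : Prop := forall g, phi (coset_proj g) = coset_proj (f g).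

Definition borel_definable : Prop := exists2 f, is_lift f & borel_fun f.

Lemma defect_subproof f : is_lift f ->
  forall x y, f x * f y * (f (x * y))^-1 \in cover_pred D.
Proof.
move=> lf x y.
have /coset_eq h : coset_proj (f (x * y)) = coset_proj (f x * f y).
  by rewrite -lf !coset_projM gmulfM !lf.
have -> : f x * f y * (f (x * y))^-1 =
          ((f (x * y))^-1 * (f x * f y)) ^ (f (x * y))^-1.
  by rewrite /conjg invgK !mulgA mulgV mul1g.
exact: cover_normal.
Qed.

Definition defect f (lf : is_lift f) (p : cover_group C * cover_group C) :
    cover_sub D :=
  Sub (f p.1 * f p.2 * (f (p.1 * p.2))^-1) (defect_subproof lf p.1 p.2).

Definition approximately_multiplicative f (lf : is_lift f) : Prop :=
  f 1 = 1 /\ {for (1, 1), continuous (defect lf)}.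

End Lifts.

Definition monomial (R : realType) (m : nat) (h : 'rV[R]_m)
    (a : {ffun 'I_m -> nat}) : R :=
  (\prod_(i < m) h ord0 i ^+ a i)%R.

(* Convergence along [totally] is unconditional summability, which in ['rV_n]
   is absolute convergence of the multivariate power series. *)
Definition analytic_at (R : realType) (m n : nat) (f : 'rV[R]_m -> 'rV[R]_n)
    (x : 'rV[R]_m) : Prop :=
  exists c : {ffun 'I_m -> nat} -> 'rV[R]_n,
    \forall h \near (0 : 'rV[R]_m)%R,
      partial_sum (fun a => monomial h a *: c a)%R @ totally --> f (x + h)%R.

Record chart (R : realType) (T : topologicalType) (n : nat) := Chart {
  chart_dom : set T;
  chart_map :> T -> 'rV[R]_n;
  chart_inv : 'rV[R]_n -> T;
  chart_dom_open : open chart_dom;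
  chart_img_open : open (chart_map @` chart_dom);
  chart_mapK : {in chart_dom, cancel chart_map chart_inv};
  chart_map_continuous : {in chart_dom, continuous chart_map};
  chart_inv_continuous : {in chart_map @` chart_dom, continuous chart_inv}
}.

Record lie_structure (R : realType) (G : topologicalGroupType) := LieStructure {
  lie_dim : nat;
  lie_atlas : set (chart R G lie_dim);
  lie_atlas_cover : forall x, exists2 c, lie_atlas c & chart_dom c x;
  lie_atlas_compatible : forall c d x, lie_atlas c -> lie_atlas d ->
    chart_dom c x -> chart_dom d x -> analytic_at (d \o chart_inv c) (c x);
  (* [row_mx (c x) (d y)] are the coordinates of [(x, y)] in the product
     manifold [G * G]. *)
  lie_mul_analytic : forall c d e x y,
    lie_atlas c -> lie_atlas d -> lie_atlas e ->
    chart_dom c x -> chart_dom d y -> chart_dom e (x * y) ->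
    analytic_at (fun v : 'rV[R]_(lie_dim + lie_dim) =>
        e (chart_inv c (lsubmx v) * chart_inv d (rsubmx v)))
      (row_mx (c x) (d y));
  lie_inv_analytic : forall c d x,
    lie_atlas c -> lie_atlas d -> chart_dom c x -> chart_dom d x^-1 ->
    analytic_at (fun v => d (chart_inv c v)^-1) (c x)
}.

Arguments lie_atlas {R G} l _.

Definition lie_analytic_at (R : realType) (G H : topologicalGroupType)
    (LG : lie_structure R G) (LH : lie_structure R H) (f : G -> H) (x : G) : Prop :=
  {for x, continuous f} /\
  forall c d, lie_atlas LG c -> lie_atlas LH d ->
    chart_dom c x -> chart_dom d (f x) ->
    analytic_at (d \o f \o chart_inv c) (c x).

Record real_lie_cover (R : realType) := RealLieCover {
  lie_cover :> polish_cover R;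
  lie_cover_group : lie_structure R (cover_group lie_cover);
  lie_cover_sub : lie_structure R (cover_sub lie_cover)
}.

Definition analytic_near_one (R : realType) (C D : real_lie_cover R)
    (f : cover_group C -> cover_group D) : Prop :=
  exists2 U : set (cover_group C), open_nbhs 1 U &
    forall x, U x -> lie_analytic_at (lie_cover_group C) (lie_cover_group D) f x.

(* Main.v *)
Require Import Defs.
From HB Require Import structures.
From mathcomp Require Import all_boot all_order all_algebra finmap.
From mathcomp Require Import all_classical all_reals all_analysis.
From mathcomp.analysis.showcase Require Import summability.
From mathcomp Require Import ring lra.
Import numFieldNormedType.Exports.

Set Implicit Arguments.
Unset Strict Implicit.
Unset Printing Implicit Defensive.

Import Order.TTheory GRing.Theory Num.Theory.
Local Open Scope classical_set_scope.
Local Open Scope ring_scope.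

(* Idea.  Only the composite psi : G -> H/M of phi with the projection matters.  Along a
   one-parameter subgroup s |-> exp (s Y) of G, a Borel lift F of psi has its defect in M, which is
   a countable union of translates of a compact set.  By Baire category the defect lies, off a
   meager set, in a single translate on some box, so that F(s)^-1 F(s + t) does not depend on s up
   to a compact piece of M.  The pairs (t, h) compatible with these differences form a closed local
   semigroup over psi, and Cartan's argument (limits of directions of elements tending to the
   identity) extracts from it a vector Z with psi (exp (t Y)) = exp (t Z) M for small t.

   In coordinates of the second kind x = exp (t_1 Y_1) ... exp (t_n Y_n) the map
   g(x) = exp (t_1 Z_1) ... exp (t_n Z_n) is then an analytic lift near 1, and it is patched with
   the given Borel lift away from 1.  Its defect is continuous for the topology of H; on a segment
   issued from (1, 1) it cannot jump between the countably many plaques of M, because an interval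
   is not a countable union of at least two disjoint nonempty closed sets.  Hence it stays in a
   compact plaque, where the topologies of M and H agree.

   Analyticity is handled through the weighted norms sum |c_a| r^|a| of power series: the inverse
   function theorem and the exponential map, which solves exp (2 v) = exp v * exp v, are fixed
   points of contractions for these norms. *)

(* The obstacle is that [M] need not be closed in [H] (think of a dense line in a torus), so the
   quotient topology of H/M may fail to be Hausdorff and continuity of [phi] itself says little.
   Everything is therefore done in [H] with compact pieces of [M]: their images are closed in [H],
   countably many translates of one of them cover [M], and on them the two topologies agree.
   Countability of this cover comes from separability of [M] and enters twice: through Baire
   category in the plane, to find one translate on a box, and through the connectedness of an
   interval. Coordinates of the second kind fit the multiplicativity of [phi]: a product of lifts
   lifts the product, so each Z_i may come from its own curve. The doubling equation yields the
   exponential because halving turns second-order estimates into exact identities: a quantity that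
   is O(|v|^2) and doubles with v must vanish. *)
#[local] Existing Instance totally_filter.

(** * Unconditional sums *)

Section UnconditionalSums.
Context {R : realType} {I : choiceType}.
Implicit Types (x y : I -> R) (A B : {fset I}).

Definition hassum x (l : R) : Prop := partial_sum x @ totally --> l.

(** Absolute summability with an explicit constant: these constants become the weighted norms that
    the contractions below control. *)
Definition bsum x (C : R) : Prop := forall A, \sum_(i <- A) `|x i| <= C.

Lemma partial_sumE x A : partial_sum x A = \sum_(i <- A) x i.
Proof. by rewrite /partial_sum big_seq_fsetE. Qed.

Lemma big_fset_disjU x A B : [disjoint A & B]%fset ->
  \sum_(i <- (A `|` B)%fset) x i = \sum_(i <- A) x i + \sum_(i <- B) x i.
Proof.
move=> dAB; rewrite (big_fsetID _ (mem A)) /=; congr (_ + _).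
  by apply: eq_fbigl => i; rewrite !inE /= andbC; case: (i \in A); rewrite ?orbT.
apply: eq_fbigl => i; rewrite !inE /=; have [iA|iA] /= := boolP (i \in A).
  by apply/esym/negbTE; move/fdisjointP: dAB; apply.
by rewrite andbT.
Qed.

Lemma big_fset_subD x A B : (A `<=` B)%fset ->
  \sum_(i <- B) x i = \sum_(i <- A) x i + \sum_(i <- (B `\` A)%fset) x i.
Proof.
move=> AB; rewrite -big_fset_disjU; first by rewrite fsetUDl fsetDv fsetD0 (fsetUidPr _ _ AB).
by apply/fdisjointP => i iA; rewrite inE iA.
Qed.

Lemma ler_sum_fset x A B : (A `<=` B)%fset -> (forall i, 0 <= x i) ->
  \sum_(i <- A) x i <= \sum_(i <- B) x i.
Proof. by move=> AB x0; rewrite (big_fset_subD _ AB) lerDl sumr_ge0. Qed.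

Lemma hassumP x l : hassum x l <-> forall e, 0 < e ->
  exists A, forall B, (A `<=` B)%fset -> `|\sum_(i <- B) x i - l| < e.
Proof.
split=> [/cvgrPdist_lt h e e0|h].
  have [A _ AP] := h e e0; exists A => B AB.
  by rewrite distrC -partial_sumE; exact: AP.
apply/cvgrPdist_lt => e e0; have [A AP] := h e e0; exists A => // B /= AB.
by rewrite distrC partial_sumE; exact: AP.
Qed.

Lemma hassum_unique x l l' : hassum x l -> hassum x l' -> l = l'.
Proof. by move=> h h'; apply: cvg_unique h h'. Qed.

Lemma hassumD x y l m : hassum x l -> hassum y m -> hassum (x \+ y) (l + m).
Proof.
move=> hx hy; rewrite /hassum.
rewrite (_ : partial_sum _ = partial_sum x \+ partial_sum y); first exact: cvgD.
by apply/funext => A /=; rewrite !partial_sumE big_split.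
Qed.

Lemma hassumZ (a : R) x l : hassum x l -> hassum (fun i => a * x i) (a * l).
Proof.
move=> hx; rewrite /hassum.
rewrite (_ : partial_sum _ = fun A => a * partial_sum x A); last first.
  by apply/funext => A /=; rewrite !partial_sumE mulr_sumr.
by apply: cvgM => //; exact: cvg_cst.
Qed.

Arguments hassumZ a {x l}.

Lemma hassum_finite (A : {fset I}) x : (forall i, i \notin A -> x i = 0) ->
  hassum x (\sum_(i <- A) x i).
Proof.
move=> x0; apply/hassumP => e e0; exists A => B AB.
by rewrite (big_fset_incl _ AB) ?subrr ?normr0// => i _; exact: x0.
Qed.

Lemma bsum_finite (A : {fset I}) x : (forall i, i \notin A -> x i = 0) ->
  bsum x (\sum_(i <- A) `|x i|).
Proof.
move=> x0 B.
rewrite (big_fset_incl _ (fsubsetUl A B)); last first.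
  by move=> i _ /x0 ->; rewrite normr0.
by apply: ler_sum_fset => //; exact: fsubsetUr.
Qed.

Lemma bsum_ge0 x C : bsum x C -> 0 <= C.
Proof. by move=> /(_ fset0); rewrite big_seq_fset0. Qed.

Lemma bsum_le x y C : (forall i, `|y i| <= `|x i|) -> bsum x C -> bsum y C.
Proof. by move=> yx bx A; apply: le_trans (bx A); apply: ler_sum. Qed.

Lemma bsum_leC x C D : C <= D -> bsum x C -> bsum x D.
Proof. by move=> CD bx A; apply: le_trans CD. Qed.

Lemma bsumD x y C D : bsum x C -> bsum y D -> bsum (x \+ y) (C + D).
Proof.
move=> bx byy A; apply: le_trans (lerD (bx A) (byy A)).
by rewrite -big_split ler_sum// => i _; exact: ler_normD.
Qed.

Lemma bsumZ (a : R) x C : bsum x C -> bsum (fun i => a * x i) (`|a| * C).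
Proof.
move=> bx A; under eq_bigr do rewrite normrM.
by rewrite -mulr_sumr ler_wpM2l.
Qed.

Arguments bsumZ a {x C}.

Lemma bsum1 x C i : bsum x C -> `|x i| <= C.
Proof. by move=> /(_ [fset i]%fset); rewrite big_seq_fset1. Qed.

(** [B] nearly attains the supremum of the finite absolute sums, so a set disjoint from it adds at
    most [e]. *)
Lemma bsum_tail x C : bsum x C -> forall e, 0 < e ->
  exists B, forall A, [disjoint A & B]%fset -> \sum_(i <- A) `|x i| <= e.
Proof.
move=> bx e e0; pose S := [set \sum_(i <- A) `|x i| | A in [set: {fset I}]].
have hS : has_sup S.
  split; first by exists (\sum_(i <- fset0) `|x i|), fset0.
  by exists C => _ [A _ <-]; exact: bx.
have [_ [B _ <-] hB] := sup_adherent e0 hS.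
exists B => A dAB.
have : \sum_(i <- (A `|` B)%fset) `|x i| <= sup S.
  by apply: ub_le_sup; [exact: hS.2|exists (A `|` B)%fset].
rewrite big_fset_disjU//.
by move: hB; lra.
Qed.

Lemma bsum_hassum x C : bsum x C -> exists2 l, hassum x l & `|l| <= C.
Proof.
move=> bx.
have nonneg y : (forall i, 0 <= y i) -> bsum y C -> exists l, hassum y l.
  move=> y0 byC; pose S := [set \sum_(i <- A) y i | A in [set: {fset I}]].
  have hS : has_sup S.
    split; first by exists (\sum_(i <- fset0) y i), fset0.
    exists C => _ [A _ <-]; apply: le_trans (byC A).
    by apply: ler_sum => i _; exact: ler_norm.
  exists (sup S); apply/hassumP => e e0.
  have [_ [A _ <-] hA] := sup_adherent e0 hS.
  exists A => B AB.
  have h1 : \sum_(i <- B) y i <= sup S by apply: ub_le_sup; [exact: hS.2|exists B].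
  have h2 : \sum_(i <- A) y i <= \sum_(i <- B) y i.
    exact: ler_sum_fset.
  by rewrite ltr_norml; move: hA h1 h2; lra.
have [|l1 h1] := nonneg (fun i => `|x i|) (fun i => normr_ge0 _).
  by apply: bsum_le bx => i; rewrite normr_id.
(* This is the positive part of [x], which keeps the bound [C]; [x] is twice it minus [|x|]. *)
have bx2 : bsum (fun i => 2^-1 * (`|x i| + x i)) C.
  apply: bsum_le bx => i; rewrite normrM ger0_norm ?invr_ge0//.
  have := ler_normD (`|x i|) (x i); rewrite normr_id; lra.
have [|l2 h2] := nonneg _ _ bx2.
  by move=> i; have := ler_norm (- x i); rewrite normrN; lra.
have hx : hassum x (2 * l2 + -1 * l1).
  have := hassumD (hassumZ 2 h2) (hassumZ (-1) h1).
  rewrite (_ : (_ \+ _) = x)//; apply/funext => i /=; lra.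
exists (2 * l2 + -1 * l1) => //; apply/ler_addgt0Pr => e e0.
have /hassumP/(_ _ e0)[A /(_ A (fsubset_refl _))] := hx.
set s := \sum_(i <- A) x i => hA.
have : `|s| <= C by apply: le_trans (bx A); exact: ler_norm_sum.
have := ler_normD s (- (s - (2 * l2 + -1 * l1))); rewrite normrN opprB addrCA subrr addr0.
by move: hA; lra.
Qed.

Lemma hassum_le x l C : hassum x l -> bsum x C -> `|l| <= C.
Proof.
by move=> hx /bsum_hassum[l' hx' lC]; rewrite (hassum_unique hx hx').
Qed.

(** Cauchy's criterion with tolerance 1 bounds every finite sum disjoint from some [A] by 2, and
    splitting by sign gives 4 for the absolute values. This extracts a weighted norm from the
    unconditional convergence in [analytic_at]. *)
Lemma hassum_bsum x l : hassum x l -> exists C, bsum x C.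
Proof.
move=> /hassumP/(_ 1 ltr01)[A hA].
have h1 B : [disjoint B & A]%fset -> `|\sum_(i <- B) x i| <= 2.
  move=> dBA; have := hA (B `|` A)%fset (fsubsetUr _ _); have := hA A (fsubset_refl _).
  rewrite big_fset_disjU//.
  set a := \sum_(i <- A) x i; set b := \sum_(i <- B) x i => u v.
  have := ler_normD (b + a - l) (- (a - l)); rewrite normrN.
  rewrite (_ : b + a - l + _ = b); last by ring.
  by move: u v; lra.
have h2 B : [disjoint B & A]%fset -> \sum_(i <- B) `|x i| <= 4.
  move=> dBA.
  rewrite (big_fsetID _ (fun i => 0 <= x i)) /=.
  have e1 : \sum_(i <- [fset i | i in B & 0 <= x i]%fset) `|x i| <= 2.
    apply: le_trans (h1 [fset i | i in B & 0 <= x i]%fset _); last first.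
      by apply/fdisjointP => i; rewrite !inE /= => /andP[iB _]; move/fdisjointP: dBA; apply.
    apply: le_trans (ler_norm _); rewrite big_seq [leRHS]big_seq ler_sum// => i.
    by rewrite !inE /= => /andP[_ xi]; rewrite ger0_norm.
  have e2 : \sum_(i <- [fset i | i in B & ~~ (0 <= x i)]%fset) `|x i| <= 2.
    apply: le_trans (h1 [fset i | i in B & ~~ (0 <= x i)]%fset _); last first.
      by apply/fdisjointP => i; rewrite !inE /= => /andP[iB _]; move/fdisjointP: dBA; apply.
    rewrite -normrN -sumrN; apply: le_trans (ler_norm _).
    rewrite big_seq [leRHS]big_seq ler_sum// => i.
    by rewrite !inE /= -ltNge => /andP[_ xi]; rewrite ltr0_norm.
  by move: e1 e2; lra.
exists (4 + \sum_(i <- A) `|x i|) => B.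
rewrite (big_fsetID _ (mem A)) /= addrC lerD//.
  by apply: h2; apply/fdisjointP => i; rewrite !inE /= => /andP[].
apply: ler_sum_fset => //; apply/fsubsetP => i; by rewrite !inE /= => /andP[].
Qed.

End UnconditionalSums.
Arguments hassumZ {R I} a {x l}.
Arguments bsumZ {R I} a {x C}.

Section FiniteSums.
Context {R : realType} {I : choiceType}.

Lemma hassum_sum (J : Type) (s : seq J) (c : J -> I -> R) l :
  (forall j, hassum (c j) (l j)) ->
  hassum (fun i => \sum_(j <- s) c j i) (\sum_(j <- s) l j).
Proof.
move=> h; elim: s => [|j s ih].
  rewrite big_nil (_ : (fun _ => _) = fun=> 0); last first.
    by apply/funext => i; rewrite big_nil.
  have := @hassum_finite R I fset0 (fun=> 0) (fun _ _ => erefl).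
  by rewrite big_seq_fset0.
rewrite big_cons (_ : (fun _ => _) = c j \+ (fun i => \sum_(j <- s) c j i)).
  exact: hassumD.
by apply/funext => i; rewrite big_cons.
Qed.

Lemma hassum_tail (x : I -> R) s e (B : {fset I}) : hassum x s ->
  (forall A, [disjoint A & B]%fset -> \sum_(i <- A) `|x i| <= e) ->
  `|s - \sum_(i <- B) x i| <= e.
Proof.
move=> /hassumP hx tB; apply/ler_addgt0Pr => d d0.
have [A /(_ (B `|` A)%fset (fsubsetUr _ _))] := hx d d0.
rewrite (@big_fset_subD _ _ _ B) ?fsubsetUl//.
set b := \sum_(i <- B) _; set a := \sum_(i <- _) _ => h.
have ae : `|a| <= e.
  apply: le_trans (ler_norm_sum _ _ _) (tB _ _).
  by apply/fdisjointP => i; rewrite !inE => /andP[].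
have := ler_normD a (- (b + a - s)); rewrite normrN.
rewrite (_ : a - _ = s - b); [lra|ring].
Qed.

End FiniteSums.

Section Exchange.
Context {R : realType} {I K : choiceType}.

(** Multiplying [d i] by its sign turns a finite sum of absolute values into a sum over [k] of
    signed finite combinations of the [c k i], each bounded by [N k]. *)
Lemma bsum_exchange (c : K -> I -> R) N C :
  (forall k, bsum (c k) (N k)) -> bsum N C ->
  exists2 d : I -> R, (forall i, hassum (c^~ i) (d i)) & bsum d C.
Proof.
move=> cN NC.
have /choice[d hd] : forall i, exists d, hassum (c^~ i) d.
  move=> i; have [|d hd _] := @bsum_hassum R K (c^~ i) C; last by exists d.
  apply: bsum_le NC => k; apply: le_trans (bsum1 i (cN k)) _.
  exact: ler_norm.
exists d => // A; pose sg i : R := Num.sg (d i).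
rewrite (_ : \sum_(i <- A) `|d i| = \sum_(i <- A) sg i * d i); last first.
  by apply: eq_bigr => i _; rewrite normrEsg.
apply: le_trans (ler_norm _) _.
have := @hassum_sum R K I A (fun i k => sg i * c k i) _ (fun i => hassumZ (sg i) (hd i)).
move=> /hassum_le; apply; apply: bsum_le NC => k.
apply: le_trans (ler_norm_sum _ _ _) _; apply: le_trans (ler_norm (N k)).
apply: le_trans (cN k A); apply: ler_sum => i _.
rewrite normrM ler_piMl// /sg normr_sg.
by case: (_ == _) => //=.
Qed.

(** Outside a finite set [B] of indices [k] the double family contributes at most [e / 4]; on [B]
    the exchange is that of finite sums. *)
Lemma hassum_exchange (c : K -> I -> R) l N C d s :
  (forall k, bsum (c k) (N k)) -> bsum N C ->
  (forall k, hassum (c k) (l k)) -> (forall i, hassum (c^~ i) (d i)) ->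
  hassum l s -> hassum d s.
Proof.
move=> cN NC cl cd ls; apply/hassumP => e e0.
have e4 : 0 < e / 4 by rewrite divr_gt0.
have [B tB] := bsum_tail NC e4.
have tl A : [disjoint A & B]%fset -> \sum_(i <- A) `|l i| <= e / 4.
  move=> /tB; apply: le_trans; apply: ler_sum => k _.
  by apply: le_trans (hassum_le (cl k) (cN k)) (ler_norm _).
have h1 := hassum_tail ls tl.
have /hassumP/(_ _ e4)[A0 hA0] := @hassum_sum R I K B c l cl.
exists A0 => A /hA0 h2.
have h3 := @hassum_sum R K I A (fun i k => c k i) d cd.
have {h3} : `|\sum_(i <- A) d i - \sum_(k <- B) \sum_(i <- A) c k i| <= e / 4.
  apply: hassum_tail h3 _ => A' /tB; apply: le_trans; apply: ler_sum => k _.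
  apply: le_trans (ler_norm_sum _ _ _) _.
  by apply: le_trans (cN k A) (ler_norm _).
move: h2; rewrite exchange_big /= => h2 h3.
move: h1 h2 h3; set a := \sum_(i <- A) d i; set b := \sum_(k <- B) l k.
set w := \sum_(k <- B) _ => h1 h2 h3.
have := ler_normD (a - w) (w - b - (s - b)); have := ler_normB (w - b) (s - b).
rewrite (_ : a - w + _ = a - s); [lra|ring].
Qed.

End Exchange.

(** * Convergent power series *)

Section PSum.
Context {R : realType} {m : nat}.
Implicit Types (a b : {ffun 'I_m -> nat}) (h v : 'rV[R]_m) (f g : 'rV[R]_m -> R).

Definition mdeg a : nat := (\sum_i a i)%N.

(** [C] bounds the norm [sum |c_a| r^|a|], which is submultiplicative and compatible with
    substitution; [d] bounds the order of vanishing at 0 from below. Recording [d] is what turns a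
    smaller radius into a smaller norm. *)
Definition psum (d : nat) (r C : R) f : Prop :=
  exists c : {ffun 'I_m -> nat} -> R,
    [/\ bsum (fun a => c a * r ^+ mdeg a) C,
        (forall a, (mdeg a < d)%N -> c a = 0) &
        forall h, `|h| <= r -> hassum (fun a => monomial h a * c a) (f h)].

Lemma rV_normP v r : 0 <= r -> `|v| <= r <-> forall j, `|v ord0 j| <= r.
Proof.
move=> r0; rewrite [X in X <= _]/Num.norm /= mx_normrE; split=> [/bigmax_leP[_ h] j|h].
  exact: (h (ord0, j)).
by apply/bigmax_leP; split=> // -[i j] _ /=; rewrite ord1.
Qed.

Lemma monomial_bound h r a : `|h| <= r -> `|monomial h a| <= r ^+ mdeg a.
Proof.
move=> hr; have r0 := le_trans (normr_ge0 _) hr.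
rewrite /monomial normr_prod /mdeg -prodrXr; apply: ler_prod => i _.
by rewrite normr_ge0 normrX lerXn2r ?nnegrE//; move/rV_normP: hr; apply.
Qed.

Lemma psum_ge0 d r C f : psum d r C f -> 0 <= C.
Proof. by move=> [c [/bsum_ge0]]. Qed.

Lemma psum_bound d r C f h : psum d r C f -> `|h| <= r -> `|f h| <= C.
Proof.
move=> [c [bc _ hc]] hr; apply: hassum_le (hc _ hr) _.
apply: bsum_le bc => a; rewrite mulrC !normrM ler_wpM2l//.
apply: le_trans (monomial_bound _ hr) (ler_norm _).
Qed.

Lemma psum_eq d r C f g : (forall h, `|h| <= r -> f h = g h) ->
  psum d r C f -> psum d r C g.
Proof.
move=> fg [c [bc dc hc]]; exists c; split => // h hr.
by rewrite -fg//; exact: hc.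
Qed.

Lemma psum_le d d' r C C' f : (d' <= d)%N -> C <= C' ->
  psum d r C f -> psum d' r C' f.
Proof.
move=> dd CC [c [bc dc hc]]; exists c; split => //.
  exact: bsum_leC bc.
by move=> a ad; apply: dc; exact: leq_trans dd.
Qed.

(** Every surviving monomial has degree at least [d], so passing from radius [r] to [t * r] gains
    [t ^+ d]. For order 2 this gain beats division by the radius, hence small Lipschitz
    constants. *)
Lemma psum_shrink d r C f t : 0 <= t <= 1 -> 0 <= r ->
  psum d r C f -> psum d (t * r) (t ^+ d * C) f.
Proof.
move=> /andP[t0 t1] r0 [c [bc dc hc]]; exists c; split => //; last first.
  by move=> h hr; apply: hc; apply: le_trans hr _; rewrite ler_piMl.
have := bsumZ (t ^+ d) bc; rewrite ger0_norm ?exprn_ge0//.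
apply: bsum_le => a; have [/dc->|ad] := ltnP (mdeg a) d.
  by rewrite !mul0r mulr0.
rewrite exprMn mulrCA !normrM ler_wpM2r//.
by rewrite !ger0_norm ?exprn_ge0// -(subnK ad) exprD ler_piMl ?exprn_ge0// exprn_ile1.
Qed.

Lemma monomialZ t h a : monomial (t *: h) a = t ^+ mdeg a * monomial h a.
Proof.
rewrite /monomial /mdeg -prodrXr -big_split /=.
by apply: eq_bigr => i _; rewrite mxE exprMn.
Qed.

Lemma psum_scale d r C f t : 0 <= t <= 1 ->
  psum d r C f -> psum d r (t ^+ d * C) (fun h => f (t *: h)).
Proof.
move=> /andP[t0 t1] [c [bc dc hc]]; exists (fun a => t ^+ mdeg a * c a); split.
- have := bsumZ (t ^+ d) bc; rewrite ger0_norm ?exprn_ge0//.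
  apply: bsum_le => a; have [/dc->|ad] := ltnP (mdeg a) d.
    by rewrite !(mul0r, mulr0).
  rewrite -mulrA !normrM ler_wpM2r//.
  by rewrite !ger0_norm ?exprn_ge0// -(subnK ad) exprD ler_piMl ?exprn_ge0// exprn_ile1.
- by move=> a /dc ->; rewrite mulr0.
- move=> h hr; have := hc (t *: h).
  rewrite (_ : (fun a => monomial (t *: h) a * c a) =
    (fun a => monomial h a * (t ^+ mdeg a * c a))); last first.
    by apply/funext => a; rewrite monomialZ; ring.
  by apply; rewrite normrZ ger0_norm// (le_trans _ hr)// ler_piMl.
Qed.

Lemma psum_monomial r (l : R) b : 0 <= r ->
  psum (mdeg b) r (`|l| * r ^+ mdeg b) (fun h => l * monomial h b).
Proof.
move=> r0; exists (fun a => if a == b then l else 0); split.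
- have := @bsum_finite R _ [fset b]%fset
    (fun a => (if a == b then l else 0) * r ^+ mdeg a).
  rewrite big_seq_fset1 eqxx normrM (ger0_norm (exprn_ge0 _ _))//; apply.
  by move=> a; rewrite inE => /negbTE ->; rewrite mul0r.
- by move=> a; case: eqP => // ->; rewrite ltnn.
- move=> h _; have := @hassum_finite R _ [fset b]%fset
    (fun a => monomial h a * (if a == b then l else 0)).
  rewrite big_seq_fset1 eqxx mulrC; apply.
  by move=> a; rewrite inE => /negbTE ->; rewrite mulr0.
Qed.

(** Completeness of the weighted norm. The weighted coefficients are summed over [k] by
    [bsum_exchange] and the weight [r ^+ mdeg a] is divided out afterwards. Products, substitutions
    and limits of iterations are all instances. *)
Lemma psum_series (K : choiceType) d r (N : K -> R) C F f : 0 < r ->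
  (forall k, psum d r (N k) (F k)) -> bsum N C ->
  (forall h, `|h| <= r -> hassum (F^~ h) (f h)) -> psum d r C f.
Proof.
move=> r0 /choice[c hc] NC Ff.
have bc k : bsum (fun a => c k a * r ^+ mdeg a) (N k) by case: (hc k).
have [w hw bw] := bsum_exchange bc NC.
have re a : r ^+ mdeg a != 0 by rewrite expf_neq0// gt_eqF.
exists (fun a => w a / r ^+ mdeg a); split.
- by apply: bsum_le bw => a; rewrite mulfVK.
- move=> a ad; suff -> : w a = 0 by rewrite mul0r.
  apply: hassum_unique (hw a) _.
  rewrite (_ : (fun _ => _) = fun=> 0); last first.
    by apply/funext => k; have [_ -> //] := hc k; rewrite mul0r.
  have := @hassum_finite R K fset0 (fun=> 0) (fun _ _ => erefl).
  by rewrite big_seq_fset0.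
- move=> h hr.
  apply: (@hassum_exchange R _ K (fun k a => monomial h a * c k a) _ N C) NC _ _ (Ff _ hr).
  + move=> k; apply: bsum_le (bc k) => a.
    rewrite mulrC !normrM ler_wpM2l//; apply: le_trans (monomial_bound _ hr) (ler_norm _).
  + by move=> k; have [_ _] := hc k; apply.
  + move=> a; have := hassumZ (monomial h a / r ^+ mdeg a) (hw a).
    rewrite (_ : (fun k => _) = fun k => monomial h a * c k a); last first.
      by apply/funext => k; have := re a => ra; field.
    by rewrite mulrAC mulrA.
Qed.

Lemma psumD d r C D f g : psum d r C f -> psum d r D g ->
  psum d r (C + D) (fun h => f h + g h).
Proof.
move=> [c [bc dc hc]] [e [be de he]]; exists (fun a => c a + e a); split.
- apply: bsum_le (bsumD bc be) => a; by rewrite mulrDl.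
- by move=> a ad; rewrite dc// de// addr0.
- move=> h hr; have := hassumD (hc h hr) (he h hr).
  rewrite (_ : (_ \+ _) = (fun a => monomial h a * (c a + e a)))//.
  by apply/funext => a /=; rewrite mulrDr.
Qed.

Lemma psumZ d r C f l : psum d r C f -> psum d r (`|l| * C) (fun h => l * f h).
Proof.
move=> [c [bc dc hc]]; exists (fun a => l * c a); split.
- by apply: bsum_le (bsumZ l bc) => a; rewrite mulrA.
- by move=> a ad; rewrite dc// mulr0.
- move=> h hr; have := hassumZ l (hc h hr).
  rewrite (_ : (fun a => _) = (fun a => monomial h a * (l * c a)))//.
  by apply/funext => a /=; rewrite mulrCA.
Qed.

Lemma psum0 d r : psum d r 0 (fun=> 0).
Proof.
exists (fun=> 0); split => //.
- by move=> A; rewrite big1// => a _; rewrite mul0r normr0.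
- move=> h _; have := @hassum_finite R {ffun 'I_m -> nat} fset0 (fun a => monomial h a * 0).
  by rewrite big_seq_fset0; apply => a _; rewrite mulr0.
Qed.

Lemma psum_cst r l : 0 <= r -> psum 0 r `|l| (fun=> l).
Proof.
move=> r0; have := psum_monomial l [ffun=> 0%N] r0.
have -> : mdeg [ffun=> 0%N] = 0%N by rewrite /mdeg big1// => i _; rewrite ffunE.
rewrite expr0 mulr1; apply: psum_eq => h _.
by rewrite /monomial big1 ?mulr1// => i _; rewrite ffunE.
Qed.

Lemma mdeg_unit (i : 'I_m) : mdeg [ffun j => (j == i : nat)] = 1%N.
Proof.
rewrite /mdeg (bigD1 i)//= ffunE eqxx big1// => j /negbTE.
by rewrite ffunE => ->.
Qed.

Lemma monomial_unit h (i : 'I_m) : monomial h [ffun j => (j == i : nat)] = h ord0 i.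
Proof.
rewrite /monomial (bigD1 i)//= ffunE eqxx big1 ?mulr1// => j /negbTE.
by rewrite ffunE => ->.
Qed.

Lemma psum_coord r i : 0 <= r -> psum 1 r r (fun h => h ord0 i).
Proof.
move=> r0; have := psum_monomial 1 [ffun j => (j == i : nat)] r0.
rewrite mdeg_unit normr1 mul1r expr1; apply: psum_eq => h _.
by rewrite monomial_unit mul1r.
Qed.

Lemma monomialD h a b : monomial h [ffun i => (a i + b i)%N] = monomial h a * monomial h b.
Proof.
by rewrite /monomial -big_split; apply: eq_bigr => i _; rewrite ffunE exprD.
Qed.

Lemma mdegD a b : mdeg [ffun i => (a i + b i)%N] = (mdeg a + mdeg b)%N.
Proof. by rewrite /mdeg -big_split; apply: eq_bigr => i _; rewrite ffunE. Qed.

Lemma psum_mul_monomial d r C f b : 0 < r -> psum d r C f ->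
  psum (mdeg b + d) r (r ^+ mdeg b * C) (fun h => monomial h b * f h).
Proof.
move=> r0 [c [bc dc hc]].
pose F a h := c a * monomial h [ffun i => (b i + a i)%N].
apply: (@psum_series _ _ _ (fun a => `|c a| * r ^+ (mdeg b + mdeg a)) _ F) => //.
- move=> a; have [/dc ca|ad] := ltnP (mdeg a) d.
    rewrite /F ca normr0 !mul0r; apply: psum_eq (psum0 _ _) => h _.
    by rewrite mul0r.
  have := psum_monomial (c a) [ffun i => (b i + a i)%N] (ltW r0).
  by rewrite mdegD; apply: psum_le => //; rewrite leq_add2l.
- have := bsumZ (r ^+ mdeg b) bc; rewrite ger0_norm ?exprn_ge0 ?ltW//.
  apply: bsum_le => a; rewrite exprD !normrM normr_id.
  by rewrite mulrCA.
- move=> h hr; have := hassumZ (monomial h b) (hc h hr).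
  rewrite (_ : (fun a => _) = F^~ h)//.
  by apply/funext => a; rewrite /F monomialD; ring.
Qed.

(** Only the first factor is expanded: the product becomes a series of monomials times [g], to which
    [psum_series] applies. *)
Lemma psumM d d' r C D f g : 0 < r -> psum d r C f -> psum d' r D g ->
  psum (d + d') r (C * D) (fun h => f h * g h).
Proof.
move=> r0 [c [bc dc hc]] hg.
pose F a h := c a * (monomial h a * g h).
apply: (@psum_series _ _ _ (fun a => `|c a| * (r ^+ mdeg a * D)) _ F) => //.
- move=> a; have [/dc ca|ad] := ltnP (mdeg a) d.
    rewrite /F ca normr0 !mul0r; apply: psum_eq (psum0 _ _) => h _.
    by rewrite mul0r.
  have := psumZ (c a) (psum_mul_monomial a r0 hg).
  by apply: psum_le => //; rewrite leq_add2r.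
- have := bsumZ D bc; rewrite ger0_norm ?(psum_ge0 hg)// mulrC.
  apply: bsum_le => a; rewrite !normrM normr_id.
  by rewrite mulrA mulrC.
- move=> h hr; have := hassumZ (g h) (hc h hr).
  rewrite (_ : (fun a => _) = F^~ h) 1?mulrC//.
  by apply/funext => a; rewrite /F; ring.
Qed.

End PSum.

Section PSumComp.
Context {R : realType} {m : nat}.
Implicit Types (h : 'rV[R]_m) (f g : 'rV[R]_m -> R).

Definition vpsum (p d : nat) (r C : R) (u : 'rV[R]_m -> 'rV[R]_p) : Prop :=
  forall j, psum d r C (fun h => u h ord0 j).

Lemma psum_one r : 0 <= r -> psum 0 r 1 (fun _ : 'rV[R]_m => 1).
Proof. by move=> r0; have := @psum_cst R m r 1 r0; rewrite normr1. Qed.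

Lemma psumX d r C f n : 0 < r -> psum d r C f ->
  psum (n * d) r (C ^+ n) (fun h => f h ^+ n).
Proof.
move=> r0 hf; elim: n => [|n ih]; first by rewrite mul0n expr0; exact: (psum_one (ltW r0)).
have := psumM r0 hf ih; rewrite -mulSn -exprS.
by apply: psum_eq => h _; rewrite exprS.
Qed.

Lemma psum_prod (I : Type) (s : seq I) (d : I -> nat) r (C : I -> R) F : 0 < r ->
  (forall i, psum (d i) r (C i) (F i)) ->
  psum (\sum_(i <- s) d i) r (\prod_(i <- s) C i) (fun h => \prod_(i <- s) F i h).
Proof.
move=> r0 hF; elim: s => [|i s ih].
  rewrite !big_nil; apply: psum_eq (psum_one (ltW r0)) => h _.
  by rewrite big_nil.
rewrite !big_cons; have := psumM r0 (hF i) ih.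
by apply: psum_eq => h _; rewrite big_cons.
Qed.

Lemma psum_monomial_comp p (u : 'rV[R]_m -> 'rV[R]_p) d r rho b : 0 < r ->
  vpsum d r rho u ->
  psum (mdeg b * d) r (rho ^+ mdeg b) (fun h => monomial (u h) b).
Proof.
move=> r0 hu; rewrite /mdeg big_distrl /= -prodrXr.
by apply: psum_prod => // i; exact: psumX.
Qed.

Lemma vpsum_bound p (u : 'rV[R]_m -> 'rV[R]_p) d r C h : 0 <= C -> vpsum d r C u ->
  `|h| <= r -> `|u h| <= C.
Proof.
by move=> C0 hu hr; apply/rV_normP => // j; exact: psum_bound (hu j) hr.
Qed.

(** A monomial in [u] has norm at most [rho ^+ mdeg b], so the substituted series is dominated by
    the norm of [F] at radius [rho]; hence the bound [C] is unchanged. *)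
Lemma psum_comp p D d r rho C F (u : 'rV[R]_m -> 'rV[R]_p) : 0 < r -> 0 <= rho ->
  psum D rho C F -> vpsum d r rho u -> psum (D * d) r C (F \o u).
Proof.
move=> r0 rho0 [c [bc dc hc]] hu.
pose G b h := c b * monomial (u h) b.
apply: (@psum_series _ _ _ _ _ (fun b => `|c b| * rho ^+ mdeg b) _ G) => //.
- move=> b; have [/dc cb|bd] := ltnP (mdeg b) D.
    rewrite /G cb normr0 !mul0r; apply: psum_eq (psum0 _ _) => h _.
    by rewrite mul0r.
  have := psumZ (c b) (psum_monomial_comp b r0 hu).
  by apply: psum_le => //; rewrite leq_mul2r bd orbT.
- by apply: bsum_le bc => b; rewrite !normrM normr_id.
- move=> h hr; have /hc := vpsum_bound rho0 hu hr.
  rewrite (_ : (fun a => _) = G^~ h)//.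
  by apply/funext => a; rewrite /G mulrC.
Qed.

(* [U] and [V] stand for products of [n] factors of size [rho] that differ
   factor by factor by at most [delta]. *)
Let close r rho d' delta n U V :=
  [/\ psum 0 r (rho ^+ n) U, psum 0 r (rho ^+ n) V &
      psum d' r (n%:R * rho ^+ n.-1 * delta) (fun h => U h - V h)].

Let closeM r rho d' delta n n' U V U' V' : 0 < r ->
  close r rho d' delta n U V -> close r rho d' delta n' U' V' ->
  close r rho d' delta (n + n')%N (fun h => U h * U' h) (fun h => V h * V' h).
Proof.
move=> r0 [hU hV hUV] [hU' hV' hUV']; split; rewrite ?exprD.
- exact: (psumM r0 hU hU').
- exact: (psumM r0 hV hV').
have h1 := psumM r0 hUV hU'; have h2 := psumM r0 hV hUV'.
rewrite addn0 in h1; rewrite add0n in h2.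
have := psumD h1 h2.
rewrite (_ : _ + _ = (n + n')%:R * rho ^+ (n + n').-1 * delta); last first.
  case: n n' {hU hV hUV hU' hV' hUV' h1 h2} => [|n] [|n'].
  - by rewrite !(mul0r, mulr0, addr0).
  - by rewrite add0n !mul0r add0r expr0 mul1r.
  - by rewrite addn0 !mul0r mulr0 addr0 expr0 mulr1.
  - have -> : (n.+1 + n'.+1).-1 = (n + n').+1 by rewrite addnS addSn.
    by rewrite natrD /= !exprS !exprD; ring.
by apply: psum_eq => h _; ring.
Qed.

Lemma psum_monomial_diff p (u v : 'rV[R]_m -> 'rV[R]_p) d' r rho delta b : 0 < r ->
  vpsum 0 r rho u -> vpsum 0 r rho v -> vpsum d' r delta (fun h => u h - v h) ->
  psum d' r ((mdeg b)%:R * rho ^+ (mdeg b).-1 * delta)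
    (fun h => monomial (u h) b - monomial (v h) b).
Proof.
move=> r0 hu hv huv.
have close0 : close r rho d' delta 0 (fun=> 1) (fun=> 1).
  split; rewrite ?expr0; do ?exact: (psum_one (ltW r0)).
  by rewrite !mul0r; apply: psum_eq (psum0 _ _) => h _; rewrite subrr.
have closeX i n : close r rho d' delta n (fun h => u h ord0 i ^+ n) (fun h => v h ord0 i ^+ n).
  elim: n => [|n ih].
    by rewrite (_ : (fun _ => _) = fun=> 1)// (_ : (fun h => v h ord0 i ^+ 0) = fun=> 1).
  have := closeM r0 _ ih; move=> /(_ 1%N (fun h => u h ord0 i) (fun h => v h ord0 i)).
  rewrite add1n => h.
  rewrite (_ : (fun _ => _) = fun h => u h ord0 i * u h ord0 i ^+ n); last first.
    by apply/funext => ?; rewrite exprS.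
  rewrite (_ : (fun h => v h ord0 i ^+ n.+1) = fun h => v h ord0 i * v h ord0 i ^+ n); last first.
    by apply/funext => ?; rewrite exprS.
  apply: h; split; rewrite ?expr1 //.
  rewrite expr0 !mul1r; apply: psum_eq (huv i) => h _; by rewrite !mxE.
have closep (s : seq 'I_p) : close r rho d' delta (\sum_(i <- s) b i)%N
    (fun h => \prod_(i <- s) u h ord0 i ^+ b i) (fun h => \prod_(i <- s) v h ord0 i ^+ b i).
  elim: s => [|i s ih].
    rewrite big_nil (_ : (fun _ => _) = fun=> 1); last by apply/funext=> h; rewrite big_nil.
    by rewrite (_ : (fun h => \prod_(i <- [::]) _) = fun=> 1)//; apply/funext=> h; rewrite big_nil.
  rewrite big_cons (_ : (fun _ => _) = fun h =>
    u h ord0 i ^+ b i * \prod_(i <- s) u h ord0 i ^+ b i); last first.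
    by apply/funext=> h; rewrite big_cons.
  rewrite (_ : (fun h => \prod_(i <- i :: s) v h ord0 i ^+ b i) =
     fun h => v h ord0 i ^+ b i * \prod_(i <- s) v h ord0 i ^+ b i); last first.
    by apply/funext=> h; rewrite big_cons.
  exact: closeM.
by have [_ _] := closep (index_enum _).
Qed.

(** Mean value inequality for the weighted norm. A monomial of degree n contributes [n * rho^(n-1)],
    which the doubled radius absorbs because [n <= 2^n]; hence [2 * rho] in the hypothesis and
    [C / rho] in the conclusion. *)
Lemma psum_comp_diff p D d' r rho delta C F (u v : 'rV[R]_m -> 'rV[R]_p) :
  0 < r -> 0 < rho -> 0 <= delta -> psum D (2 * rho) C F ->
  vpsum 0 r rho u -> vpsum 0 r rho v -> vpsum d' r delta (fun h => u h - v h) ->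
  psum d' r (C / rho * delta) (fun h => F (u h) - F (v h)).
Proof.
move=> r0 rho0 delta0 [c [bc dc hc]] hu hv huv.
pose G b h := c b * (monomial (u h) b - monomial (v h) b).
apply: (@psum_series _ _ _ _ _ (fun b =>
  `|c b| * ((mdeg b)%:R * rho ^+ (mdeg b).-1 * delta)) _ G) => //.
- by move=> b; exact: psumZ (psum_monomial_diff b r0 hu hv huv).
- have := bsumZ (delta / rho) bc; rewrite ger0_norm; last by rewrite divr_ge0// ltW.
  have -> : C / rho * delta = delta / rho * C by ring.
  apply: bsum_le => b; have n2 := exprn_ge0 (mdeg b) (ltW (mulr_gt0 (ltr0Sn R 1) rho0)).
  have -> : `|delta / rho * (c b * (2 * rho) ^+ mdeg b)| =
      `|c b| * ((2 * rho) ^+ mdeg b / rho * delta).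
    by rewrite !normrM normfV (ger0_norm delta0) (gtr0_norm rho0) (ger0_norm n2); ring.
  rewrite normrM normr_id ler_wpM2l// ger0_norm; last first.
    by apply: mulr_ge0 => //; apply: mulr_ge0 => //; apply: exprn_ge0; exact: ltW.
  rewrite ler_wpM2r//; case: (mdeg b) => [|n].
    by rewrite mul0r expr0 mul1r invr_ge0 ltW.
  rewrite /= exprMn [rho ^+ n.+1]exprS.
  rewrite (_ : 2 ^+ n.+1 * (rho * rho ^+ n) / rho = 2 ^+ n.+1 * rho ^+ n); last by field;
    rewrite gt_eqF.
  apply: ler_wpM2r; first by apply: exprn_ge0; exact: ltW.
  by rewrite -natrX ler_nat ltnW// ltn_expl.
- move=> h hr; have r2 : rho <= 2 * rho by move: rho0; lra.
  have hu' := hc _ (le_trans (vpsum_bound (ltW rho0) hu hr) r2).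
  have hv' := hc _ (le_trans (vpsum_bound (ltW rho0) hv hr) r2).
  have := hassumD hu' (hassumZ (-1) hv'); rewrite mulN1r.
  rewrite (_ : (_ \+ _) = G^~ h)//.
  by apply/funext => a /=; rewrite /G; ring.
Qed.

End PSumComp.

Lemma psum_lipschitz (R : realType) m D rho C (F : 'rV[R]_m -> R) x y :
  0 < rho -> psum D (2 * rho) C F -> `|x| <= rho -> `|y| <= rho ->
  `|F x - F y| <= C / rho * `|x - y|.
Proof.
move=> rho0 hF xr yr.
(* Both points are viewed as constant power series on a ball of radius 1, an arbitrary choice. *)
have cst (z : 'rV[R]_m) c : `|z| <= c -> vpsum (m := m) 0 1 c (fun=> z).
  move=> zr j; apply: psum_le (psum_cst (z ord0 j) ler01) => //.
  by have /rV_normP := zr; apply; apply: le_trans zr.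
have := psum_comp_diff (d' :=
  0) ltr01 rho0 (normr_ge0 (x - y)) hF (cst _ _ xr) (cst _ _ yr) (cst _ _ (lexx _)).
by move=> /(psum_bound (h := 0)); apply; rewrite normr0.
Qed.

(** * Germs at the origin, filtered by the order of vanishing *)

Section Germ.
Context {R : realType}.

(** Order 0 is analyticity at 0, order 1 adds the value 0 there, order 2 also kills the linear part.
    Hiding the radius and the norm lets germs be composed freely. *)
Definition germ (m p d : nat) (u : 'rV[R]_m -> 'rV[R]_p) : Prop :=
  exists r C, [/\ 0 < r, 0 <= C & vpsum d r C u].

Context {m : nat}.

Lemma germ_shrink p d (u : 'rV[R]_m -> 'rV[R]_p) s : germ d u -> 0 < s ->
  exists r C, [/\ 0 < r <= s, 0 <= C & vpsum d r C u].
Proof.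
move=> [r [C [r0 C0 hu]]] s0; pose t := Num.min 1 (s / r).
have t0 : 0 < t by rewrite lt_min ltr01 divr_gt0.
have t1 : t <= 1 by rewrite ge_min lexx.
exists (t * r), (t ^+ d * C); split.
- by rewrite mulr_gt0//= -ler_pdivlMr// ge_min lexx orbT.
- by rewrite mulr_ge0// exprn_ge0// ltW.
- by move=> j; apply: psum_shrink => //; rewrite ltW.
Qed.

(** Positive order lets the norm fall below any [rho] when the radius shrinks; this is how an inner
    map enters the domain of an outer one in [germ_comp]. *)
Lemma germ_small p d (u : 'rV[R]_m -> 'rV[R]_p) s rho :
  germ d.+1 u -> 0 < s -> 0 < rho ->
  exists2 r, 0 < r <= s & vpsum d.+1 r rho u.
Proof.
move=> gu s0 rho0; have [r [C [/andP[r0 rs] C0 hu]]] := germ_shrink gu s0.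
have C1 : 0 < C + 1 by rewrite ltr_wpDl.
pose t := Num.min 1 (rho / (C + 1)).
have t0 : 0 < t by rewrite lt_min ltr01 divr_gt0.
have t1 : t <= 1 by rewrite ge_min lexx.
exists (t * r); first by rewrite mulr_gt0//= (le_trans _ rs)// ler_piMl// ltW.
move=> j; apply: psum_le (psum_shrink _ (ltW r0) (hu j)) => //; last by rewrite ltW.
rewrite exprS (@le_trans _ _ (t * (C + 1)))//; last first.
  by rewrite -ler_pdivlMr// ge_min lexx orbT.
rewrite -mulrA ler_wpM2l ?ltW// (@le_lt_trans _ _ C)// ?ltrDl//.
by rewrite ler_piMl// exprn_ile1// ltW.
Qed.

Lemma germ_eq p d (u v : 'rV[R]_m -> 'rV[R]_p) :
  (\forall h \near (0 : 'rV[R]_m), u h = v h) -> germ d u -> germ d v.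
Proof.
move=> /nbhs_ballP[e /= e0 uv] gu.
have [r [C [/andP[r0 re] C0 hu]]] := germ_shrink gu (divr_gt0 e0 (ltr0Sn R 1)).
exists r, C; split => // j; apply: psum_eq (hu j) => h hr.
rewrite uv// -ball_normE /= sub0r normrN (le_lt_trans hr)//.
by apply: le_lt_trans re _; rewrite ltr_pdivrMr// ltr_pMr// ltr1n.
Qed.

Lemma germ_ext p d (u v : 'rV[R]_m -> 'rV[R]_p) : (forall h, u h = v h) ->
  germ d u -> germ d v.
Proof. by move=> /funext ->. Qed.

Lemma germ_le p d d' (u : 'rV[R]_m -> 'rV[R]_p) : (d' <= d)%N -> germ d u -> germ d' u.
Proof.
move=> dd [r [C [r0 C0 hu]]]; exists r, C; split => // j.
exact: psum_le dd (lexx _) (hu j).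
Qed.

Lemma germZ p d a (u : 'rV[R]_m -> 'rV[R]_p) : germ d u -> germ d (fun h => a *: u h).
Proof.
move=> [r [C [r0 C0 hu]]]; exists r, (`|a| * C); split => //.
  by rewrite mulr_ge0.
by move=> j; apply: psum_eq (psumZ a (hu j)) => h _; rewrite mxE.
Qed.

Lemma germ_common p d q d' (u : 'rV[R]_m -> 'rV[R]_p) (v : 'rV[R]_m -> 'rV[R]_q) :
  germ d u -> germ d' v ->
  exists r C, [/\ 0 < r, 0 <= C, vpsum d r C u & vpsum d' r C v].
Proof.
have H p1 d1 p2 d2 (u1 : 'rV[R]_m -> 'rV[R]_p1) (u2 : 'rV[R]_m -> 'rV[R]_p2)
    r1 C1 r2 C2 : 0 < r1 -> r1 <= r2 -> 0 <= C1 -> 0 <= C2 ->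
    vpsum d1 r1 C1 u1 -> vpsum d2 r2 C2 u2 ->
    exists r C, [/\ 0 < r, 0 <= C, vpsum d1 r C u1 & vpsum d2 r C u2].
  move=> r10 r12 C10 C20 hu1 hu2; have r20 := lt_le_trans r10 r12.
  exists r1, (C1 + C2); split => //; first exact: addr_ge0.
    by move=> j; apply: psum_le (hu1 j) => //; rewrite lerDl.
  move=> j; have t1 : 0 <= r1 / r2 <= 1.
    by apply/andP; split; [rewrite divr_ge0// ltW|rewrite ler_pdivrMr// mul1r].
  have := psum_shrink t1 (ltW r20) (hu2 j); rewrite divfK ?gt_eqF//.
  apply: psum_le => //; rewrite ler_wpDl// ler_piMl//.
  by case/andP : t1 => ? ?; exact: exprn_ile1.
move=> [r1 [C1 [r10 C10 hu]]] [r2 [C2 [r20 C20 hv]]].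
have [r12|r12] := leP r1 r2; first exact: H hu hv.
have [r [C [? ? ? ?]]] := H _ _ _ _ _ _ _ _ _ _ r20 (ltW r12) C20 C10 hv hu.
by exists r, C.
Qed.

Lemma germD p d (u v : 'rV[R]_m -> 'rV[R]_p) : germ d u -> germ d v ->
  germ d (fun h => u h + v h).
Proof.
move=> gu gv; have [r [C [r0 C0 hu hv]]] := germ_common gu gv.
exists r, (C + C); split => //; first exact: addr_ge0.
by move=> j; apply: psum_eq (psumD (hu j) (hv j)) => h _; rewrite mxE.
Qed.

Lemma germB p d (u v : 'rV[R]_m -> 'rV[R]_p) : germ d u -> germ d v ->
  germ d (fun h => u h - v h).
Proof.
move=> gu gv; have := germD gu (germZ (-1) gv).
by apply: germ_ext => h; rewrite scaleN1r.
Qed.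

Lemma germ0 p d : germ d (fun _ : 'rV[R]_m => 0 : 'rV[R]_p).
Proof.
exists 1, 0; split => // j; apply: psum_eq (psum0 _ _) => h _.
by rewrite mxE.
Qed.

Lemma germ_sum p d (I : Type) (s : seq I) (u : I -> 'rV[R]_m -> 'rV[R]_p) :
  (forall i, germ d (u i)) -> germ d (fun h => \sum_(i <- s) u i h).
Proof.
move=> gu; elim: s => [|i s ih].
  by apply: germ_ext (germ0 _ _) => h; rewrite big_nil.
by apply: germ_ext (germD (gu i) ih) => h; rewrite big_cons.
Qed.

Lemma germ_cst p (c : 'rV[R]_p) : germ 0 (fun _ : 'rV[R]_m => c).
Proof.
exists 1, `|c|; split => // j; apply: psum_le (psum_cst (c ord0 j) ler01) => //.
by have /rV_normP := lexx `|c|; apply.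
Qed.

Lemma germ_id : germ 1 (fun h : 'rV[R]_m => h).
Proof. by exists 1, 1; split => // j; exact: psum_coord. Qed.

Lemma germ_coord p i (w : 'rV[R]_p) : germ 1 (fun h : 'rV[R]_m => h ord0 i *: w).
Proof.
exists 1, `|w|; split => // j.
apply: (@psum_le _ _ 1 1 1 (`|w ord0 j| * 1)) => //.
  by rewrite mulr1; have /rV_normP := lexx `|w|; apply.
apply: psum_eq (psumZ (w ord0 j) (psum_coord i ler01)) => h _.
by rewrite mxE mulrC.
Qed.

End Germ.

Section GermCalculus.
Context {R : realType} {m : nat}.
Implicit Types h : 'rV[R]_m.

Lemma germ_lin p (A : 'M[R]_(m, p)) : germ 1 (fun h => h *m A).
Proof.
have := germ_sum (index_enum 'I_m) (fun i => germ_coord i (row i A)).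
by apply: germ_ext => h; rewrite mulmx_sum_row.
Qed.

Lemma germ_comp p q D d (F : 'rV[R]_p -> 'rV[R]_q) (u : 'rV[R]_m -> 'rV[R]_p) :
  germ D F -> germ d.+1 u -> germ (D * d.+1) (fun h => F (u h)).
Proof.
move=> [rho [C [rho0 C0 hF]]] gu.
have [r /andP[r0 _] hu] := germ_small gu ltr01 rho0.
exists r, C; split => // j.
exact: (psum_comp r0 (ltW rho0) (hF j) hu).
Qed.

Lemma germ_row_mx p q d (u : 'rV[R]_m -> 'rV[R]_p) (v : 'rV[R]_m -> 'rV[R]_q) :
  germ d u -> germ d v -> germ d (fun h => row_mx (u h) (v h)).
Proof.
move=> gu gv; have [r [C [r0 C0 hu hv]]] := germ_common gu gv.
exists r, C; split => // j; case: (split_ordP j) => k ->.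
  by apply: psum_eq (hu k) => h _; rewrite row_mxEl.
by apply: psum_eq (hv k) => h _; rewrite row_mxEr.
Qed.

Lemma mdeg0 (a : {ffun 'I_m -> nat}) : mdeg a = 0%N -> a = [ffun=> 0%N].
Proof.
move/eqP; rewrite /mdeg sum_nat_eq0 => /forallP a0.
by apply/ffunP => i; rewrite ffunE; apply/eqP; exact: a0.
Qed.

Lemma mdeg1 (a : {ffun 'I_m -> nat}) : mdeg a = 1%N ->
  exists i, a = [ffun j => (j == i : nat)].
Proof.
move=> a1; have [i ai] : exists i, a i != 0%N.
  apply/existsP; apply: contra_eqT a1; rewrite negb_exists => /forallP a0.
  by rewrite /mdeg big1// => i _; apply/eqP; rewrite -[_ == _]negbK.
exists i; move: a1; rewrite /mdeg (bigD1 i)//=.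
move: ai; rewrite -lt0n; case E : (a i) => [//|n] _; rewrite addSn => -[] /eqP.
rewrite addn_eq0 => /andP[/eqP n0]; rewrite sum_nat_eq0 => /forallP h0.
apply/ffunP => j; rewrite ffunE; have [->|ji] := eqVneq j i; first by rewrite E n0.
by apply/eqP; move: (h0 j); rewrite ji.
Qed.

Lemma psum_vanish r C (f : 'rV[R]_m -> R) : 0 <= r -> f 0 = 0 ->
  psum 0 r C f -> psum 1 r C f.
Proof.
move=> r0 f0 [c [bc _ hc]]; exists c; split => // a; rewrite ltnS leqn0 => /eqP /mdeg0 ->.
have /hc : `|0 : 'rV[R]_m| <= r by rewrite normr0.
rewrite f0 => hz; apply/esym/(hassum_unique hz).
have := @hassum_finite R _ [fset ([ffun=> 0%N] : {ffun 'I_m -> nat})]%fset (fun a =>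
  monomial 0 a * c a).
rewrite big_seq_fset1 (_ : monomial 0 _ = 1) ?mul1r; last first.
  by rewrite /monomial big1// => i _; rewrite ffunE.
apply => b; rewrite inE => b0.
have [i bi] : exists i, b i != 0%N.
  apply/existsP; apply: contraNT b0; rewrite negb_exists => /forallP b0.
  by apply/eqP/ffunP => i; rewrite ffunE; apply/eqP; rewrite -[_ == _]negbK.
by rewrite /monomial (bigD1 i)//= mxE expr0n (negbTE bi) !mul0r.
Qed.

Lemma psum_linear_part r C (f : 'rV[R]_m -> R) : psum 1 r C f ->
  exists A : 'I_m -> R, psum 2 r C (fun h => f h - \sum_i h ord0 i * A i).
Proof.
move=> [c [bc dc hc]].
pose ei i : {ffun 'I_m -> nat} := [ffun j => (j == i : nat)].
exists (fun i => c (ei i)), (fun a => if mdeg a == 1%N then 0 else c a); split.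
- by apply: bsum_le bc => a; case: ifP => // _; rewrite mul0r normr0.
- move=> a; case: eqP => // /eqP a1; rewrite ltnS leq_eqVlt (negbTE a1) /=.
  exact: dc.
- move=> h hr; have := hassumD (hc h hr) (hassumZ (-1)
    (@hassum_sum R _ _ (index_enum 'I_m)
      (fun i a => if a == ei i then h ord0 i * c (ei i) else 0)
      (fun i => h ord0 i * c (ei i)) _)).
  rewrite mulN1r (_ : (_ \+ _) = (fun a => monomial h a * (if mdeg a == 1%N then 0 else c a))).
    apply => i; have := @hassum_finite R _ [fset ei i]%fset
       (fun a => if a == ei i then h ord0 i * c (ei i) else 0).
    by rewrite big_seq_fset1 eqxx; apply => a; rewrite inE => /negbTE ->.
  apply/funext => a /=; case: ifPn => [/eqP /mdeg1[i ->]|a1].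
    rewrite mulr0 (bigD1 i)//= eqxx monomial_unit big1 ?addr0 ?mulN1r ?subrr// => j ji.
    case: eqP => // /ffunP/(_ i); rewrite !ffunE eqxx.
    by rewrite eq_sym (negbTE ji).
  rewrite big1 ?mulr0 ?addr0// => i _; case: eqP => // ae.
  by move: a1; rewrite ae mdeg_unit.
Qed.

Lemma germ_vanish p (u : 'rV[R]_m -> 'rV[R]_p) : germ 0 u -> u 0 = 0 -> germ 1 u.
Proof.
move=> [r [C [r0 C0 hu]]] u0; exists r, C; split => // j.
by apply: psum_vanish (hu j); [exact: ltW|rewrite u0 mxE].
Qed.

Lemma germ_linear_part p (u : 'rV[R]_m -> 'rV[R]_p) : germ 1 u ->
  exists A : 'M[R]_(m, p), germ 2 (fun h => u h - h *m A).
Proof.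
move=> [r [C [r0 C0 hu]]].
have /choice[A hA] := fun j => psum_linear_part (hu j).
exists (\matrix_(i, j) A j i), r, C; split => // j.
apply: psum_eq (hA j) => h _; rewrite !mxE; congr (_ - _).
by apply: eq_bigr => i _; rewrite mxE.
Qed.

(** The radius is shrunk to [|h|] itself, and the order 2 yields the factor [(|h| / r) ^+ 2]. *)
Lemma germ_quad p (u : 'rV[R]_m -> 'rV[R]_p) : germ 2 u ->
  exists2 K, 0 <= K & \forall h \near (0 : 'rV[R]_m), `|u h| <= K * `|h| ^+ 2.
Proof.
move=> [r [C [r0 C0 hu]]]; exists (C / r ^+ 2).
  by rewrite divr_ge0// exprn_ge0// ltW.
apply/nbhs_ballP; exists r => //= h; rewrite -ball_normE /= sub0r normrN => hr.
have t1 : 0 <= `|h| / r <= 1.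
  by apply/andP; split; [rewrite divr_ge0// ltW|rewrite ler_pdivrMr// mul1r ltW].
have h2 : vpsum 2 `|h| ((`|h| / r) ^+ 2 * C) u.
  move=> j; have := psum_shrink t1 (ltW r0) (hu j).
  by rewrite divfK// gt_eqF.
apply: le_trans (vpsum_bound _ h2 (lexx _)) _.
  by apply: mulr_ge0 => //; apply: exprn_ge0; case/andP: t1.
by rewrite expr_div_n mulrAC -mulrA mulrC.
Qed.

Lemma germ_lipschitz p d (u : 'rV[R]_m -> 'rV[R]_p) : germ d u ->
  exists2 K, 0 <= K & exists2 r, 0 < r & forall x y, `|x| <= r -> `|y| <= r ->
    `|u x - u y| <= K * `|x - y|.
Proof.
move=> [r [C [r0 C0 hu]]]; have r2 : 0 < r / 2 by rewrite divr_gt0.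
exists (C / (r / 2)); first by rewrite divr_ge0// ltW.
exists (r / 2) => // x y xr yr; apply/rV_normP; first by rewrite mulr_ge0// divr_ge0// ltW.
move=> j; rewrite !mxE.
apply: (psum_lipschitz (D := d) r2 _ xr yr (F := fun h => u h ord0 j)).
by rewrite mulrCA divff// mulr1; exact: hu.
Qed.

Lemma germ_continuous p d (u : 'rV[R]_m -> 'rV[R]_p) : germ d u ->
  \forall x \near (0 : 'rV[R]_m), {for x, continuous u}.
Proof.
move=> /germ_lipschitz[K K0 [r r0 hK]].
apply/nbhs_ballP; exists r => //= x; rewrite -ball_normE /= sub0r normrN => xr.
apply/(@cvgrPdist_lt _ _ _ _ (nbhs_filter x)) => e e0.
have d0 : 0 < Num.min (r - `|x|) (e / (K + 1)).
  by rewrite lt_min subr_gt0 xr divr_gt0// ltr_wpDl.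
apply/nbhs_ballP; exists (Num.min (r - `|x|) (e / (K + 1))) => //= y.
rewrite -ball_normE /= lt_min => /andP[xy xye].
have yr : `|y| <= r.
  have := ler_normB x (x - y); rewrite opprB addrCA subrr addr0.
  by move: xy; lra.
apply: le_lt_trans (hK _ _ (ltW xr) yr) _.
rewrite ltr_pdivlMr ?ltr_wpDl// mulrDr mulr1 in xye.
by apply: le_lt_trans xye; rewrite mulrC lerDl.
Qed.

Lemma germ1_at0 p (u : 'rV[R]_m -> 'rV[R]_p) : germ 1 u -> u 0 = 0.
Proof.
move=> gu; apply/eqP; rewrite -normr_le0; apply/ler_addgt0Pr => e e0; rewrite add0r.
have [s /andP[s0 _] hs] := germ_small gu ltr01 e0.
by apply: vpsum_bound hs _; rewrite ?normr0 ltW.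
Qed.

Lemma germ_cvg p (u : 'rV[R]_m -> 'rV[R]_p) : germ 1 u -> u @ (0 : 'rV[R]_m) --> (0 : 'rV[R]_p).
Proof.
move=> gu; have /germ_continuous/nbhs_singleton := gu.
by rewrite /prop_for /continuous_at germ1_at0.
Qed.

(** Recentering is substitution of [x + h], whose norm on the ball of radius [r / 2] is at most [r]
    when [|x| < r / 2]. *)
Lemma germ_near p (u : 'rV[R]_m -> 'rV[R]_p) : germ 0 u ->
  \forall x \near (0 : 'rV[R]_m), germ 0 (fun h => u (x + h)).
Proof.
move=> [r [C [r0 C0 hu]]]; have r2 : 0 < r / 2 by rewrite divr_gt0.
apply/nbhs_ballP; exists (r / 2) => //= x; rewrite -ball_normE /= sub0r normrN => xr.
exists (r / 2), C; split => // j.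
have hv : vpsum 0 (r / 2) r (fun h => x + h).
  move=> k; have := psumD (psum_cst (x ord0 k) (ltW r2)) (psum_le (leq0n 1) (lexx _) (psum_coord
    k (ltW r2))).
  move=> /(psum_le (leqnn 0) (C' := r)) H; apply: psum_eq (H _) => [h _|].
    by rewrite mxE.
  have /rV_normP/(_ k) := ltW xr; have := ltW r2; lra.
exact: (psum_comp r2 (ltW r0) (hu j) hv).
Qed.

End GermCalculus.

(** * Fixed points of contractions on power series *)

Section FixedPoint.
Context {R : realType}.

(** The constant 4 is [1 / (1 - 3/4)], for the contraction ratio 3/4 of the iteration below. *)
Lemma geometric_fset n (A : {fset nat}) : (forall k, k \in A -> (n <= k)%N) ->
  \sum_(k <- A) (3 / 4 : R) ^+ k <= 4 * (3 / 4) ^+ n.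
Proof.
move=> nA.
have q0 k : 0 <= (3 / 4 : R) ^+ k by apply: exprn_ge0; lra.
suff H : forall j (B : {fset nat}), (forall k, k \in B -> (n <= k < n + j)%N) ->
    \sum_(k <- B) (3 / 4 : R) ^+ k <= 4 * (3 / 4) ^+ n - 4 * (3 / 4) ^+ (n + j).
  apply: le_trans (H (\sum_(k <- A) k.+1)%N A _) _; last by have :=
    q0 (n + \sum_(k <- A) k.+1)%N; lra.
  move=> k kA; rewrite nA//= (leq_trans _ (leq_addl _ _))//.
  by rewrite (big_fsetD1 k)//= leq_addr.
elim=> [|j ih] B hB.
  rewrite addn0 subrr (_ : B = fset0) ?big_seq_fset0//.
  by apply/fsetP => k; rewrite inE; apply/negP => /hB; rewrite addn0 => /andP[]; case: ltngtP.
have [kB|kB] := boolP ((n + j)%N \in B).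
  rewrite (big_fsetD1 (n + j)%N)//=.
  have := ih (B `\ (n + j)%N)%fset; rewrite addnS exprS => /(_ _)/le_trans H.
  have {}H := lerD (lexx ((3 / 4) ^+ (n + j))) (H _ _ (lexx _)).
  apply: le_trans (H _) _; last by lra.
  by move=> k; rewrite !inE => /andP[kj /hB/andP[->]]; rewrite addnS ltnS leq_eqVlt (negbTE kj).
apply: le_trans (ih B _) _; last by rewrite addnS exprS; have := q0 (n + j)%N; lra.
move=> k kB'; have /andP[->] := hB k kB'; rewrite addnS ltnS leq_eqVlt.
by case: eqP => // E; rewrite -E kB' in kB.
Qed.

Lemma telescope_fset n : exists B : {fset nat}, (forall k, (k \in B) = (k < n)%N) /\
  forall g : nat -> R, \sum_(k <- B) (g k.+1 - g k) = g n - g 0%N.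
Proof.
elim: n => [|n [B [BE Bs]]].
  by exists fset0; split=> [k|g]; rewrite ?inE// big_seq_fset0 subrr.
exists (n |` B)%fset; split => [k|g].
  by rewrite !inE BE ltnS [(k <= n)%N]leq_eqVlt.
by rewrite big_fsetU1 ?BE ?ltnn//= Bs addrA subrK.
Qed.

Context {m : nat}.

Lemma rV_subE p (u v : 'rV[R]_p) j : (u - v) ord0 j = u ord0 j - v ord0 j.
Proof. by rewrite !mxE. Qed.

Lemma vpsum_eq p d r C (u v : 'rV[R]_m -> 'rV[R]_p) :
  (forall h, u h = v h) -> vpsum d r C u -> vpsum d r C v.
Proof. by move=> /funext ->. Qed.

Lemma fixpoint_bounds (F : 'rV[R]_m -> 'rV[R]_m) : germ 2 F ->
  exists rho C, [/\ 0 < rho, 0 <= C, C / rho <= 4^-1 & vpsum 2 (2 * rho) C F].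
Proof.
move=> [r [C [r0 C0 hF]]]; have C1 : 0 < 16 * (C + 1) by rewrite mulr_gt0// ltr_wpDl.
(* At radius [2 * rho] the order 2 gives norm [(2 * rho / r) ^+ 2 * C]. Divided by [rho] it is
   [4 * rho * C / r ^+ 2], which the second term of the minimum brings below 1/4. *)
pose rho := Num.min (r / 2) (r ^+ 2 / (16 * (C + 1))).
have rho0 : 0 < rho by rewrite lt_min !divr_gt0// exprn_gt0.
have t1 : 0 <= 2 * rho / r <= 1.
  apply/andP; split; first by rewrite divr_ge0 ?mulr_ge0// ltW.
  by rewrite ler_pdivrMr// mul1r mulrC -ler_pdivlMr// ge_min lexx.
exists rho, ((2 * rho / r) ^+ 2 * C); split => //.
- by rewrite mulr_ge0// sqr_ge0.
- rewrite (_ : _ / rho = 4 * rho * C / r ^+ 2); last by field; rewrite !gt_eqF.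
  rewrite ler_pdivrMr ?exprn_gt0//.
  have : rho * (16 * (C + 1)) <= r ^+ 2 by rewrite -ler_pdivlMr// ge_min lexx orbT.
  have : 0 <= rho * C by rewrite mulr_ge0// ltW.
  move: rho0; nra.
- move=> j; have := psum_shrink t1 (ltW r0) (hF j).
  by rewrite divfK// gt_eqF.
Qed.

(* Solves [e v = al e (la v) + be F (la v + e (la v))]; the inverse function theorem is the case
   (al, be, la) = (0, -1, 1), the exponential map the case (2, 1, 1/2). *)
Section Iteration.
Variables (F : 'rV[R]_m -> 'rV[R]_m) (al be la rho C : R).
Hypotheses (rho0 : 0 < rho) (Crho : C / rho <= 4^-1)
  (hF : vpsum 2 (2 * rho) C F).
Hypotheses (hal : `|al| * la ^+ 2 <= 2^-1) (hbe : `|be| <= 1) (hla : 0 <= la <= 1).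

Let r := rho / 2.
Let Phi (e : 'rV[R]_m -> 'rV[R]_m) h := al *: e (la *: h) + be *: F (la *: h + e (la *: h)).

Let r0 : 0 < r. Proof. by rewrite divr_gt0. Qed.

Let la2 : 0 <= la ^+ 2 <= 1.
Proof. by case/andP: hla => ? ?; rewrite exprn_ge0//= exprn_ile1. Qed.

(** The ratio 3/4 is 1/2 + 1/4: scaling the argument by [la] multiplies the norm of an order 2 map
    by [la ^+ 2], which [hal] compares with 1/2, and [F] has Lipschitz constant at most [C / rho],
    hence at most 1/4. *)
Let step e e' delta : 0 <= delta ->
  vpsum 2 r (rho / 2) e -> vpsum 2 r (rho / 2) e' ->
  vpsum 2 r delta (fun h => e' h - e h) ->
  vpsum 2 r (3 / 4 * delta) (fun h => Phi e' h - Phi e h).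
Proof.
move=> d0 he he' hd.
have hu (f : 'rV[R]_m -> 'rV[R]_m) : vpsum 2 r (rho / 2) f -> vpsum 0 r rho (fun h => h + f h).
  move=> hf k; have :=
    psumD (psum_le (leq0n 1) (lexx _) (psum_coord k (ltW r0))) (psum_le (leq0n 2) (lexx _) (hf k)).
  rewrite (_ : r + rho / 2 = rho) => [H|]; last by rewrite /r; lra.
  by apply: psum_eq H => h _; rewrite mxE.
have hD j : psum 2 r (4^-1 * delta) (fun h => F (h + e' h) ord0 j - F (h + e h) ord0 j).
  have hd' : vpsum 2 r delta (fun h => (h + e' h) - (h + e h)).
    by apply: vpsum_eq hd => h; rewrite opprD addrACA subrr add0r.
  have := psum_comp_diff r0 rho0 d0 (hF j) (hu _ he') (hu _ he) hd'.
  by apply: psum_le => //; rewrite ler_wpM2r.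
move=> j.
have h1 := psumZ be (psum_scale hla (hD j)).
have h2 := psumZ al (psum_scale hla (hd j)).
have := psumD h2 h1.
move=> /(@psum_le _ _ 2 2 _ _ (3 / 4 * delta) _ (leqnn _)) H.
apply: psum_eq (H _) => [h _|]; first by rewrite !mxE; ring.
rewrite mulrA [X in X * _ + _]mulrC.
have b1 : `|be| * (la ^+ 2 * (4^-1 * delta)) <= 4^-1 * delta.
  have d4 : 0 <= 4^-1 * delta by rewrite mulr_ge0.
  apply: le_trans (_ : la ^+ 2 * (4^-1 * delta) <= _).
    by rewrite ler_piMl// mulr_ge0//; case/andP: la2.
  by rewrite ler_piMl//; case/andP: la2.
have b2 := ler_wpM2r d0 hal.
by move: b1 b2; rewrite [la ^+ 2 * `|al|]mulrC; lra.
Qed.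

Let E n := iter n Phi (fun=> 0).
(** Bound on the first iterate: [F] has norm at most [rho / 4] at radius [2 * rho], and the four
    times smaller radius [r] gains 1/16 by the order 2. The whole geometric series then stays below
    [4 * d0 = rho / 16], well inside [rho / 2]. *)
Let d0 := rho / 64.

Let E_bounds n :
  vpsum 2 r (4 * d0 * (1 - (3 / 4) ^+ n)) (E n) /\
  vpsum 2 r ((3 / 4) ^+ n * d0) (fun h => E n.+1 h - E n h).
Proof.
have q1 k : 0 <= (3 / 4 : R) ^+ k <= 1.
  by rewrite exprn_ge0 ?exprn_ile1//; lra.
elim: n => [|n [ih1 ih2]].
  split; rewrite expr0.
    by rewrite subrr mulr0 => j; apply: psum_eq (psum0 _ _) => h _; rewrite mxE.
  rewrite mul1r => j.
  have F1 : psum 2 r d0 (fun h => F h ord0 j).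
    have t4 : 0 <= (4^-1 : R) <= 1 by apply/andP; split; lra.
    have rr : 0 <= 2 * rho by rewrite mulr_ge0// ltW.
    have := psum_shrink t4 rr (hF j).
    rewrite (_ : 4^-1 * (2 * rho) = r); last by rewrite /r; lra.
    apply: psum_le => //.
    by move: Crho; rewrite ler_pdivrMr// /d0; lra.
  have := psumZ be (psum_scale hla F1).
  move=> /(@psum_le _ _ 2 2 _ _ d0 _ (leqnn _)) H.
  apply: psum_eq (H _) => [h _|]; first by rewrite /= /Phi scaler0 add0r addr0 subr0 !mxE.
  have dd : 0 <= d0 by rewrite divr_ge0// ltW.
  apply: le_trans (_ : la ^+ 2 * d0 <= _).
    by rewrite ler_piMl// mulr_ge0//; case/andP: la2.
  by rewrite ler_piMl//; case/andP: la2.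
have dd : 0 <= d0 by rewrite divr_ge0// ltW.
have small k : 4 * d0 * (1 - (3 / 4) ^+ k) <= rho / 2.
  have /andP[k0 k1] := q1 k.
  have := mulr_ge0 dd k0; rewrite mulrBr mulr1; move: rho0; rewrite /d0; lra.
have ih1' : vpsum 2 r (4 * d0 * (1 - (3 / 4) ^+ n.+1)) (E n.+1).
  move=> j; apply: psum_le (psum_eq _ (psumD (ih1 j) (ih2 j))) => //.
    by rewrite exprS; lra.
  by move=> h _; rewrite rV_subE addrC subrK.
split => //.
have : vpsum 2 r (3 / 4 * ((3 / 4) ^+ n * d0)) (fun h => Phi (E n.+1) h - Phi (E n) h).
  apply: step ih2 => //.
  - by rewrite mulr_ge0//; case/andP: (q1 n).
  - by move=> j; exact: psum_le (small n) (ih1 j).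
  - by move=> j; exact: psum_le (small n.+1) (ih1' j).
by rewrite mulrA -exprS.
Qed.

Lemma iteration_limit : exists2 e, vpsum 2 r (rho / 2) e & forall h, `|h| <= r -> e h = Phi e h.
Proof.
have dd : 0 <= d0 by rewrite divr_ge0// ltW.
have q0 k : 0 <= (3 / 4 : R) ^+ k by apply: exprn_ge0; lra.
have bN : bsum (fun n => (3 / 4) ^+ n * d0) (4 * d0).
  move=> A; rewrite (eq_bigr (fun n => (3 / 4) ^+ n * d0)); last first.
    by move=> n _; rewrite ger0_norm// mulr_ge0.
  rewrite -mulr_suml ler_wpM2r//.
  by have := @geometric_fset 0 A (fun _ _ => leq0n _); rewrite expr0 mulr1.
have bE h j : `|h| <= r -> bsum (fun n => (E n.+1 h - E n h) ord0 j) (4 * d0).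
  move=> hr; apply: bsum_le bN => n; have [_ /(_ j) H] := E_bounds n.
  by apply: le_trans (psum_bound H hr) (ler_norm _).
have /choice[e he] : forall h, exists w : 'rV[R]_m, `|h| <= r -> forall j,
    hassum (fun n => (E n.+1 h - E n h) ord0 j) (w ord0 j).
  move=> h; have [hr|hr] := boolP (`|h| <= r); last by exists 0.
  have /choice[w hw] : forall j, exists l, hassum (fun n => (E n.+1 h - E n h) ord0 j) l.
    by move=> j; have [l hl _] := bsum_hassum (bE h j hr); exists l.
  by exists (\row_j w j) => _ j; rewrite mxE.
(* The limit is the telescoping series of the [E n.+1 - E n], so [psum_series] makes it a power
   series. *)
have e2 : vpsum 2 r (4 * d0) e.
  move=> j; apply: (psum_series (F := fun n h => (E n.+1 h - E n h) ord0 j) r0 _ bN).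
    by move=> n; have [_] := E_bounds n; apply.
  by move=> h hr; exact: he.
have e2' : vpsum 2 r (rho / 2) e.
  by move=> j; apply: psum_le (e2 j) => //; rewrite /d0; move: rho0; lra.
exists e => // h hr.
have b0 n : 0 <= 4 * (3 / 4) ^+ n * d0.
  by apply: mulr_ge0 => //; exact: mulr_ge0.
have tl x n : `|x| <= r -> `|e x - E n x| <= 4 * (3 / 4) ^+ n * d0.
  move=> xr; apply/rV_normP => //.
  move=> j; have [B [BE Bs]] := telescope_fset n.
  have := hassum_tail (e := 4 * (3 / 4) ^+ n * d0) (B := B) (he x xr j).
  under eq_bigr do rewrite rV_subE.
  rewrite (Bs (fun k => E k x ord0 j)) {2}/E /= !mxE subr0; apply => A dA.
  apply: le_trans (_ : \sum_(i <- A) (3 / 4) ^+ i * d0 <= _).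
    apply: ler_sum => i _; have [_ /(_ j) H] := E_bounds i.
    exact: psum_bound H xr.
  rewrite -mulr_suml ler_wpM2r// geometric_fset// => k kA.
  by rewrite leqNgt -BE; move/fdisjointP: dA; apply.
have lhr : `|la *: h| <= r.
  by case/andP: hla => l0 l1; rewrite normrZ ger0_norm// (le_trans _ hr)// ler_piMl.
have lE x n : `|x| <= r -> `|x + E n x| <= rho.
  move=> xr; apply: le_trans (ler_normD _ _) _.
  have : `|E n x| <= 4 * d0.
    have dq : 4 * d0 * (1 - (3 / 4) ^+ n) <= 4 * d0.
      by have := mulr_ge0 dd (q0 n); lra.
    have [H _] := E_bounds n; apply: vpsum_bound xr; last first.
      by move=> j; exact: psum_le (leqnn _) dq (H j).
    by rewrite mulr_ge0.
  by move: xr rho0; rewrite /r /d0; lra.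
have le' x : `|x| <= r -> `|x + e x| <= rho.
  move=> xr; apply: le_trans (ler_normD _ _) _.
  have := vpsum_bound (mulr_ge0 (ler0n _ 4) dd) e2 xr.
  by move: xr rho0; rewrite /r /d0; lra.
(* Both sides of the fixed point equation are compared with [E n.+1], which is [Phi (E n)]. *)
have key n : `|e h - Phi e h| <= (8 + `|al| * 4) * (3 / 4) ^+ n * d0.
  have h1 := tl h n.+1 hr.
  have h2 : `|Phi (E n) h - Phi e h| <= (4 + `|al| * 4) * (3 / 4) ^+ n * d0.
    have t2 := tl _ n lhr.
    rewrite /Phi (_ : _ - _ = al *: (E n (la *: h) - e (la *: h)) +
      be *: (F (la *: h + E n (la *: h)) - F (la *: h + e (la *: h)))); last first.
      by rewrite !scalerBr opprD addrACA.
    apply: le_trans (ler_normD _ _) _; rewrite !normrZ.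
    have F1 : `|F (la *: h + E n (la *: h)) - F (la *: h + e (la *: h))| <= 4 * (3 / 4) ^+ n * d0.
      apply/rV_normP => //.
      move=> j; rewrite !mxE.
      apply: le_trans (psum_lipschitz rho0 (hF j) (lE _ n lhr) (le' _ lhr)) _.
      rewrite opprD addrACA subrr add0r distrC.
      apply: le_trans (_ : 4^-1 * `|e (la *: h) - E n (la *: h)| <= _).
        by rewrite ler_wpM2r.
      by move: t2; have := normr_ge0 (e (la *: h) - E n (la *: h)); lra.
    have F2 : `|be| * `|F (la *: h + E n (la *: h)) - F (la *: h + e (la *: h))| <= 4 * (3 / 4)
      ^+ n * d0.
      by apply: le_trans F1; rewrite ler_piMl.
    have := ler_wpM2l (normr_ge0 al) t2; rewrite distrC.
    by move: F2; lra.
  have := ler_normD (e h - E n.+1 h) (E n.+1 h - Phi e h); rewrite addrA subrK.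
  move: h1 h2; rewrite exprS /=.
  have := mulr_ge0 (q0 n) dd; lra.
have K0 : 0 <= 8 + `|al| * 4 by rewrite addr_ge0// mulr_ge0.
apply/eqP; rewrite -subr_eq0 -normr_le0; apply/ler_addgt0Pr => eps eps0; rewrite add0r.
have K1 : 0 < (8 + `|al| * 4) * d0 + 1 by rewrite ltr_wpDl// mulr_ge0.
have cv : (3 / 4 : R) ^+ n @[n --> \oo] --> 0.
  by apply: cvg_expr; rewrite ger0_norm; lra.
have := cvgr_lt _ cv _ (divr_gt0 eps0 K1).
move=> [n _ /(_ n (leqnn _)) /= hn].
apply: le_trans (key n) _.
have h3 : (3 / 4) ^+ n * ((8 + `|al| * 4) * d0 + 1) < eps by rewrite -ltr_pdivlMr.
by move: h3 (q0 n); lra.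
Qed.

End Iteration.

Lemma germ_fixpoint (F : 'rV[R]_m -> 'rV[R]_m) al be la : germ 2 F ->
  `|al| * la ^+ 2 <= 2^-1 -> `|be| <= 1 -> 0 <= la <= 1 ->
  exists2 e : 'rV[R]_m -> 'rV[R]_m, germ 2 e & \forall h \near (0 : 'rV[R]_m),
    e h = al *: e (la *: h) + be *: F (la *: h + e (la *: h)).
Proof.
move=> /fixpoint_bounds[rho [C [rho0 C0 Crho hF]]] hal hbe hla.
have [e he eE] := iteration_limit rho0 Crho hF hal hbe hla.
have r0 : 0 < rho / 2 by rewrite divr_gt0.
exists e; first by exists (rho / 2), (rho / 2); split => //; exact: ltW.
apply/nbhs_ballP; exists (rho / 2) => //= h; rewrite -ball_normE /= sub0r normrN => hr.
by apply: eE; exact: ltW.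
Qed.

End FixedPoint.

(** * Inverse functions and analytic maps *)

Section Analytic.
Context {R : realType}.

Lemma germ2_contraction m p (f : 'rV[R]_m -> 'rV[R]_p) : germ 2 f ->
  exists2 r, 0 < r & forall x y, `|x| <= r -> `|y| <= r ->
    `|f x - f y| <= 2^-1 * `|x - y|.
Proof.
move=> [r [C [r0 C0 hf]]]; have C1 : 0 < 4 * (C + 1) by rewrite mulr_gt0// ltr_wpDl.
(* The Lipschitz constant on radius [t * r / 2] is [2 * t * C / r]; this [t] makes it at most
   1/2. *)
pose t := Num.min 1 (r / (4 * (C + 1))).
have t0 : 0 < t by rewrite lt_min ltr01 divr_gt0.
have t1 : 0 <= t <= 1 by rewrite ltW//= ge_min lexx.
have tr0 : 0 < t * r / 2 by rewrite !mulr_gt0// invr_gt0.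
exists (t * r / 2) => // x y xr yr; apply/rV_normP; first by rewrite mulr_ge0.
move=> j; rewrite rV_subE.
have := psum_shrink t1 (ltW r0) (hf j); rewrite (_ : t * r = 2 * (t * r / 2)); last by field.
move=> /(psum_lipschitz tr0)/(_ xr yr)/le_trans; apply; apply: ler_wpM2r => //.
rewrite ler_pdivrMr//.
have : t * (4 * (C + 1)) <= r by rewrite -ler_pdivlMr// ge_min lexx orbT.
by move: t0 r0; nra.
Qed.

(** The fixed point [l x = - f (x + l x)] gives a right inverse of [x + f x]. It is also a left
    inverse because [f] contracts by 1/2, which makes [x + f x] injective near 0. *)
Lemma germ_inverse m (f : 'rV[R]_m -> 'rV[R]_m) : germ 2 f ->
  exists2 l : 'rV[R]_m -> 'rV[R]_m, germ 2 l & \forall x \near (0 : 'rV[R]_m),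
    (x + l x) + f (x + l x) = x /\ (x + f x) + l (x + f x) = x.
Proof.
move=> gf; have [||| l gl lE] := @germ_fixpoint R m f 0 (-1) 1 gf.
- by rewrite normr0 mul0r invr_ge0.
- by rewrite normrN1.
- by rewrite ler01 lexx.
exists l => //.
have right_inv : \forall x \near (0 : 'rV[R]_m), (x + l x) + f (x + l x) = x.
  apply: filterS lE => x; rewrite scale0r add0r scale1r scaleN1r => {1}->.
  by rewrite subrK.
have [r r0 cf] := germ2_contraction gf.
have gF : germ 1 (fun x => x + f x) by apply: germD germ_id (germ_le _ gf).
have gL : germ 1 (fun x => x + l x) by apply: germD germ_id (germ_le _ gl).
have ballr (u : 'rV[R]_m -> 'rV[R]_m) : germ 1 u -> \forall x \near (0 : 'rV[R]_m), `|u x| <= r.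
  move=> /germ_cvg gu; apply: (gu [set y | `|y| <= r]); apply/nbhs_ballP; exists r => //= y.
  by rewrite -ball_normE /= sub0r normrN => /ltW.
have near_comp P : (\forall x \near (0 : 'rV[R]_m), P x) ->
    \forall x \near (0 : 'rV[R]_m), P (x + f x) by exact: germ_cvg gF P.
apply: filterS3 (filterI right_inv (ballr _ germ_id)) (near_comp _ right_inv) (near_comp _ (ballr
  _ gL)).
move=> x [h1 xr] h2 yr; split => //.
set y := x + f x + _ in h2 yr *.
have := cf _ _ xr yr; have -> : f x - f y = - (x - y).
  have : x + f x = y + f y by rewrite h2.
  move=> /(congr1 (fun z => z - x - f y)) /=; rewrite [x + f x]addrC addrK => ->;
    by rewrite addrAC addrK opprB.
rewrite normrN => h; have : `|x - y| <= 0 by have := normr_ge0 (x - y); lra.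
by rewrite normr_le0 subr_eq0 => /eqP.
Qed.

Lemma partial_sum_coord (I : choiceType) p (x : I -> 'rV[R]_p) A j :
  partial_sum x A ord0 j = partial_sum (fun i => x i ord0 j) A.
Proof. by rewrite /partial_sum summxE. Qed.

Lemma analytic_germ m p (f : 'rV[R]_m -> 'rV[R]_p) x :
  analytic_at f x <-> germ 0 (fun h => f (x + h)).
Proof.
split.
- move=> [c /nbhs_ballP[e /= e0 hc]].
  have cj h j : `|h| < e -> hassum (fun a => monomial h a * c a ord0 j) (f (x + h) ord0 j).
    move=> he; have hb : ball 0 e h by rewrite -ball_normE /= sub0r normrN.
    have := hc h hb => /(cvg_comp _ _) /(_ (@coord_continuous R 1 p ord0 j (f (x + h)))).
    rewrite /hassum (_ : _ \o _ = partial_sum (fun a => monomial h a * c a ord0 j))//.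
    apply/funext => A /=; rewrite partial_sum_coord; congr partial_sum.
    by apply/funext => a; rewrite mxE.
  have e2 : 0 < e / 2 by rewrite divr_gt0.
  (* At this diagonal point the monomial of exponent [a] equals [(e / 2) ^+ mdeg a], so convergence
     there is a weighted bound at radius [e / 2]. *)
  have h0 : `|const_mx (e / 2) : 'rV[R]_m| <= e / 2.
    apply/rV_normP => [|j]; first exact: ltW.
    by rewrite mxE gtr0_norm.
  have /choice[C hC] : forall j, exists C, bsum (fun a =>
    monomial (const_mx (e / 2)) a * c a ord0 j) C.
    move=> j; apply: (hassum_bsum (cj _ j _)).
    by apply: le_lt_trans h0 _; rewrite ltr_pdivrMr// ltr_pMr// ltr1n.
  have mE a : monomial (const_mx (e / 2) : 'rV[R]_m) a = (e / 2) ^+ mdeg a.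
    by rewrite /monomial /mdeg -prodrXr; apply: eq_bigr => i _; rewrite mxE.
  have C0 j : 0 <= C j by exact: bsum_ge0 (hC j).
  exists (e / 2), (\sum_j C j); split => //; first exact: sumr_ge0.
  move=> j; exists (fun a => c a ord0 j); split => //.
    apply: bsum_leC (_ : C j <= _) _; first by rewrite (bigD1 j)//= lerDl sumr_ge0.
    by apply: bsum_le (hC j) => a; rewrite mE mulrC.
  move=> h hr; apply: cj; apply: le_lt_trans hr _.
  by rewrite ltr_pdivrMr// ltr_pMr// ltr1n.
- move=> [r [C [r0 C0 hu]]].
  have /choice[c hc] := hu.
  exists (fun a => \row_j c j a); apply/nbhs_ballP; exists r => //= h.
  rewrite -ball_normE /= sub0r normrN => hr.
  apply/cvgrPdist_lt => e e0.
  have H : \forall A \near totally, forall j : 'I_p,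
      `|f (x + h) ord0 j - partial_sum (fun a => monomial h a * c j a) A| < e.
    apply: filter_forall => j; have [_ _ /(_ h (ltW hr))] := hc j.
    by move=> /cvgrPdist_lt/(_ e e0).
  apply: filterS H => A HA.
  rewrite [X in X < _]/Num.norm /= mx_normrE.
  apply/bigmax_ltP; split => // -[i j] _ /=; rewrite ord1 rV_subE.
  rewrite partial_sum_coord; have := HA j.
  rewrite (_ : (fun a => monomial h a * c j a) = (fun a =>
    (monomial h a *: \row_j0 c j0 a) ord0 j))//.
  by apply/funext => a; rewrite !mxE.
Qed.

Lemma analytic_comp m p q (f : 'rV[R]_m -> 'rV[R]_p) (g : 'rV[R]_p -> 'rV[R]_q) x :
  analytic_at f x -> analytic_at g (f x) -> analytic_at (g \o f) x.
Proof.
move=> /analytic_germ gf /analytic_germ gg; apply/analytic_germ.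
have g1 : germ 1 (fun h => f (x + h) - f x).
  apply: germ_vanish; last by rewrite addr0 subrr.
  exact: germB gf (germ_cst _).
have := germ_comp gg g1; rewrite mul0n; apply: germ_ext => h /=.
by rewrite addrCA subrr addr0.
Qed.

Lemma analytic_near m p (f : 'rV[R]_m -> 'rV[R]_p) x :
  analytic_at f x -> \forall y \near x, analytic_at f y.
Proof.
move=> /analytic_germ/germ_near/nbhs_ballP[e /= e0 he].
apply/nbhs_ballP; exists e => //= y; rewrite -ball_normE /= => xy.
apply/analytic_germ; have := he (y - x); rewrite -ball_normE /= sub0r normrN distrC => /(_ xy).
by apply: germ_ext => h; rewrite addrA addrCA subrr addr0.
Qed.

Lemma analytic_eq m p (f g : 'rV[R]_m -> 'rV[R]_p) x :
  (\forall y \near x, f y = g y) -> analytic_at f x -> analytic_at g x.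
Proof.
move=> /nbhs_ballP[e /= e0 fg] /analytic_germ gf; apply/analytic_germ.
apply: germ_eq gf; apply/nbhs_ballP; exists e => //= h.
rewrite -ball_normE /= sub0r normrN => he; apply: fg.
by rewrite -ball_normE /= opprD addrA subrr sub0r normrN.
Qed.

End Analytic.

(** * The exponential map of a Lie group *)

Section GermExtra.
Context {R : realType} {m : nat}.

Lemma germ1_near p (u : 'rV[R]_m -> 'rV[R]_p) (P : 'rV[R]_p -> Prop) : germ 1 u ->
  (\forall x \near (0 : 'rV[R]_p), P x) -> \forall x \near (0 : 'rV[R]_m), P (u x).
Proof. by move=> /germ_cvg gu hP; exact: (gu P). Qed.

Lemma germ2_linear0 p (A : 'M[R]_(m, p)) : germ 2 (fun h => h *m A) -> A = 0.
Proof.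
move=> /germ_quad[K K0 /nbhs_ballP[e /= e0 hK]]; apply/row_matrixP => i.
rewrite row0 rowE; set v := delta_mx 0 i; apply/eqP; rewrite -normr_le0.
apply/ler_addgt0Pr => d d0; rewrite add0r.
have v0 := normr_ge0 v.
have D0 : 0 < K * `|v| ^+ 2 + 1 by rewrite ltr_wpDl// mulr_ge0// sqr_ge0.
pose t := Num.min (e / (`|v| + 1)) (d / (K * `|v| ^+ 2 + 1)) / 2.
have t0 : 0 < t by rewrite divr_gt0// lt_min !divr_gt0// ltr_wpDl.
have te : 2 * t * (`|v| + 1) <= e.
  by rewrite -ler_pdivlMr ?ltr_wpDl// mulrC divfK// ge_min lexx.
have td : 2 * t * (K * `|v| ^+ 2 + 1) <= d.
  by rewrite -ler_pdivlMr// mulrC divfK// ge_min lexx orbT.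
have tb : ball 0 e (t *: v).
  rewrite -ball_normE /= sub0r normrN normrZ gtr0_norm//.
  by move: te t0 v0 e0; nra.
have := hK _ tb; rewrite -scalemxAl normrZ gtr0_norm// (_ : `|t *: v| = t * `|v|); last first.
  by rewrite normrZ gtr0_norm.
rewrite exprMn.
rewrite (_ : K * _ = t * (t * (K * `|v| ^+ 2))); last by ring.
rewrite ler_pM2l// => /le_trans; apply.
by move: td t0; nra.
Qed.

(** [D v] equals [2^k D (v / 2^k)], while order 2 gives [D (v / 2^k) = O(4^-k)]. In the construction
    of the exponential this plays the part of uniqueness for differential equations. *)
Lemma germ2_homogeneous0 p (D : 'rV[R]_m -> 'rV[R]_p) : germ 2 D ->
  (\forall v \near (0 : 'rV[R]_m), D (2 *: v) = 2 *: D v) ->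
  \forall v \near (0 : 'rV[R]_m), D v = 0.
Proof.
move=> /germ_quad[K K0 hK] hD.
have /nbhs_ballP[r /= r0 hr] : \forall v \near (0 : 'rV[R]_m),
    `|D v| <= K * `|v| ^+ 2 /\ D (2 *: v) = 2 *: D v.
  by apply: filterS2 hK hD.
apply/nbhs_ballP; exists r => //= v vr; apply/eqP; rewrite -normr_le0.
have half k : D v = 2 ^+ k *: D ((2 ^+ k)^-1 *: v) /\ ball 0 r ((2 ^+ k)^-1 *: v).
  elim: k => [|k [ih1 ih2]]; first by rewrite expr0 invr1 !scale1r.
  have b : ball 0 r ((2 ^+ k.+1)^-1 *: v).
    rewrite -ball_normE /= sub0r normrN exprS invfM -scalerA normrZ.
    move: ih2; rewrite -ball_normE /= sub0r normrN; apply: le_lt_trans.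
    rewrite ger0_norm ?invr_ge0// ler_piMl// invf_le1//; lra.
  split=> //; rewrite ih1 {1}exprSr -scalerA; congr (_ *: _).
  by have [_ <-] := hr _ b; rewrite scalerA exprS invfM mulrA divff// mul1r.
apply/ler_addgt0Pr => d d0; rewrite add0r.
have D0 : 0 <= K * `|v| ^+ 2 by rewrite mulr_ge0// sqr_ge0.
have D1 : 0 < K * `|v| ^+ 2 + 1 by rewrite ltr_wpDl.
have cv : (2^-1 : R) ^+ n @[n --> \oo] --> 0.
  by apply: cvg_expr; rewrite ger0_norm; lra.
have := cvgr_lt _ cv _ (divr_gt0 d0 D1).
move=> [n _ /(_ n (leqnn _)) /= hn].
have [-> bn] := half n; have [q _] := hr _ bn.
have n0 : 0 < (2 : R) ^+ n by rewrite exprn_gt0.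
rewrite normrZ gtr0_norm//.
have h3 : (2^-1) ^+ n * (K * `|v| ^+ 2 + 1) < d by rewrite -ltr_pdivlMr.
move: q; rewrite normrZ gtr0_norm ?invr_gt0// exprMn => q.
have := ler_wpM2l (ltW n0) q => {}q; apply: le_trans q _.
rewrite (_ : _ * _ = (2^-1) ^+ n * (K * `|v| ^+ 2)); last first.
  by rewrite exprVn; field; rewrite gt_eqF.
move: h3; have : 0 <= (2^-1 : R) ^+ n by rewrite exprn_ge0// invr_ge0.
nra.
Qed.

End GermExtra.

(** What the argument keeps of the exponential map: instead of a bracket, additivity up to second
    order in [exp_product]. The exact law [exp_add] has a uniform radius but nonnegative times;
    signs are handled by [exp_opp]. The logarithm [l] is meaningful only near 1. *)
Record exp_coordinates (R : realType) (G : topologicalGroupType) n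
    (e : 'rV[R]_n -> G) (l : G -> 'rV[R]_n) : Prop := ExpCoordinates {
  exp0 : e 0 = 1%g;
  exp_continuous : \forall v \near (0 : 'rV[R]_n), {for v, continuous e};
  expK : \forall v \near (0 : 'rV[R]_n), l (e v) = v;
  logK : \forall x \near (1%g : G), e (l x) = x;
  log_continuous : \forall x \near (1%g : G), {for x, continuous l};
  exp_product : germ 2 (fun w : 'rV[R]_(n + n) =>
    l (e (lsubmx w) * e (rsubmx w))%g - (lsubmx w + rsubmx w));
  exp_add : exists2 r, 0 < r & forall v s t, 0 <= s -> 0 <= t ->
    `|(s + t) *: v| < r -> e ((s + t) *: v) = (e (s *: v) * e (t *: v))%g;
  exp_opp : \forall v \near (0 : 'rV[R]_n), e (- v) = (e v)^-1%g
}.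

Section ChartFacts.
Context {R : realType} {T : topologicalType} {n : nat} (c : chart R T n).

Lemma chartK x : chart_dom c x -> chart_inv c (c x) = x.
Proof. by move=> dx; apply: chart_mapK; rewrite inE. Qed.

Lemma chart_dom_near x : chart_dom c x -> \forall y \near x, chart_dom c y.
Proof. by move=> dx; apply: open_nbhs_nbhs; split => //; exact: chart_dom_open. Qed.

Lemma chart_invK x : chart_dom c x -> \forall w \near c x,
  [/\ chart_dom c (chart_inv c w), c (chart_inv c w) = w & {for w, continuous (chart_inv c)}].
Proof.
move=> dx; have : \forall w \near c x, (c @` chart_dom c) w.
  by apply: open_nbhs_nbhs; split; [exact: chart_img_open | exists x].
apply: filterS => w [y dy yw]; rewrite -yw chartK//; split => //.
by apply: chart_inv_continuous; rewrite inE; exists y.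
Qed.

Lemma chart_continuous x : chart_dom c x -> {for x, continuous c}.
Proof. by move=> dx; apply: chart_map_continuous; rewrite inE. Qed.

Lemma chart_map_near x (P : 'rV[R]_n -> Prop) : chart_dom c x ->
  (\forall w \near c x, P w) -> \forall y \near x, P (c y).
Proof. by move=> dx hP; have cc := chart_continuous dx; exact: (cc P hP). Qed.

End ChartFacts.

Section LocalGroupLaw.
Context {R : realType} {n : nat}.
Variable mu : 'rV[R]_(n + n) -> 'rV[R]_n.

Lemma germ_lsubmx : germ 1 (fun w : 'rV[R]_(n + n) => lsubmx w).
Proof.
apply: germ_ext (germ_lin (col_mx 1%:M 0)) => w.
by rewrite -{1}[w]hsubmxK mul_row_col mulmx1 mulmx0 addr0.
Qed.

Lemma germ_rsubmx : germ 1 (fun w : 'rV[R]_(n + n) => rsubmx w).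
Proof.
apply: germ_ext (germ_lin (col_mx 0 1%:M)) => w.
by rewrite -{1}[w]hsubmxK mul_row_col mulmx1 mulmx0 add0r.
Qed.

(** Restriction to the two axes, where 0 is neutral, gives a linear map of order 2 for each block of
    [A]; so both blocks are the identity. *)
Lemma germ_law_linear : germ 1 mu ->
  (\forall x \near (0 : 'rV[R]_n), mu (row_mx x 0) = x) ->
  (\forall x \near (0 : 'rV[R]_n), mu (row_mx 0 x) = x) ->
  germ 2 (fun w => mu w - (lsubmx w + rsubmx w)).
Proof.
move=> gmu mul0 mu0r; have [A gA] := germ_linear_part gmu.
have g10 : germ 1 (fun x : 'rV[R]_n => row_mx x (0 : 'rV[R]_n)).
  exact: germ_row_mx germ_id (germ0 _ _).
have g01 : germ 1 (fun x : 'rV[R]_n => row_mx (0 : 'rV[R]_n) x).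
  exact: germ_row_mx (germ0 _ _) germ_id.
have Au : usubmx A = 1%:M.
  apply/eqP; rewrite -subr_eq0 -oppr_eq0 opprB; apply/eqP/germ2_linear0.
  have := germ_comp gA g10; apply: germ_eq; apply: filterS mul0 => x ->.
  by rewrite -{1}[A]vsubmxK mul_row_col mul0mx addr0 mulmxBr mulmx1.
have Ad : dsubmx A = 1%:M.
  apply/eqP; rewrite -subr_eq0 -oppr_eq0 opprB; apply/eqP/germ2_linear0.
  have := germ_comp gA g01; apply: germ_eq; apply: filterS mu0r => x ->.
  by rewrite -{1}[A]vsubmxK mul_row_col mul0mx add0r mulmxBr mulmx1.
apply: germ_ext gA => w; congr (_ - _).
by rewrite -{1}[w]hsubmxK -{1}[A]vsubmxK mul_row_col Au Ad !mulmx1.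
Qed.

Hypothesis gmu : germ 2 (fun w => mu w - (lsubmx w + rsubmx w)).

Lemma germ_law_comp (m : nat) (u v : 'rV[R]_m -> 'rV[R]_n) : germ 1 u -> germ 1 v ->
  germ 2 (fun h => mu (row_mx (u h) (v h)) - (u h + v h)).
Proof.
move=> gu gv; have := germ_comp gmu (germ_row_mx gu gv).
by apply: germ_ext => h; rewrite row_mxKl row_mxKr.
Qed.

Lemma germ_law_inv (io : 'rV[R]_n -> 'rV[R]_n) : germ 1 io ->
  (\forall x \near (0 : 'rV[R]_n), mu (row_mx x (io x)) = 0) ->
  germ 2 (fun x => io x + x).
Proof.
move=> gio h; have := germZ (-1) (germ_law_comp germ_id gio).
apply: germ_eq; apply: filterS h => x ->.
by rewrite sub0r scaleN1r opprK addrC.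
Qed.

(* [E] linearizes the squaring map: it solves [E (2 v) = E v * E v]. *)
Lemma germ_law_exp : exists E L : 'rV[R]_n -> 'rV[R]_n,
  [/\ germ 2 (fun v => E v - v), germ 2 (fun v => L v - v),
      (\forall v \near (0 : 'rV[R]_n), E (2 *: v) = mu (row_mx (E v) (E v))),
      (\forall v \near (0 : 'rV[R]_n), E (L v) = v) &
      (\forall v \near (0 : 'rV[R]_n), L (E v) = v)].
Proof.
pose s (x : 'rV[R]_n) := mu (row_mx x x) - (x + x).
have gs : germ 2 s by exact: germ_law_comp germ_id germ_id.
have [||| e ge eE] := @germ_fixpoint R n s 2 1 (2^-1) gs.
- by rewrite ger0_norm// expr2 mulrA divff// mul1r.
- by rewrite normr1.
- by rewrite invr_ge0 ler0n/= invf_le1// ler1n.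
have [l gl lE] := germ_inverse ge.
exists (fun v => v + e v), (fun v => v + l v); split.
- by apply: germ_ext ge => v; rewrite addrC addKr.
- by apply: germ_ext gl => v; rewrite addrC addKr.
- have := germ1_near (germZ 2 germ_id) eE; apply: filterS => v.
  rewrite scalerA mulVf// !scale1r /s => ->.
  by rewrite addrA -scalerDr scaler_nat mulr2n addrC subrK.
- by apply: filterS lE => v [].
- by apply: filterS lE => v [].
Qed.

End LocalGroupLaw.

Lemma near_and {T : topologicalType} (x : T) (P Q : T -> Prop) :
  (\forall y \near x, P y) -> (\forall y \near x, Q y) -> \forall y \near x, P y /\ Q y.
Proof. by move=> hP hQ; exact: filterI. Qed.

Lemma near_all {T : topologicalType} (x : T) (P : T -> Prop) :
  (forall y, P y) -> \forall y \near x, P y.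
Proof. by move=> hP; exact: filterE. Qed.

Section TopologicalGroupLimits.
Context {G : topologicalGroupType} {T : Type} {F : set_system T} {FF : Filter F}.

Lemma cvgMg (f g : T -> G) a b : f @ F --> a -> g @ F --> b ->
  (fun x => f x * g x)%g @ F --> (a * b)%g.
Proof.
move=> fa gb; apply: (@continuous2_cvg T G G G F FF f g (fun x y : G => (x * y)%g)) => //.
exact: (mulg_continuous (s := G) (a, b)).
Qed.

Lemma cvgVg (f : T -> G) a : f @ F --> a -> (fun x => (f x)^-1)%g @ F --> (a^-1)%g.
Proof. by move=> fa; apply: continuous_cvg => //; exact: invg_continuous. Qed.

End TopologicalGroupLimits.

(* Unification unfolds [nbhs] on matrices, which hides the [Filter] instance. *)
Notation cvgMg_at := (cvgMg (FF := nbhs_filter _)).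
Notation cvgVg_at := (cvgVg (FF := nbhs_filter _)).

Section OneParameter.
Context {R : realType} {G : topologicalGroupType} {n : nat}.
Variables (e : 'rV[R]_n -> G) (l : G -> 'rV[R]_n).
Hypotheses (hG : hausdorff_space G) (e0 : e 0 = 1%g)
  (econt : \forall v \near (0 : 'rV[R]_n), {for v, continuous e})
  (eK : \forall v \near (0 : 'rV[R]_n), l (e v) = v)
  (lK : \forall x \near (1%g : G), e (l x) = x)
  (lcont : \forall x \near (1%g : G), {for x, continuous l})
  (prod : germ 2 (fun w : 'rV[R]_(n + n) =>
    l (e (lsubmx w) * e (rsubmx w))%g - (lsubmx w + rsubmx w)))
  (dbl : \forall v \near (0 : 'rV[R]_n), e (2 *: v) = (e v * e v)%g)
  (inv : germ 2 (fun v => l (e v)^-1%g + v)).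

Let ecvg (m : nat) (u : 'rV[R]_m -> 'rV[R]_n) : germ 1 u -> e \o u @ (0 : 'rV[R]_m) --> (1%g : G).
Proof.
move=> /germ_cvg gu; have := nbhs_singleton econt; rewrite -e0 => ec.
exact: (continuous_cvg _ ec gu).
Qed.

Let log_sqr : \forall x \near (1%g : G), l (x * x)%g = 2 *: l x.
Proof.
have lc := nbhs_singleton lcont.
have l1 : l 1%g = 0 by rewrite -e0; exact: (nbhs_singleton eK).
have lto0 P : (\forall v \near (0 : 'rV[R]_n), P v) -> \forall x \near (1%g : G), P (l x).
  by move=> hP; apply: lc; rewrite l1.
have := near_and (lto0 _ dbl) (lto0 _ (germ1_near (germZ 2 germ_id) eK)).
move=> H; apply: filterS2 lK H => x lx [h1 h2].
by rewrite -{1 2}lx -h1 h2.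
Qed.

(** By induction on [k], [l (e v * e (k v)) - (v + k v)] has order 2 and doubles with [v], because
    [e v] commutes with its power [e (k v)]; hence it vanishes. The neighborhood depends on [k]. *)
Let exp_mulrn_near k : \forall v \near (0 : 'rV[R]_n), e (k%:R *: v) = (e v ^+ k)%g.
Proof.
elim: k => [|k ih].
  by apply: near_all => v; rewrite scale0r e0.
have gk (a : R) : germ 1 (fun v : 'rV[R]_n => a *: v) by exact: germZ germ_id.
have gB : germ 2 (fun v => l (e v * e (k%:R *: v))%g - (v + k%:R *: v)).
  have := germ_comp prod (germ_row_mx germ_id (gk k%:R)).
  by apply: germ_ext => v; rewrite row_mxKl row_mxKr.
have ycvg : (fun v => e v * e (k%:R *: v))%g @ (0 : 'rV[R]_n) --> (1%g : G).
  by rewrite -[1%g]mulg1; apply: cvgMg_at; [exact: (ecvg germ_id) | exact: (ecvg (gk _))].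
have D0 : \forall v \near (0 : 'rV[R]_n), l (e v * e (k%:R *: v))%g - (v + k%:R *: v) = 0.
  apply: germ2_homogeneous0 gB _.
  have := near_and (ycvg _ log_sqr) (near_and ih (germ1_near (gk 2) ih)).
  apply: filterS2 dbl => v dv [ls [kv k2v]].
  rewrite scalerBr -ls scalerDr !scalerA [k%:R * 2]mulrC -[X in _ - (_ + X)]scalerA.
  congr (l _ - _); last by rewrite scalerA.
  rewrite [2 * k%:R]mulrC -scalerA k2v dv kv.
  have c : commute (e v) (e v ^+ k)%g by apply: commuteX; exact: commute_refl.
  rewrite expgMn; last exact: commute_refl.
  by rewrite !mulgA; congr (_ * _)%g; rewrite -!mulgA; congr (_ * _)%g.
have := ycvg _ lK; apply: filterS3 D0 ih => v /eqP + kv.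
rewrite subr_eq0 => /eqP Dv /=; rewrite Dv => ey.
by rewrite expgS -kv -ey -natr1 scalerDl scale1r addrC.
Qed.

Let exp_opp_near : \forall v \near (0 : 'rV[R]_n), e (- v) = (e v)^-1%g.
Proof.
have gid2 : germ 1 (fun v : 'rV[R]_n => 2 *: v) by exact: germZ germ_id.
have ycvg : (fun v => (e v)^-1)%g @ (0 : 'rV[R]_n) --> (1%g : G).
  by rewrite -[1%g]invg1; apply: cvgVg_at; exact: (ecvg germ_id).
have D0 : \forall v \near (0 : 'rV[R]_n), l (e v)^-1%g + v = 0.
  apply: germ2_homogeneous0 inv _.
  have := ycvg _ log_sqr; apply: filterS2 dbl => v dv ls.
  by rewrite dv invgM ls scalerDr.
have := ycvg _ lK; apply: filterS2 D0 => v /eqP.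
by rewrite addr_eq0 => /eqP Dv /=; rewrite Dv.
Qed.

Let exp_mulrn : exists2 r, 0 < r &
  (forall v, `|v| < r -> {for v, continuous e}) /\
  forall k v, `|k%:R *: v| < r -> e (k%:R *: v) = (e v ^+ k)%g.
Proof.
have /nbhs_ballP[r /= r0 hr] : \forall v \near (0 : 'rV[R]_n),
   {for v, continuous e} /\ e (2 *: v) = (e v * e v)%g by exact: filterI econt dbl.
have {}hr v : `|v| < r -> {for v, continuous e} /\ e (2 *: v) = (e v * e v)%g.
  by move=> vr; apply: hr; rewrite -ball_normE /= sub0r normrN.
exists r => //; split => [v /hr[]//|[|k] v vr]; first by rewrite scale0r e0.
have up w : `|k.+1%:R *: w| < r -> e (k.+1%:R *: (2^-1 *: w)) = (e (2^-1 *: w) ^+ k.+1)%g ->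
    e (k.+1%:R *: w) = (e w ^+ k.+1)%g.
  move=> wr h.
  have half (u : 'rV[R]_n) : `|u| < r -> e u = (e (2^-1 *: u) * e (2^-1 *: u))%g.
    move=> ur; have ur2 : `|2^-1 *: u| < r.
      rewrite normrZ ger0_norm ?invr_ge0//; have := normr_ge0 u; move: ur; lra.
    by have [_ <-] := hr _ ur2; rewrite scalerA mulfV// scale1r.
  rewrite half// scalerA mulrC -scalerA h (half w); last first.
    apply: le_lt_trans wr; rewrite normrZ ger0_norm// ler_peMl// ler1n//.
  by rewrite expgMn//; exact: commute_refl.
have /nbhs_ballP[d /= d0 hd] := exp_mulrn_near k.+1.
have cv : (2^-1 : R) ^+ j @[j --> \oo] --> 0 by apply: cvg_expr; rewrite ger0_norm; lra.
have d1 : 0 < d / (`|v| + 1) by rewrite divr_gt0// ltr_wpDl.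
have := cvgr_lt _ cv _ d1; move=> [j _ /(_ j (leqnn _)) /= hj].
have base : e (k.+1%:R *: ((2^-1) ^+ j *: v)) = (e ((2^-1) ^+ j *: v) ^+ k.+1)%g.
  apply: hd; rewrite -ball_normE /= sub0r normrN normrZ ger0_norm ?exprn_ge0 ?invr_ge0//.
  move: hj; rewrite ltr_pdivlMr ?ltr_wpDl//; apply: le_lt_trans.
  by rewrite ler_wpM2l ?exprn_ge0 ?invr_ge0// lerDl.
elim: j base {hj} => [|j ih]; first by rewrite expr0 scale1r.
rewrite exprS -scalerA => /up h; apply: ih; apply: h.
apply: le_lt_trans vr; rewrite scalerA mulrC -scalerA normrZ ler_piMl//.
by rewrite ger0_norm ?exprn_ge0 ?invr_ge0// exprn_ile1 ?invr_ge0// invf_le1// ler1n.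
Qed.

Let trunc_ratio (s : R) : 0 <= s ->
  ((Num.truncn (s * j.+1%:R))%:R / j.+1%:R) @[j --> \oo] --> s.
Proof.
move=> s0; apply/cvgrPdist_le => d d0.
have cv : (@harmonic R j) @[j --> \oo] --> 0 by exact: cvg_harmonic.
have [N _ hN] := cvgr_le _ cv _ d0; exists N => // j /= /hN /= hj.
have j0 : (0 : R) < j.+1%:R by [].
have /andP[t1 t2] := truncn_itv (mulr_ge0 s0 (ltW j0)).
rewrite ger0_norm; last by rewrite subr_ge0 ler_pdivrMr.
apply: le_trans hj; rewrite /harmonic -[leRHS]mul1r -ler_pdivrMr ?invr_gt0// invrK.
rewrite mulrBl divfK ?gt_eqF//; move: t2; rewrite -natr1; lra.
Qed.

(** For fractions with common denominator [j.+1] this is [exp_mulrn]; then a limit is taken in the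
    Hausdorff group. Truncations approach [s] and [t] from below, so all arguments stay within the
    radius. *)
Lemma one_parameter : exists2 r, 0 < r & forall v s t, 0 <= s -> 0 <= t ->
    `|(s + t) *: v| < r -> e ((s + t) *: v) = (e (s *: v) * e (t *: v))%g.
Proof.
have [r r0 [ec ek]] := exp_mulrn; exists r => // v s t s0 t0 vr.
have st0 : 0 <= s + t by exact: addr_ge0.
have less a : 0 <= a -> a <= s + t -> `|a *: v| < r.
  move=> a0 ast; apply: le_lt_trans vr; rewrite !normrZ ler_wpM2r//.
  by rewrite !ger0_norm.
pose a j := (Num.truncn (s * j.+1%:R))%:R / j.+1%:R : R.
pose b j := (Num.truncn (t * j.+1%:R))%:R / j.+1%:R : R.
have aE x j : 0 <= x -> 0 <= ((Num.truncn (x * j.+1%:R))%:R / j.+1%:R : R) <= x.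
  move=> x0; apply/andP; split; first by rewrite divr_ge0.
  rewrite ler_pdivrMr//; by have /andP[] := truncn_itv (mulr_ge0 x0 (ler0n R j.+1)).
have key j : e ((a j + b j) *: v) = (e (a j *: v) * e (b j *: v))%g.
  have /andP[a0 a1] := aE s j s0; have /andP[b0 b1] := aE t j t0.
  rewrite /a /b -mulrDl -natrD -!scalerA !ek ?expgnDr//.
  - by rewrite scalerA; apply: less => //; rewrite ler_wpDl.
  - by rewrite scalerA; apply: less => //; rewrite ler_wpDr.
  - rewrite scalerA natrD mulrDl; apply: less; [exact: addr_ge0 | exact: lerD].
have ca : a j @[j --> \oo] --> s by exact: trunc_ratio.
have cb : b j @[j --> \oo] --> t by exact: trunc_ratio.
have lim (x : R) (y : R^nat) : y j @[j --> \oo] --> x -> `|x *: v| < r ->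
    e (y j *: v) @[j --> \oo] --> e (x *: v).
  move=> yx xr; have /ec h := xr; apply: continuous_cvg; first exact: h.
  exact: cvgZr_tmp.
have l1 : e ((a j + b j) *: v) @[j --> \oo] --> e ((s + t) *: v).
  by apply: lim => //; exact: cvgD.
have l2 : (e (a j *: v) * e (b j *: v))%g @[j --> \oo] --> (e (s *: v) * e (t *: v))%g.
  by apply: cvgMg; apply: lim => //; apply: less => //; rewrite ?lerDl ?lerDr.
rewrite (_ : (fun j => e ((a j + b j) *: v)) = (fun j => e (a j *: v) * e (b j *: v))%g) in l1.
  exact: (cvg_unique hG l1 l2).
by apply/funext.
Qed.

Lemma exp_coordinatesP : exp_coordinates e l.
Proof. split => //; exact: one_parameter. Qed.

End OneParameter.

Lemma near_shift {R : realType} {n : nat} (a : 'rV[R]_n) (P : 'rV[R]_n -> Prop) :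
  (\forall w \near a, P w) -> \forall h \near (0 : 'rV[R]_n), P (a + h).
Proof.
move=> /nbhs_ballP[d /= d0 hd]; apply/nbhs_ballP; exists d => //= h.
rewrite -ball_normE /= sub0r normrN => hb; apply: hd.
by rewrite -ball_normE /= opprD addrA subrr sub0r normrN.
Qed.

Section LieExponential.
Context {R : realType} {G : topologicalGroupType} (LG : lie_structure R G).
Notation n := (lie_dim LG).
Hypothesis hG : hausdorff_space G.

Lemma lie_exponential : exists (c : chart R G n) (e : 'rV[R]_n -> G) (l : G -> 'rV[R]_n),
  [/\ lie_atlas LG c, chart_dom c 1%g, exp_coordinates e l,
      analytic_at (c \o e) 0 & analytic_at (l \o chart_inv c) (c 1%g)].
Proof.
have [c cA c1] := lie_atlas_cover LG 1%g.
(* The chart is recentered so that the identity becomes the origin. *)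
pose ka (x : G) : 'rV[R]_n := c x - c 1%g.
pose ki (v : 'rV[R]_n) : G := chart_inv c (c 1%g + v).
have ki0 : ki 0 = 1%g by rewrite /ki addr0 chartK.
have ka1 : ka 1%g = 0 by rewrite /ka subrr.
have kiK : \forall v \near (0 : 'rV[R]_n), [/\ chart_dom c (ki v), ka (ki v) = v & {for v,
  continuous ki}].
  apply: filterS (near_shift (chart_invK c1)) => v [h1 h2 h3]; split => //.
    by rewrite /ka h2 addrAC subrr add0r.
  apply: (@continuous_comp _ _ _ (fun w => c 1%g + w)) => //.
  by apply: (@continuousD _ _ _ (fun=> c 1%g) id); [exact: cst_continuous | exact: cvg_id].
have kaK x : chart_dom c x -> ki (ka x) = x.
  by move=> dx; rewrite /ki /ka addrCA subrr addr0 chartK.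
have kacont x : chart_dom c x -> {for x, continuous ka}.
  move=> dx; apply: (@continuousB _ _ _ c (fun=> c 1%g)); first exact: chart_continuous.
  exact: cst_continuous.
have kicvg (m : nat) (u : 'rV[R]_m -> 'rV[R]_n) : germ 1 u -> ki \o u @ (0 : 'rV[R]_m) -->
  (1%g : G).
  move=> /germ_cvg gu; have [_ _ kc] := nbhs_singleton kiK.
  by rewrite -ki0; exact: (continuous_cvg _ kc gu).
pose mu (w : 'rV[R]_(n + n)) := ka (ki (lsubmx w) * ki (rsubmx w))%g.
have gmu1 : germ 1 mu.
  apply: germ_vanish; last by rewrite /mu !linear0 ki0 mulg1.
  have c11 : chart_dom c (1 * 1)%g by rewrite mulg1.
  have /analytic_germ := lie_mul_analytic cA cA cA c1 c1 c11.
  move=> /germB/(_ (germ_cst (c 1%g))); apply: germ_ext => w.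
  by rewrite /mu /ka /ki !linearD /= row_mxKl row_mxKr.
have gl : germ 1 (fun w : 'rV[R]_(n + n) => lsubmx w) by exact: germ_lsubmx.
have gr : germ 1 (fun w : 'rV[R]_(n + n) => rsubmx w) by exact: germ_rsubmx.
have mul_cvg (m : nat) (u v : 'rV[R]_m -> 'rV[R]_n) : germ 1 u -> germ 1 v ->
    (fun h => ki (u h) * ki (v h))%g @ (0 : 'rV[R]_m) --> (1%g : G).
  move=> gu gv; rewrite -[1%g]mulg1; apply: cvgMg_at; exact: kicvg.
have domc := chart_dom_near c1.
have kimu : \forall w \near (0 : 'rV[R]_(n + n)),
    ki (mu w) = (ki (lsubmx w) * ki (rsubmx w))%g.
  have dmul : \forall w \near (0 : 'rV[R]_(n + n)), chart_dom c (ki (lsubmx w) * ki (rsubmx w))%g.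
    exact: (mul_cvg _ _ _ gl gr _ domc).
  by apply: filterS dmul => w; exact: kaK.
have mul0 : \forall x \near (0 : 'rV[R]_n), mu (row_mx x 0) = x.
  apply: filterS kiK => x [_ kx _].
  by rewrite /mu row_mxKl row_mxKr ki0 mulg1.
have mu0 : \forall x \near (0 : 'rV[R]_n), mu (row_mx 0 x) = x.
  apply: filterS kiK => x [_ kx _].
  by rewrite /mu row_mxKl row_mxKr ki0 mul1g.
have gmu := germ_law_linear gmu1 mul0 mu0.
pose io (x : 'rV[R]_n) := ka (ki x)^-1%g.
have gio1 : germ 1 io.
  apply: germ_vanish; last by rewrite /io ki0 invg1.
  have c1V : chart_dom c 1^-1%g by rewrite invg1.
  have /analytic_germ := lie_inv_analytic cA cA c1 c1V.
  by move=> /germB/(_ (germ_cst (c 1%g))); apply: germ_ext => w.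
have gio : germ 2 (fun x => io x + x).
  apply: (germ_law_inv gmu gio1).
  have kVcvg : (fun x => (ki x)^-1)%g @ (0 : 'rV[R]_n) --> (1%g : G).
    by rewrite -[1%g]invg1; apply: cvgVg_at; exact: (kicvg _ _ germ_id).
  have dV : \forall x \near (0 : 'rV[R]_n), chart_dom c (ki x)^-1%g by exact: (kVcvg _ domc).
  by apply: filterS dV => x dx; rewrite /mu row_mxKl row_mxKr kaK// mulgV.
have [E [L [gE gL dblE EL LE]]] := germ_law_exp gmu.
have gE1 : germ 1 E.
  have := germD (germ_le (leqnSn 1) gE) germ_id.
  by apply: germ_ext => v; rewrite subrK.
have gL1 : germ 1 L.
  have := germD (germ_le (leqnSn 1) gL) germ_id.
  by apply: germ_ext => v; rewrite subrK.
have ka0 P : (\forall v \near (0 : 'rV[R]_n), P v) -> \forall x \near (1%g : G), P (ka x).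
  by move=> hP; apply: (kacont _ c1); rewrite ka1.
have E0 : E 0 = 0 by exact: germ1_at0.
pose e v := ki (E v); pose l x := L (ka x).
exists c; exists e; exists l; split => //.
- apply: exp_coordinatesP => //.
  + by rewrite /e E0 ki0.
  + apply: filterS2 (germ_continuous gE1) (germ1_near gE1 kiK) => v Ec [_ _ kc].
    exact: continuous_comp.
  + by apply: filterS2 (germ1_near gE1 kiK) LE => v [_ kE _] LEv; rewrite /l /e kE.
  + apply: filterS2 (ka0 _ EL) domc => x ELx dx.
    by rewrite /e /l ELx kaK.
  + apply: filterS2 (ka0 _ (germ_continuous gL1)) domc => x Lc dx.
    by apply: continuous_comp => //; exact: kacont.
  + have gEl : germ 1 (fun w : 'rV[R]_(n + n) => E (lsubmx w)) by exact: germ_comp gE1 gl.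
    have gEr : germ 1 (fun w : 'rV[R]_(n + n) => E (rsubmx w)) by exact: germ_comp gE1 gr.
    have g1 := germ_law_comp gmu gEl gEr.
    have g2 : germ 1 (fun w : 'rV[R]_(n + n) => mu (row_mx (E (lsubmx w)) (E (rsubmx w)))).
      exact: germ_comp gmu1 (germ_row_mx gEl gEr).
    (* The remainder splits into [L - id] at the product, the remainder of [mu], and [E - id] at
       each of the two arguments, all of order 2. *)
    have := germD (germD (germ_comp gL g2) g1) (germD (germ_comp gE gl) (germ_comp gE gr)).
    apply: germ_ext => w; rewrite /l /e /mu row_mxKl row_mxKr.
    by rewrite [X in X + _ = _]addrA subrK [X in _ + X = _]addrACA [LHS]addrA subrK opprD.
  + apply: filterS2 dblE (germ1_near (germ_row_mx gE1 gE1) kimu) => v d1 d2.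
    by rewrite /e d1 d2 row_mxKl row_mxKr.
  + have g2 : germ 1 (fun v => io (E v)) by exact: germ_comp gio1 gE1.
    have := germD (germD (germ_comp gL g2) (germ_comp gio gE1)) (germZ (-1) gE).
    apply: germ_ext => v; rewrite /l /e /io.
    by rewrite addrA subrK scaleN1r opprB -addrA [E v + _]addrCA subrr addr0.
- apply/analytic_germ; have := germD (germ_cst (c 1%g)) (germ_le (leq0n 1) gE1).
  apply: germ_eq; apply: filterS (germ1_near gE1 kiK) => v [_ kE _].
  by rewrite add0r /= /e -[in LHS]kE /ka addrCA subrr addr0.
- apply/analytic_germ; have := germ_le (leq0n 1) gL1.
  apply: germ_eq; apply: filterS kiK => v [_ kv _].
  by rewrite /= /l -/(ki v) kv.
Qed.

End LieExponential.

(** * Baire category *)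

Section PolishFacts.
Context {R : realType} {T : topologicalType}.

Lemma dense_sequence (D : set T) : countable D -> dense D -> [set: T] !=set0 ->
  exists u : nat -> T, forall O, O !=set0 -> open O -> exists n, O (u n).
Proof.
move=> cD dD T0; have [x [_ Dx]] := dD _ T0 openT.
have /pfcard_geP[D0|/unsquash f] := cD; first by rewrite D0 in Dx.
exists f => O O0 oO; have [y [Oy Dy]] := dD _ O0 oO.
have [n _ fn] := @surj _ _ _ _ f _ Dy; by exists n; rewrite fn.
Qed.

Lemma polish_hausdorff : polish R T -> hausdorff_space T.
Proof.
move=> [_ [d [d0 dC dT dN _]]] x y clxy.
have dge a b : 0 <= d a b.
  have /d0 daa : a = a by [].
  by have := dT a b a; rewrite daa (dC b a); lra.
apply/d0/eqP; rewrite eq_le dge andbT; apply/ler_addgt0Pr => e e0; rewrite add0r.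
have e2 : 0 < e / 2 by rewrite divr_gt0.
have [||z []] := clxy [set z | d x z < e / 2] [set z | d y z < e / 2] _ _.
- by apply/dN; exists (e / 2).
- by apply/dN; exists (e / 2).
- by move=> /= xz yz; have := dT x z y; rewrite (dC z y); lra.
Qed.

Lemma polish_base : polish R T -> [set: T] !=set0 ->
  exists B : nat -> set T, (forall n, open (B n)) /\
    forall x U, nbhs x U -> exists n, B n x /\ B n `<=` U.
Proof.
move=> [[D cD dD] [d [d0 dC dT dN _]]] T0.
have [u hu] := dense_sequence cD dD T0.
have bo x e : open [set y | d x y < e].
  rewrite openE => y /= xy; apply/dN; exists (e - d x y); first by rewrite subr_gt0.
  by move=> z /=; have := dT x y z; lra.
exists (fun n => if (choice.unpickle n : option (nat * nat)) is Some (i,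
  k) then [set y | d (u i) y < (k.+1%:R^-1 : R)] else set0).
split=> [n|x U /dN[e e0 eU]].
  by case: choice.unpickle => [[i k]|]; [exact: bo | exact: open0].
have cv : (@harmonic R j) @[j --> \oo] --> 0 by exact: cvg_harmonic.
have [k _ /(_ k (leqnn _)) /= hk] := cvgr_lt _ cv _ (divr_gt0 e0 (ltr0Sn R 1)).
rewrite /harmonic in hk; have k0 : 0 < (k.+1%:R^-1 : R) by rewrite invr_gt0.
have [|i /= xi] := hu [set y | d x y < k.+1%:R^-1] _ (bo _ _).
  by exists x => /=; have /d0 -> : x = x by [].
exists (choice.pickle (i, k)); rewrite choice.pickleK; split => /=; first by rewrite dC.
move=> y /= iy; apply: eU => /=; apply: le_lt_trans (dT x (u i) y) _.
by rewrite [e]splitr; apply: ltrD; apply: lt_trans hk.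
Qed.

End PolishFacts.

Definition comeager (S : topologicalType) (A : set S) : Prop :=
  exists U : nat -> set S, (forall n, open (U n) /\ dense (U n)) /\ \bigcap_n U n `<=` A.

Section Comeager.
Context {S : topologicalType}.
Implicit Types A B : set S.

Lemma comeagerS A B : A `<=` B -> comeager A -> comeager B.
Proof. by move=> AB [U [hU UA]]; exists U; split => //; exact: subset_trans AB. Qed.

Lemma dense_setT : dense [set: S].
Proof. by move=> O [x Ox] _; exists x. Qed.

Lemma comeager_open A : open A -> dense A -> comeager A.
Proof. by move=> oA dA; exists (fun=> A); split => // x /(_ 0%N I). Qed.

Lemma comeager_bigcap (A : nat -> set S) : (forall n, comeager (A n)) ->
  comeager (\bigcap_n A n).
Proof.
move=> /choice[U hU].
exists (fun n => if (choice.unpickle n : option (nat * nat)) is Some (i,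
  j) then U i j else setT); split=> [n|x hx i _].
  case: choice.unpickle => [[i j]|]; first by have [h _] := hU i.
  by split; [exact: openT | exact: dense_setT].
have [_] := hU i; apply=> j _.
by have := hx (choice.pickle (i, j)) I; rewrite choice.pickleK.
Qed.

Lemma comeagerI A B : comeager A -> comeager B -> comeager (A `&` B).
Proof.
move=> cA cB; have := @comeager_bigcap (fun n => if n == 0%N then A else B).
move=> /(_ _)/comeagerS; apply; first by move=> x h; split; [exact: (h 0%N)|exact: (h 1%N)].
by case.
Qed.

End Comeager.

Lemma comeager_dense (R : realType) (V : completeNormedModType R) (A : set V) :
  comeager A -> dense A.
Proof.
move=> [U [hU UA]] O O0 oO; have [x [Ox Ux]] := Baire hU O0 oO.
by exists x; split => //; exact: UA.
Qed.

Lemma comeager_meet (R : realType) (A : set R) (W : set R) (x : R) : comeager A ->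
  nbhs x W -> exists2 y, W y & A y.
Proof.
move=> cA; rewrite nbhsE => -[Z [oZ Zx] ZW].
have [|y [Zy Ay]] := @comeager_dense R (R^o)%type A cA Z _ oZ; first by exists x.
by exists y => //; exact: ZW.
Qed.

(** An open set contains a small segment in the direction [v], and [g] maps it onto an interval; so
    preimages of dense open sets are dense. It serves for the coordinates, for their sum and for
    translations of the line. *)
Lemma comeager_preimage (R : realType) (V : normedModType R) (g : V -> R) v (A : set R) :
  continuous g -> (forall w t, g (w + t *: v) = g w + t) ->
  comeager A -> comeager (g @^-1` A).
Proof.
move=> gc gv [U [hU UA]]; exists (fun n => g @^-1` U n); split; last first.
  by move=> x hx; apply: UA => n _; exact: hx.
move=> n; have [oU dU] := hU n; split.
  by apply: open_comp => // x _; exact: gc.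
move=> O [w Ow] oO.
have cO : {for 0, continuous (fun t : R => w + t *: v)}.
  apply: (@continuousD _ _ _ (fun=> w) (fun t : R => t *: v)); first exact: cst_continuous.
  by apply: cvgZr_tmp; exact: cvg_id.
have : nbhs (0 : R) [set t | O (w + t *: v)].
  by apply: cO; rewrite scale0r addr0; exact: open_nbhs_nbhs.
move=> /nbhs_ballP[e /= e0 he].
have [|t [/= th Ut]] := dU (ball (g w) e) _ (ball_open _ _).
  by exists (g w); exact: ballxx.
exists (w + (t - g w) *: v); split; last by rewrite /= gv addrC subrK.
apply: he; move: th; rewrite -!ball_normE /=.
by rewrite sub0r normrN -normrN opprB.
Qed.

Definition baire_property (S : topologicalType) (E : set S) : Prop :=
  exists W, open W /\ comeager [set x | E x <-> W x].

Section BaireProperty.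
Context {S : topologicalType}.

Lemma baire_property_open (E : set S) : open E -> baire_property E.
Proof.
move=> oE; exists E; split => //; apply: (comeagerS _ (comeager_open openT dense_setT)).
by [].
Qed.

(** The exterior of [W] represents the complement: [W] and its exterior together form a dense open
    set, so the boundary is negligible. *)
Lemma baire_property_setC (E : set S) : baire_property E -> baire_property (~` E).
Proof.
move=> [W [oW cW]]; exists (~` closure W); split.
  by apply: closed_openC; exact: closed_closure.
have oWV : open (W `|` ~` closure W) by apply: openU => //;
  exact: closed_openC (@closed_closure _ _).
have dWV : dense (W `|` ~` closure W).
  move=> O [x Ox] oO; have [cx|ncx] := pselect (closure W x).
    by have [y [Wy Oy]] := cx O (open_nbhs_nbhs (conj oO Ox)); exists y; split => //; left.
  by exists x; split => //; right.
apply: comeagerS (comeagerI cW (comeager_open oWV dWV)) => x [/= EW [Wx|nWx]].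
  by split=> [/(_ (EW.2 Wx))//|]; move=> /(_ (subset_closure Wx)).
by split => // _ /EW Wx; apply: nWx; exact: subset_closure.
Qed.

Lemma baire_property_bigcup (E : nat -> set S) : (forall n, baire_property (E n)) ->
  baire_property (\bigcup_n E n).
Proof.
move=> /choice[W hW]; exists (\bigcup_n W n); split.
  by apply: bigcup_open => n _; have [] := hW n.
have := @comeager_bigcap _ (fun n => [set x | E n x <-> W n x]) (fun n => (hW n).2).
by apply: comeagerS => x hx; split=> -[n _ h]; exists n => //; apply/(hx n I).
Qed.

Lemma baire_property_borel (E : set S) : <<s [set U : set S | open U] >> E -> baire_property E.
Proof.
move=> sE; apply: sE; split; last exact: baire_property_open.
split.
- by apply: baire_property_open; exact: open0.
- by move=> A bA; rewrite setTD; exact: baire_property_setC.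
- exact: baire_property_bigcup.
Qed.

(** The preimage of each basic open set agrees with an open set off a meager set. On the
    intersection of these countably many comeager sets preimages are relatively open, so it is the
    restriction of [f] that is continuous. *)
Lemma borel_continuous_comeager (T : topologicalType) (B : nat -> set T) (f : S -> T) :
  (forall n, open (B n)) -> (forall x U, nbhs x U -> exists n, B n x /\ B n `<=` U) ->
  borel_fun f -> exists2 A, comeager A & forall x, A x -> f @ within A (nbhs x) --> f x.
Proof.
move=> oB bB bf.
have /choice[W hW] : forall n, exists W, open W /\ comeager [set x | B n (f x) <-> W x].
  move=> n; have := @baire_property_borel (f @^-1` B n) _; apply; apply: bf.
  by apply: sub_sigma_algebra => /=.
exists (\bigcap_n [set x | B n (f x) <-> W n x]).
  by apply: comeager_bigcap => n; exact: (hW n).2.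
move=> x Ax U /bB[n [Bn BU]].
have Wx : W n x by apply/(Ax n I).
have [oW _] := hW n.
apply: filterS (open_nbhs_nbhs (conj oW Wx)) => y Wy Ay; apply: BU.
by apply/(Ay n I).
Qed.

End BaireProperty.

(** Joins completeness with the norm on matrices, so that Baire's theorem applies to the plane
    ['rV_2]. *)
HB.instance Definition _ (R : realType) (m n : nat) := Complete.on 'M[R]_(m, n).

Section Box.
Context {R : realType} {H : topologicalGroupType}.
Variables (f : R -> H) (A : set R) (P : set H) (m : nat -> H) (rho : R).
Hypotheses (cA : comeager A) (fA : forall x, A x -> f @ within A (nbhs x) --> f x)
  (cP : closed P) (rho0 : 0 < rho).
Hypothesis cover : forall s t, 0 < s -> 0 < t -> s + t < rho ->
  exists k, P ((m k)^-1 * (f s * f t * (f (s + t))^-1))%g.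

Let V := 'rV[R]_2.
Let i0 : 'I_2 := ord0.
Let i1 : 'I_2 := ord_max.
Let p0 (w : V) := w ord0 i0.
Let p1 (w : V) := w ord0 i1.
Let ps (w : V) := p0 w + p1 w.

Let p0c : continuous p0. Proof. exact: coord_continuous. Qed.
Let p1c : continuous p1. Proof. exact: coord_continuous. Qed.
Let psc : continuous ps.
Proof. by move=> w; apply: (@continuousD _ _ _ p0 p1); [exact: p0c | exact: p1c]. Qed.

Let A2 := [set w : V | [/\ A (p0 w), A (p1 w) & A (ps w)]].

Let cA2 : comeager A2.
Proof.
have c0 := comeager_preimage p0c (v := delta_mx 0 i0) _ cA.
have c1 := comeager_preimage p1c (v := delta_mx 0 i1) _ cA.
have cs := comeager_preimage psc (v := delta_mx 0 i0) _ cA.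
apply: comeagerS (comeagerI (c0 _) (comeagerI (c1 _) (cs _))).
- by move=> w [? [? ?]].
- by move=> w t; rewrite /p0 !mxE !eqxx mulr1.
- by move=> w t; rewrite /p1 !mxE !eqxx mulr1.
- by move=> w t; rewrite /ps /p0 /p1 !mxE !eqxx mulr1 mulr0 addr0 addrAC.
Qed.

Let good k (w : V) := P ((m k)^-1 * (f (p0 w) * f (p1 w) * (f (ps w))^-1))%g.

Let within_comp (p : V -> R) (B : set V) (w : V) : continuous p -> (forall w, B w -> A (p w)) ->
  B w -> (f \o p) @ within B (nbhs w) --> f (p w).
Proof.
move=> pc BA Bw U /(fA (BA _ Bw)) hU.
have h : nbhs w (fun z => A (p z) -> U (f (p z))) by exact: (pc w _ hU).
by apply: filterS h => z /= h /BA; exact: h.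
Qed.

Let good_open k w : A2 w -> ~ good k w -> nbhs w [set z | A2 z -> ~ good k z].
Proof.
move=> Aw ng.
have h0 : (fun z => f (p0 z)) @ within A2 (nbhs w) --> f (p0 w).
  by apply: (within_comp p0c _ Aw) => z [].
have h1 : (fun z => f (p1 z)) @ within A2 (nbhs w) --> f (p1 w).
  by apply: (within_comp p1c _ Aw) => z [].
have hs : (fun z => f (ps z)) @ within A2 (nbhs w) --> f (ps w).
  by apply: (within_comp psc _ Aw) => z [].
have c : (fun z => (m k)^-1 * (f (p0 z) * f (p1 z) * (f (ps z))^-1))%g @ within A2 (nbhs w)
    --> ((m k)^-1 * (f (p0 w) * f (p1 w) * (f (ps w))^-1))%g.
  apply: cvgMg; first exact: cvg_cst.
  by apply: cvgMg; [exact: cvgMg | exact: cvgVg].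
by have := c _ (open_nbhs_nbhs (conj (closed_openC cP) ng)).
Qed.

(* Baire category in the plane, applied to the countably many translates [m k * P]. *)
Lemma defect_box : exists x0 y0 eps k,
  [/\ 0 < eps, eps < x0, eps < y0, x0 + y0 + 2 * eps < rho &
   forall x y, `|x - x0| < eps -> `|y - y0| < eps -> A x -> A y -> A (x + y) ->
     P ((m k)^-1 * (f x * f y * (f (x + y))^-1))%g].
Proof.
(* Without such a box the open sets [D k], on which [good k] fails at generic points of the triangle
   [B0], are all dense. A generic point of [B0] then lies in no translate, against [cover]. *)
apply: contrapT => nbox.
pose B0 := [set w : V | [/\ 0 < p0 w, 0 < p1 w & ps w < rho]].
pose D k := interior [set w | B0 w -> A2 w -> ~ good k w].
have oD k : open (D k) by exact: open_interior.
have dD k : dense (D k).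
  move=> Z [w Zw] oZ.
  have [ZB|ZB] := pselect (exists2 w, Z w & B0 w); last first.
    exists w; split => //; rewrite /D /interior.
    apply: filterS (open_nbhs_nbhs (conj oZ Zw)) => z Zz Bz; exfalso.
    by apply: ZB; exists z.
  move: ZB => [{Zw}w Zw [w0 w1 ws]].
  have /nbhs_ballP[e /= e0 he] := open_nbhs_nbhs (conj oZ Zw).
  pose eps := Num.min (e / 2) (Num.min (p0 w / 2) (Num.min (p1 w / 2) ((rho - ps w) / 4))).
  have eps0 : 0 < eps by rewrite !lt_min !divr_gt0// subr_gt0.
  have epse : eps < e.
    by rewrite (@le_lt_trans _ _ (e / 2)) ?ge_min ?lexx//; lra.
  have eps1 : eps < p0 w.
    by rewrite (@le_lt_trans _ _ (p0 w / 2)) ?ge_min ?lexx ?orbT//; lra.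
  have eps2 : eps < p1 w.
    by rewrite (@le_lt_trans _ _ (p1 w / 2)) ?ge_min ?lexx ?orbT//; lra.
  have eps3 : eps <= (rho - ps w) / 4 by rewrite !ge_min lexx !orbT.
  apply: contrapT => nZ; apply: nbox; exists (p0 w), (p1 w), eps, k; split => //.
    by move: eps3 ws; rewrite /ps; lra.
  move=> x y xw yw Ax Ay Axy; apply: contrapT => ng.
  pose z : V := \row_j (if j == i0 then x else y).
  have z0 : p0 z = x by rewrite /p0 mxE eqxx.
  have z1 : p1 z = y by rewrite /p1 mxE.
  have zs : ps z = x + y by rewrite /ps z0 z1.
  apply: nZ; exists z; split.
    apply: he; rewrite -ball_normE /=; apply: le_lt_trans epse.
    apply/rV_normP; first exact: ltW.
    move=> j; rewrite !mxE distrC; case: eqP => [->|j0]; first exact: ltW.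
    rewrite (_ : j = i1); first exact: ltW.
    by apply/val_inj; case: j j0 => -[|[|[]]]//= ? h; exfalso; apply: h; exact/val_inj.
  have Az : A2 z by rewrite /A2 /= z0 z1 zs.
  have ngz : ~ good k z by rewrite /good z0 z1 zs.
  rewrite /D /interior; apply: filterS (good_open Az ngz) => q hq _; exact: hq.
have cI := comeagerI cA2 (comeager_bigcap (fun k => comeager_open (oD k) (dD k))).
have oB0 : open B0.
  rewrite (_ : B0 = p0 @^-1` [set x | 0 < x] `&` (p1 @^-1` [set x | 0 < x] `&` ps @^-1` [set x |
    x < rho])); last first.
    by apply/seteqP; split=> [w []|w [? []]].
  by apply: openI; [|apply: openI]; apply: open_comp.
have [|w [[B1 B2 B3] [Aw Dw]]] := @comeager_dense R V _ cI B0 _ oB0.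
  exists (\row_j (rho / 4)); rewrite /B0 /= /ps /p0 /p1 !mxE.
  by split; move: rho0; lra.
have [k gk] := cover B1 B2 B3.
have := Dw k I; rewrite /D /interior => /nbhs_singleton; apply => //.
Qed.

End Box.

(** * Lifting one-parameter subgroups *)

Section LocalLift.
Context {R : realType} {H : topologicalGroupType}.
Variables (M P0 R0 U0 : set H) (m : nat -> H).
Hypotheses (MM : forall x y, M x -> M y -> M (x * y)%g) (MV : forall x, M x -> M x^-1%g)
  (MJ : forall x g, M x -> M (g^-1 * (x * g))%g).
Hypotheses (cP0 : closed P0) (cR0 : closed R0) (R01 : R0 1%g)
  (R0M : R0 `<=` M) (R0V : forall x, R0 x -> R0 x^-1%g)
  (P0R0 : forall a b, P0 a -> P0 b -> R0 (a^-1 * b)%g)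
  (U0n : nbhs 1%g U0) (R0U0 : forall a b, R0 a -> R0 b -> U0 (a * b)%g -> R0 (a * b)%g)
  (cover : forall x, M x -> exists k, P0 ((m k)^-1 * x)%g).
Variables (f : R -> H) (A : set R) (rho : R).
Hypotheses (cA : comeager A) (fA : forall x, A x -> f @ within A (nbhs x) --> f x)
  (rho0 : 0 < rho)
  (fM : forall s t, 0 <= s -> 0 <= t -> s + t < rho -> M (f s * f t * (f (s + t))^-1)%g).

Section FixedInterval.
Variables (x0 y0 eps z1 eta : R) (k0 : nat) (W0 : set H).
Hypotheses (eps0 : 0 < eps) (epsx : eps < x0) (epsy : eps < y0)
  (xyrho : x0 + y0 + 2 * eps < rho)
  (box : forall x y, `|x - x0| < eps -> `|y - y0| < eps -> A x -> A y -> A (x + y) ->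
     P0 ((m k0)^-1 * (f x * f y * (f (x + y))^-1))%g).
Hypotheses (eta0 : 0 < eta)
  (jz : forall s, `|s - z1| < eta -> `|s - (x0 + y0)| < eps / 2)
  (jU : forall s s' v, `|s - z1| < eta -> `|s' - z1| < eta -> A s -> A s' -> W0 v ->
     U0 (f s' * v^-1 * (f s)^-1)%g).

Definition window (s : R) := `|s - z1| < eta.

(* The pairs [(t, h)] such that, up to the compact set [R0], right translation by [h] carries
   [f s] to [f (s + t)] for generic [s]: a closed local semigroup lying over the cosets of [f]. *)
Definition translate (t : R) (h : H) := forall s, window s -> window (s + t) -> A s -> A (s + t) ->
  R0 (f (s + t) * h^-1 * (f s)^-1)%g.

Let addc (t : R) : continuous (fun s => s + t).
Proof.
move=> s; apply: (@continuousD _ _ _ id (fun=> t)); first exact: cvg_id.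
exact: cst_continuous.
Qed.

Let shiftA t : comeager [set s | A (s + t)].
Proof.
apply: (@comeager_preimage R (R^o)%type (fun s => s + t) 1 A _ _ cA); first exact: addc.
by move=> w s; rewrite scaler1 addrAC.
Qed.

Let window_open s : window s -> nbhs s window.
Proof.
rewrite /window => Js; apply/nbhs_ballP; exists (eta - `|s - z1|); first by rewrite /= subr_gt0.
move=> s'; rewrite -ball_normE /=.
rewrite distrC => ss'; have := ler_normD (s' - s) (s - z1); rewrite addrA subrK.
by move: ss'; rewrite /window; lra.
Qed.

Let window_open_add s t : window (s + t) -> nbhs s [set s' | window (s' + t)].
Proof. by move=> /window_open h; exact: (@addc t s _ h). Qed.

Let f_add s t : A (s + t) -> (fun s' => f (s' + t)) @ within [set s' | A (s' + t)] (nbhs s) -->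
  f (s + t).
Proof.
move=> As U /(fA As) hU.
have h : nbhs s (fun z => A (z + t) -> U (f (z + t))) by exact: (@addc t s _ hU).
exact: h.
Qed.

(** Further generic conditions [B] may be imposed on [s]: since [R0] is closed and [f] is continuous
    along generic points, a failure at one [s] would spread to a neighborhood, which meets [B]. *)
Lemma translate_generic t h (B : set R) : comeager B ->
  (forall s, window s -> window (s + t) -> A s -> A (s + t) -> B s ->
    R0 (f (s + t) * h^-1 * (f s)^-1)%g) ->
  translate t h.
Proof.
move=> cB hB s Js Jst As Ast; apply: contrapT => nR.
pose A' := [set s | A s /\ A (s + t)].
have c : (fun s' => f (s' + t) * h^-1 * (f s')^-1)%g @ within A' (nbhs s) -->
    (f (s + t) * h^-1 * (f s)^-1)%g.
  have mono (B' : set R) (g : R -> H) a : A' `<=` B' -> g @ within B' (nbhs s) --> a ->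
      g @ within A' (nbhs s) --> a.
    move=> AB ga U /ga hU; have h1 : nbhs s (fun z => B' z -> U (g z)) by exact: hU.
    by rewrite /fmap /within /=; apply: filterS h1 => z h2 /AB; exact: h2.
  apply: cvgMg; first apply: cvgMg; last 1 first.
  - by apply: cvgVg; apply: mono (fA As) => z [].
  - by apply: mono (f_add Ast) => z [].
  - exact: cvg_cst.
have h1 : nbhs s (fun z => A' z -> ~ R0 (f (z + t) * h^-1 * (f z)^-1)%g).
  exact: (c _ (open_nbhs_nbhs (conj (closed_openC cR0) nR))).
have := comeager_meet (comeagerI (comeagerI cA (shiftA t)) cB)
  (filterI h1 (filterI (window_open Js) (window_open_add Jst))).
by move=> [z [zR [Jz Jzt]] [[Az Azt] Bz]]; apply: zR (hB _ Jz Jzt Az Azt Bz).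
Qed.

(** Generic [s] are taken with all the [s + t_ j] generic at once; the relation then passes to the
    limit because [R0] is closed. *)
Lemma translate_closed (t_ : nat -> R) (h_ : nat -> H) t h : t_ j @[j --> \oo] --> t ->
  h_ j @[j --> \oo] --> h -> (forall j, translate (t_ j) (h_ j)) -> translate t h.
Proof.
move=> ct ch Qj; apply: (@translate_generic _ _ (\bigcap_j [set s | A (s + t_ j)])).
  by apply: comeager_bigcap => j; exact: shiftA.
move=> s Js Jst As Ast Bs.
have cst : s + t_ j @[j --> \oo] --> s + t by apply: cvgD => //; exact: cvg_cst.
have cf : f (s + t_ j) @[j --> \oo] --> f (s + t).
  move=> U /(fA Ast) hU; have h1 : nbhs (s + t) (fun z => A z -> U (f z)) by exact: hU.
  have h2 : \forall j \near \oo, A (s + t_ j) -> U (f (s + t_ j)) by exact: (cst _ h1).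
  have : \forall j \near \oo, U (f (s + t_ j)).
    by apply: filterS h2 => j h3; exact: (h3 (Bs j I)).
  by [].
have c : (f (s + t_ j) * (h_ j)^-1 * (f s)^-1)%g @[j --> \oo] --> (f (s + t) * h^-1 * (f s)^-1)%g.
  by apply: cvgMg; [apply: cvgMg => //; exact: cvgVg | exact: cvg_cst].
apply: (@closed_cvg _ _ \oo _ (fun j => (f (s + t_ j) * (h_ j)^-1 * (f s)^-1)%g) R0) => //.
have hJ : \forall j \near \oo, window (s + t_ j) by exact: (cst _ (window_open Jst)).
by apply: filterS hJ => j Jj; apply: Qj => //; exact: (Bs j I).
Qed.

(** The two relations are applied in succession, at [s] and at [s + t], which stays in the window
    because times are nonnegative. The product of the two elements of [R0] is again in [R0] because
    [jU] places it in [U0]; this is the purpose of [W0] and of a short window. *)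
Lemma translate_add t t' h h' : 0 <= t -> 0 <= t' -> translate t h -> translate t' h' ->
  W0 (h * h')%g ->
  translate (t + t') (h * h')%g.
Proof.
move=> t0 t0' Qt Qt' Wh; apply: (@translate_generic _ _ [set s | A (s + t)]); first exact: shiftA.
move=> s Js Jst As Ast Bs.
have Jt : window (s + t).
  move: Js Jst; rewrite /window !ltr_norml => /andP[a1 a2] /andP[b1 b2].
  by apply/andP; split; lra.
have r1 := Qt s Js Jt As Bs.
have := Qt' (s + t) Jt; rewrite -addrA => /(_ Jst Bs Ast) r2.
have := R0U0 r2 r1.
have -> : (f (s + (t + t')) * h'^-1 * (f (s + t))^-1 * (f (s + t) * h^-1 * (f s)^-1) =
   f (s + (t + t')) * (h * h')^-1 * (f s)^-1)%g.
  by rewrite invgM !mulgA mulgVK.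
by apply; apply: jU.
Qed.

Lemma translate_zero : translate 0 1%g.
Proof. by move=> s _ _ _ _; rewrite addr0 invg1 mulg1 mulgV. Qed.

Lemma translate_inv h : translate 0 h -> translate 0 h^-1%g.
Proof.
move=> Qh s Js Js0 As As0; rewrite addr0 in Js0 As0 *.
have := R0V (Qh s Js _ As _); rewrite addr0 => /(_ Js As).
by rewrite !invgM !invgK !mulgA.
Qed.

(** Two generic points [y < z] near [y0] give [t = z - y] and [h = (f y)^-1 * f z]. The defects at
    [(s - y, y)] and [(s - y, z)] lie in the same translate of [P0]; in their quotient [f (s - y)]
    cancels, and what is left is [f (s + t) * h^-1 * (f s)^-1]. *)
Lemma translate_small (N : set H) tau : nbhs 1%g N -> 0 < tau ->
  exists t h, [/\ 0 < t < tau, N h & translate t h].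
Proof.
move=> nN tau0; have e2 : 0 < eps / 2 by rewrite divr_gt0.
have [y yy0 Ay] := comeager_meet cA (nbhsx_ballx y0 _ e2).
rewrite -ball_normE /= in yy0.
have nf : nbhs y (fun z => A z -> N ((f y)^-1 * f z)%g).
  have c : (fun z => (f y)^-1 * f z)%g @ within A (nbhs y) --> (1%g : H).
    by rewrite -[1%g](mulVg (f y)); apply: cvgMg; [exact: cvg_cst | exact: fA].
  exact: (c _ nN).
have /nbhs_ballP[d /= d0 hd] := nf.
pose d' := Num.min d (Num.min tau (eps / 2)).
have d'0 : 0 < d' by rewrite !lt_min d0 tau0.
have [d1 d2 d3] : [/\ d' <= d, d' <= tau & d' <= eps / 2].
  by split; rewrite !ge_min lexx ?orbT.
have d'2 : 0 < d' / 2 by rewrite divr_gt0.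
have [z yz Az] := comeager_meet cA (nbhsx_ballx (y + d' / 2) _ d'2).
move: yz; rewrite -ball_normE /= ltr_norml => /andP[z1' z2'].
exists (z - y), ((f y)^-1 * f z)%g; split.
- by apply/andP; split; move: d'2 d2; lra.
- apply: (hd z) => //; rewrite -ball_normE /= ltr_norml; apply/andP; split; lra.
apply: (@translate_generic _ _ [set s | A (s - y)]); first exact: shiftA.
move=> s Js _ As Ast As'.
have xb : `|s - y - x0| < eps.
  have := ler_normB (s - (x0 + y0)) (y - y0); rewrite (_ : _ - (y - y0) = s - y - x0); last by ring.
  by have := jz Js; rewrite distrC in yy0; move: yy0; lra.
have yb : `|y - y0| < eps by rewrite distrC; move: yy0; lra.
have zb : `|z - y0| < eps.
  have := ler_normD (z - y) (y - y0); rewrite addrA subrK.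
  have : `|z - y| <= eps / 2 by rewrite ler_norml; apply/andP; split; lra.
  by rewrite distrC in yy0; move: yy0; lra.
have b1 := box xb yb As' Ay; rewrite subrK in b1; have {}b1 := b1 As.
have e : s - y + z = s + (z - y) by ring.
have b2 := box xb zb As' Az; rewrite e in b2; have {}b2 := b2 Ast.
have := P0R0 b2 b1; congr R0.
rewrite !invgM !invgK !mulgA mulgK; congr (_ * _)%g.
rewrite -!mulgA; congr (_ * _)%g; rewrite !mulgA mulgVK//.
Qed.

(** Conjugated by [f (s + t)], the element of [R0] and the defect at [(s, t)] multiply to
    [h^-1 * f t]; this is where normality of [M] enters. Centering [s] at [z1 - t / 2] keeps both
    [s] and [s + t] in the window. *)
Lemma translate_lift t h : 0 <= t < eta -> translate t h -> M ((f t)^-1 * h)%g.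
Proof.
move=> /andP[t0 teta] Qt.
have nJ : nbhs (z1 - t / 2) (fun s => window s /\ window (s + t)).
  apply: filterI; [apply: window_open | apply: window_open_add].
    by rewrite /window ltr_norml; apply/andP; split; lra.
  by rewrite /window ltr_norml; apply/andP; split; lra.
have [s [Js Jst] [As Ast]] := comeager_meet (comeagerI cA (shiftA t)) nJ.
have /R0M r := Qt s Js Jst As Ast.
have s0 : 0 <= s.
  by have := jz Js; rewrite ltr_norml => /andP[]; move: epsx epsy eps0; lra.
have st : s + t < rho.
  by have := jz Jst; rewrite ltr_norml => /andP[]; move: xyrho eps0; lra.
have d := fM s0 t0 st.
have := MV (MM (MJ (f (s + t)) r) (MJ (f (s + t)) d)).
by congr M; rewrite !mulgA mulVg mul1g mulgVK mulgK mulgVK invgM invgK.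
Qed.

End FixedInterval.
End LocalLift.

(** * Cartan's limit argument for closed local semigroups *)

Lemma bounded_subsequence (R : realType) n (w : nat -> 'rV[R]_n) (C : R) :
  (forall k, `|w k| <= C) ->
  exists (W : 'rV[R]_n) (phi : nat -> nat),
    (forall j, (j <= phi j)%N) /\ w (phi j) @[j --> \oo] --> W.
Proof.
move=> wC; pose K := [set v : 'rV[R]_n | `|v| <= C].
have cK : compact K.
  apply: bounded_closed_compact.
    exists C; split; first exact: num_real.
    by move=> D CD v /= vC; apply: le_trans vC _; exact: ltW.
  rewrite (_ : K = (fun v : 'rV[R]_n => `|v|) @^-1` [set x | x <= C])//.
  by apply: closed_comp => [v _|]; [exact: norm_continuous | exact: closed_le].
have [|W [_ clW]] := cK (w @ \oo) _ _.
  by exists 0%N => // k _; exact: wC.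
have /choice[phi hphi] : forall j : nat, exists k, (j <= k)%N /\ `|W - w k| < j.+1%:R^-1.
  move=> j; have j0 : 0 < (j.+1%:R^-1 : R) by rewrite invr_gt0.
  have [|_ [[k /= jk <-] hk]] := clW [set w k | k in [set k | (j <= k)%N]] _ _ (nbhsx_ballx W _ j0).
    by exists j => // k /= jk; exists k.
  by exists k; split => //; rewrite -ball_normE /= in hk.
exists W, phi; split => [j|]; first by have [] := hphi j.
apply/cvgrPdist_lt => d d0.
have cv : (@harmonic R j) @[j --> \oo] --> 0 by exact: cvg_harmonic.
have [N _ hN] := cvgr_lt _ cv _ d0; exists N => // j /= /hN /= hj.
by apply: lt_trans hj; have [] := hphi j.
Qed.

Section Cartan.
Context {R : realType} {H : topologicalGroupType} {n : nat}.
Variables (e : 'rV[R]_n -> H) (l : H -> 'rV[R]_n) (ex : exp_coordinates e l).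
Variables (Q : R -> H -> Prop) (W0 : set H).
Hypotheses (W0n : nbhs 1%g W0)
  (Qclosed : forall (t_ : nat -> R) (h_ : nat -> H) t h, t_ j @[j --> \oo] --> t ->
     h_ j @[j --> \oo] --> h -> (forall j, Q (t_ j) (h_ j)) -> Q t h)
  (Qadd : forall t t' h h', 0 <= t -> 0 <= t' -> Q t h -> Q t' h' -> W0 (h * h')%g ->
     Q (t + t') (h * h')%g)
  (Q0 : Q 0 1%g) (Qinv : forall h, Q 0 h -> Q 0 h^-1%g)
  (Qsmall : forall (N : set H) tau, nbhs 1%g N -> 0 < tau ->
     exists t h, [/\ 0 < t < tau, N h & Q t h]).

Let exp_radius : exists b K, [/\ 0 < b, 0 <= K,
  (forall v, `|v| <= b -> [/\ W0 (e v), {for v, continuous e} & e (- v) = (e v)^-1%g]),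
  (forall v s t, 0 <= s -> 0 <= t -> `|(s + t) *: v| <= b ->
     e ((s + t) *: v) = (e (s *: v) * e (t *: v))%g) &
  (forall a c x, `|a| <= x -> `|c| <= x -> x <= b ->
     [/\ W0 (e a * e c)%g, e (l (e a * e c)%g) = (e a * e c)%g &
         `|l (e a * e c)%g - (a + c)| <= K * x ^+ 2])].
Proof.
have [r r0 radd] := exp_add ex.
have [K K0 hK] := germ_quad (exp_product ex).
have ecv (m : nat) (u : 'rV[R]_m -> 'rV[R]_n) : germ 1 u -> e \o u @ (0 : 'rV[R]_m) --> (1%g : H).
  move=> /germ_cvg gu; have := nbhs_singleton (exp_continuous ex); rewrite -(exp0 ex) => ec.
  exact: (continuous_cvg _ ec gu).
have W1 : \forall v \near (0 : 'rV[R]_n), W0 (e v) by exact: (ecv _ _ germ_id _ W0n).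
have mcv : (fun w : 'rV[R]_(n + n) => e (lsubmx w) * e (rsubmx w))%g @ (0 : 'rV[R]_(n + n)) -->
  (1%g : H).
  rewrite -[1%g]mulg1; apply: cvgMg_at; first exact: (ecv _ _ germ_lsubmx).
  exact: (ecv _ _ germ_rsubmx).
have W2 : \forall w \near (0 : 'rV[R]_(n + n)), W0 (e (lsubmx w) * e (rsubmx w))%g.
  exact: (mcv _ W0n).
have lK2 : \forall w \near (0 : 'rV[R]_(n + n)),
    e (l (e (lsubmx w) * e (rsubmx w))%g) = (e (lsubmx w) * e (rsubmx w))%g.
  exact: (mcv _ (logK ex)).
have /nbhs_ballP[b1 /= b10 h1] := near_and W1 (near_and (exp_continuous ex) (exp_opp ex)).
have /nbhs_ballP[b2 /= b20 h2] := near_and W2 (near_and lK2 hK).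
pose b := Num.min (r / 2) (Num.min (b1 / 2) (b2 / 2)).
have b0 : 0 < b by rewrite !lt_min !divr_gt0.
have [br bb1 bb2] : [/\ b < r, b < b1 & b < b2].
  have : [/\ b <= r / 2, b <= b1 / 2 & b <= b2 / 2] by split; rewrite !ge_min lexx ?orbT.
  by move=> [? ? ?]; split; move: r0 b10 b20; lra.
exists b, K; split => //.
- move=> v vb; have [|? []//] := h1 v _.
  by rewrite -ball_normE /= sub0r normrN; exact: le_lt_trans bb1.
- by move=> v s t s0 t0 vb; apply: radd => //; exact: le_lt_trans br.
- move=> a c x ax cx xb; have x0 := le_trans (normr_ge0 a) ax.
  have nw : `|row_mx a c| <= x.
    apply/rV_normP => // j; case: (split_ordP j) => k ->; rewrite ?row_mxEl ?row_mxEr.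
      by have /rV_normP := ax; apply.
    by have /rV_normP := cx; apply.
  have [|w1 [w2 w3]] := h2 (row_mx a c) _.
    by rewrite -ball_normE /= sub0r normrN; apply: le_lt_trans bb2; exact: le_trans xb.
  rewrite row_mxKl row_mxKr in w1 w2 w3; split => //.
  by apply: le_trans w3 _; rewrite ler_wpM2l// lerXn2r// nnegrE.
Qed.

Section FixedRadius.
Variables (b K : R).
Hypotheses (b0 : 0 < b) (K0 : 0 <= K)
  (e1 : forall v, `|v| <= b -> [/\ W0 (e v), {for v, continuous e} & e (- v) = (e v)^-1%g])
  (eadd : forall v s t, 0 <= s -> 0 <= t -> `|(s + t) *: v| <= b ->
     e ((s + t) *: v) = (e (s *: v) * e (t *: v))%g)
  (emul : forall a c x, `|a| <= x -> `|c| <= x -> x <= b ->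
     [/\ W0 (e a * e c)%g, e (l (e a * e c)%g) = (e a * e c)%g &
         `|l (e a * e c)%g - (a + c)| <= K * x ^+ 2]).

Let Q_pow t v k : 0 <= t -> `|k%:R *: v| <= b -> Q t (e v) -> Q (k%:R * t) (e (k%:R *: v)).
Proof.
move=> t0 + Qt; elim: k => [|k ih] kb; first by rewrite mul0r scale0r (exp0 ex).
have kb' : `|k%:R *: v| <= b.
  by apply: le_trans kb; rewrite !normrZ ler_wpM2r// !ger0_norm// ler_nat.
have [W _ _] := e1 kb.
rewrite -natr1 in kb W *; rewrite eadd// in W *; rewrite scale1r in W *.
by rewrite mulrDl mul1r; apply: Qadd => //; [rewrite mulr_ge0 | exact: ih].
Qed.

(* The powers [e (v_ j) ^+ k_ j] converge to [e V]. *)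
Let Q_limit (t_ : nat -> R) (v_ : nat -> 'rV[R]_n) (k_ : nat -> nat) t V :
  (forall j, 0 <= t_ j) -> (forall j, `|(k_ j)%:R *: v_ j| <= b) -> `|V| <= b ->
  (forall j, Q (t_ j) (e (v_ j))) ->
  (k_ j)%:R * t_ j @[j --> \oo] --> t -> (k_ j)%:R *: v_ j @[j --> \oo] --> V ->
  Q t (e V).
Proof.
move=> t0 kb Vb Qj ct cv; have [_ ec _] := e1 Vb.
apply: (Qclosed ct (h_ := fun j => e ((k_ j)%:R *: v_ j))).
  by apply: continuous_cvg.
by move=> j; exact: Q_pow.
Qed.

Let trunc_le (u x : R) : 0 <= u -> 0 < x ->
  (Num.truncn (u / x))%:R * x <= u < (Num.truncn (u / x))%:R * x + x.
Proof.
move=> u0 x0; have /andP[t1 t2] := truncn_itv (divr_ge0 u0 (ltW x0)).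
rewrite -ler_pdivlMr// t1 /=.
by rewrite -[X in _ < _ + X]mul1r -mulrDl natr1 -ltr_pdivrMr.
Qed.

Let trunc_cvg (u : R) (x_ : nat -> R) : 0 <= u -> (forall j, 0 < x_ j) ->
  x_ j @[j --> \oo] --> 0 -> (Num.truncn (u / x_ j))%:R * x_ j @[j --> \oo] --> u.
Proof.
move=> u0 x0 cx; apply/cvgrPdist_lt => d d0.
have [N _ hN] := cvgr_lt _ cx _ d0; exists N => // j /= /hN /= hj.
have /andP[t1 t2] := trunc_le u0 (x0 j).
rewrite ger0_norm ?subr_ge0//; move: t2 hj; lra.
Qed.

Let cvg0_le (x_ : nat -> R) (y_ : nat -> R) : (forall j, 0 <= x_ j <= y_ j) ->
  y_ j @[j --> \oo] --> 0 -> x_ j @[j --> \oo] --> 0.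
Proof.
move=> xy cy; apply/cvgrPdist_lt => d d0.
have [N _ hN] := cvgr_lt _ cy _ d0; exists N => // j /= /hN /= hj.
have /andP[x0 xyj] := xy j; rewrite sub0r normrN ger0_norm//.
exact: le_lt_trans hj.
Qed.

Let harmonic_cvg (phi : nat -> nat) : (forall j, (j <= phi j)%N) ->
  ((phi j).+1%:R^-1 : R) @[j --> \oo] --> 0.
Proof.
move=> hphi; apply: (@cvg0_le _ harmonic); last exact: cvg_harmonic.
move=> j; rewrite invr_ge0 ler0n /harmonic /= lef_pV2 ?posrE//.
by rewrite ler_nat ltnS hphi.
Qed.

(* If [v] is long compared to [t] then [e v] can be corrected, along a direction
   [W] with [Q 0 (e (u *: W))], to an element over the same [t] that is half as long. *)
Let halving : exists c beta, [/\ 0 < c, 0 < beta, beta <= b &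
  forall t v, 0 < t < beta -> `|v| <= beta -> Q t (e v) -> c * t < `|v| ->
    exists v', Q t (e v') /\ `|v'| <= `|v| / 2].
Proof.
apply: contrapT => nh.
(* The negation at [c = k + 1] and [beta = min(b, 1 / (k + 1))] gives pairs whose time is negligible
   against the length of the vector, and which cannot be halved over the same time. *)
have /choice[tv htv] : forall k : nat, exists tv : R * 'rV[R]_n,
    [/\ 0 < tv.1 < k.+1%:R^-1, `|tv.2| <= Num.min b k.+1%:R^-1, Q tv.1 (e tv.2),
        k.+1%:R * tv.1 < `|tv.2| &
        forall v', Q tv.1 (e v') -> `|tv.2| / 2 < `|v'|].
  move=> k; apply: contrapT => nk; apply: nh.
  have k0 : 0 < (k.+1%:R^-1 : R) by rewrite invr_gt0.
  exists k.+1%:R, (Num.min b k.+1%:R^-1); split => //.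
  - by rewrite lt_min b0.
  - by rewrite ge_min lexx.
  move=> t v /andP[t0 tb] vb Qt ct; apply: contrapT => nv; apply: nk.
  exists (t, v); split => //=.
    by rewrite t0 (lt_le_trans tb)// ge_min lexx orbT.
  move=> v' Qv'; rewrite ltNge; apply/negP => vv; apply: nv.
  by exists v'.
pose t_ k := (tv k).1; pose v_ k := (tv k).2.
have t0 k : 0 < t_ k by have [/andP[]] := htv k.
have v0 k : 0 < `|v_ k|.
  by have [_ _ _ h _] := htv k; apply: le_lt_trans h; rewrite mulr_ge0// ltW// t0.
have vb k : `|v_ k| <= b by have [_ h _ _ _] := htv k; apply: le_trans h _; rewrite ge_min lexx.
have vk k : `|v_ k| <= k.+1%:R^-1.
  by have [_ h _ _ _] := htv k; apply: le_trans h _; rewrite ge_min lexx orbT.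
pose w_ k := `|v_ k|^-1 *: v_ k.
have w1 k : `|w_ k| = 1 by rewrite normrZ normfV normr_id mulVf// gt_eqF.
have w1le k : `|w_ k| <= 1 by rewrite w1.
have [W [phi [hphi cW]]] := bounded_subsequence w1le.
have cn : `|v_ (phi j)| @[j --> \oo] --> 0.
  apply: (cvg0_le _ (harmonic_cvg hphi)) => j.
  by rewrite normr_ge0 vk.
have W1 : `|W| = 1.
  have c1 : (fun j => `|w_ (phi j)|) @ \oo --> `|W| by exact: cvg_norm.
  rewrite (_ : (fun j => `|w_ (phi j)|) = fun=> 1) in c1; last by apply/funext.
  have c2 : (fun _ : nat => 1 : R) @ \oo --> (1 : R) by exact: cvg_cst.
  exact: (cvg_unique (@Rhausdorff R) c1 c2).
(* Powers of [e (v_ (phi j))] follow the direction [W] up to length [u], while their times, at most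
   [u / (phi j + 1)], tend to 0. *)
have QW u : 0 <= u <= b -> Q 0 (e (u *: W)).
  move=> /andP[u0 ub].
  pose k_ j := Num.truncn (u / `|v_ (phi j)|).
  have kE j : (k_ j)%:R *: v_ (phi j) = ((k_ j)%:R * `|v_ (phi j)|) *: w_ (phi j).
    by rewrite scalerA mulfK// gt_eqF.
  apply: (@Q_limit (t_ \o phi) (v_ \o phi) k_) => /=.
  - by move=> j; exact: ltW.
  - move=> j; rewrite normrZ ger0_norm//; apply: le_trans ub.
    by have /andP[] := trunc_le u0 (v0 (phi j)).
  - by rewrite normrZ W1 mulr1 ger0_norm.
  - by move=> j; have [] := htv (phi j).
  - apply: (cvg0_le (y_ := fun j => u * (phi j).+1%:R^-1)).
      move=> j; apply/andP; split; first by rewrite mulr_ge0// ltW.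
      have /andP[h1 _] := trunc_le u0 (v0 (phi j)).
      have [_ _ _ h2 _] := htv (phi j).
      have h3 : t_ (phi j) <= `|v_ (phi j)| / (phi j).+1%:R.
        by rewrite ler_pdivlMr// mulrC ltW.
      apply: le_trans (_ : (k_ j)%:R * (`|v_ (phi j)| / (phi j).+1%:R) <= _).
        by rewrite ler_wpM2l.
      by rewrite mulrA ler_wpM2r// invr_ge0.
    by rewrite -[0](mulr0 u); apply: cvgM; [exact: cvg_cst | exact: harmonic_cvg].
  - under eq_fun do rewrite kE.
    by apply: cvgZ => //; exact: (@trunc_cvg u (fun j => `|v_ (phi j)|)).
(* Multiplying [e v] by [e (- |v| W)], which lies over time 0, leaves a logarithm of length at most
   [|v| * (K |v| + |w - W|)], hence at most [|v| / 2]: the forbidden halving. *)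
have small j : K * `|v_ (phi j)| + `|w_ (phi j) - W| <= 2^-1 -> False.
  move=> hj; pose v := v_ (phi j); pose x := `|v|.
  have x0 : 0 < x by exact: v0.
  have xW : `|- (x *: W)| <= x by rewrite normrN normrZ W1 mulr1 normr_id.
  have [h1 h2 h3] := emul (lexx x) xW (vb _).
  have [_ _ Qv _ hv] := htv (phi j).
  have QxW : Q 0 (e (- (x *: W))).
    have xWb : `|x *: W| <= b by rewrite normrZ W1 mulr1 normr_id vb.
    have [_ _ ->] := e1 xWb.
    by apply: Qinv; apply: QW; rewrite normr_ge0 vb.
  have Qn := Qadd (ltW (t0 (phi j))) (lexx 0) Qv QxW h1.
  rewrite addr0 -h2 in Qn; have := hv _ Qn.
  have -> : (tv (phi j)).2 = v by [].
  have h4 : `|v - x *: W| = x * `|w_ (phi j) - W|.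
    have -> : v - x *: W = x *: (w_ (phi j) - W).
      by rewrite scalerBr /w_ scalerA -/v -/x mulfV ?scale1r// gt_eqF.
    by rewrite normrZ normr_id.
  have := ler_normD (l (e v * e (- (x *: W)))%g - (v - x *: W)) (v - x *: W).
  rewrite subrK h4 => h5.
  have := ler_wpM2l (ltW x0) hj; rewrite mulrDr -/v -/x.
  move: h3 h5; rewrite expr2; set y := `|l _|; set z := `|l _ - _|.
  set q := x * `|_|; rewrite mulrA [K * x]mulrC -mulrA; lra.
have c0 : K * `|v_ (phi j)| + `|w_ (phi j) - W| @[j --> \oo] --> 0.
  rewrite -[0]addr0; apply: cvgD.
    by rewrite -[0](mulr0 K); apply: cvgM => //; exact: cvg_cst.
  rewrite (_ : 0 = `|W - W|); last by rewrite subrr normr0.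
  apply: cvg_norm.
  by apply: cvgB => //; exact: cvg_cst.
have half0 : 0 < (2^-1 : R) by rewrite invr_gt0.
have [N _ /(_ N (leqnn _)) /= hN] := cvgr_lt _ c0 _ half0.
by apply: (small N); exact: ltW.
Qed.

Lemma one_parameter_in : exists Z delta, 0 < delta /\
  forall u, 0 <= u < delta -> Q u (e (u *: Z)).
Proof.
have [c [beta [c0 beta0 betab half]]] := halving.
have qb N : (2^-1) ^+ N * beta <= beta.
  by apply: ler_piMl; [exact: ltW | apply: exprn_ile1; lra].
have short tau : 0 < tau -> exists t v, [/\ 0 < t < tau, `|v| <= c * t, `|v| <= b & Q t (e v)].
  move=> tau0.
  have nl : \forall h \near (1%g : H), e (l h) = h /\ `|l h| <= beta.
    apply: near_and (logK ex) _.
    have lc := nbhs_singleton (log_continuous ex).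
    have l1 : l 1%g = 0 by rewrite -(exp0 ex); exact: (nbhs_singleton (expK ex)).
    have nb : nbhs (l 1%g) [set v | `|v| <= beta].
      rewrite l1; apply/nbhs_ballP; exists beta => //= v.
      by rewrite -ball_normE /= sub0r normrN => /ltW.
    exact: (lc _ nb).
  have tb0 : 0 < Num.min tau beta by rewrite lt_min tau0.
  have [t [h [/andP[t0 ttau] [eh lh] Qt]]] := Qsmall nl tb0.
  have tt : t < tau by apply: lt_le_trans ttau _; rewrite ge_min lexx.
  have tbeta : t < beta by apply: lt_le_trans ttau _; rewrite ge_min lexx orbT.
  (* Halving leaves [t] unchanged, so the length drops to at most [c * t] after finitely many
     steps. *)
  have iter N : (exists v, [/\ `|v| <= c * t, `|v| <= b & Q t (e v)]) \/
      (exists v, `|v| <= (2^-1) ^+ N * beta /\ Q t (e v)).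
    elim: N => [|N [ih|[v [vN Qv]]]]; [right|by left|].
      by exists (l h); rewrite expr0 mul1r eh.
    have vbeta : `|v| <= beta.
      exact: le_trans vN (qb N).
    have [vc|vc] := leP `|v| (c * t).
      by left; exists v; split => //; exact: le_trans betab.
    right; have [|v' [Qv' vv']] := half t v _ vbeta Qv vc; first by rewrite t0.
    by exists v'; split => //; apply: le_trans vv' _; rewrite exprS; lra.
  have cv : (2^-1 : R) ^+ N @[N --> \oo] --> 0 by apply: cvg_expr; rewrite ger0_norm; lra.
  have ct0 : 0 < c * t / beta by rewrite !mulr_gt0// invr_gt0.
  have [N _ /(_ N (leqnn _)) /= hN] := cvgr_lt _ cv _ ct0.
  have [[v [v1 v2 v3]]|[v [vN Qv]]] := iter N; first by exists t, v; rewrite t0.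
  exists t, v; rewrite t0 tt; split => //.
    by apply: le_trans vN _; rewrite -ler_pdivlMr// ltW.
  exact: le_trans vN (le_trans (qb N) betab).
have /choice[tv htv] : forall k : nat, exists tv : R * 'rV[R]_n,
    [/\ 0 < tv.1 < k.+1%:R^-1, `|tv.2| <= c * tv.1, `|tv.2| <= b & Q tv.1 (e tv.2)].
  move=> k; have k0 : 0 < (k.+1%:R^-1 : R) by rewrite invr_gt0.
  by have [t [v h]] := short _ k0; exists (t, v).
pose t_ k := (tv k).1; pose v_ k := (tv k).2.
have t0 k : 0 < t_ k by have [/andP[]] := htv k.
(* The slopes are bounded by [c], so they accumulate at some [Z]. Powers whose time tends to [u]
   then converge to [e (u *: Z)], and [u < b / c] keeps them within radius [b]. *)
pose z_ k := (t_ k)^-1 *: v_ k.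
have zc k : `|z_ k| <= c.
  rewrite normrZ gtr0_norm ?invr_gt0// mulrC ler_pdivrMr//.
  by have [] := htv k.
have [Z [phi [hphi cZ]]] := bounded_subsequence zc.
have Zc : `|Z| <= c.
  apply: (@closed_cvg _ _ \oo _ (fun j => z_ (phi j)) [set v | `|v| <= c]) => //.
    rewrite (_ : [set v | _] = (fun v : 'rV[R]_n => `|v|) @^-1` [set x | x <= c])//.
    by apply: closed_comp => [v _|]; [exact: norm_continuous | exact: closed_le].
  by exists 0%N => // k _; exact: zc.
exists Z, (b / c); split; first by rewrite divr_gt0.
move=> u /andP[u0 ub]; have cub : u * c <= b by rewrite -ler_pdivlMr// ltW.
pose k_ j := Num.truncn (u / t_ (phi j)).
have kE j : (k_ j)%:R *: v_ (phi j) = ((k_ j)%:R * t_ (phi j)) *: z_ (phi j).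
  by rewrite scalerA mulfK// gt_eqF.
have ck : (k_ j)%:R * t_ (phi j) @[j --> \oo] --> u.
  apply: (@trunc_cvg u (fun j => t_ (phi j))) => //.
  apply: (cvg0_le _ (harmonic_cvg hphi)) => j.
  by have [/andP[h1 /ltW h2] _ _ _] := htv (phi j); rewrite ltW.
apply: (@Q_limit (t_ \o phi) (v_ \o phi) k_) => //=.
- by move=> j; exact: ltW.
- move=> j; rewrite kE normrZ; apply: le_trans cub.
  have /andP[h1 _] := trunc_le u0 (t0 (phi j)).
  by apply: ler_pM => //; rewrite ger0_norm// mulr_ge0// ltW.
- by rewrite normrZ ger0_norm//; apply: le_trans cub; rewrite ler_wpM2l.
- by move=> j; have [] := htv (phi j).
- by under eq_fun do rewrite kE; apply: cvgZ.
Qed.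

End FixedRadius.

Lemma cartan_one_parameter : exists Z delta, 0 < delta /\
  forall u, 0 <= u < delta -> Q u (e (u *: Z)).
Proof. by have [b [K [? ? ? ? ?]]] := exp_radius; exact: (@one_parameter_in b K). Qed.

End Cartan.

(** * Countable partitions of an interval into closed sets *)

Section IntervalClasses.
Context {R : realType}.

(* Sierpinski's argument: nested intervals avoid the countably many classes one after the other. *)
Let half_step (E : R -> R -> Prop) a b x0 :
  (forall x y z, E x y -> E y z -> E x z) -> (forall x y, E x y -> E y x) ->
  (forall x, closed [set y | E x y]) -> a <= x0 <= b -> E x0 x0 -> ~ E x0 a ->
  exists b', [/\ a <= b' <= b, ~ E a b' & forall y, a <= y <= b' -> ~ E x0 y].
Proof.
move=> tr sy cl /andP[ax xb] xx nxa.
pose S := [set y | a <= y /\ E x0 y].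
have Sx : S x0 by split.
have hS : has_inf S by split; [exists x0 | exists a => y []].
have aS : a <= inf S by apply: lb_le_inf; [exists x0 | move=> y []].
have Sxc : inf S <= x0 by apply: ge_inf => //; case: hS.
have Ec : E x0 (inf S).
  have : closure [set y | E x0 y] (inf S).
    move=> B /nbhs_ballP[d /= d0 hd]; have [y [ay Ey] yd] := inf_adherent d0 hS.
    exists y; split => //; apply: hd; rewrite -ball_normE /= ltr_norml.
    have : inf S <= y by apply: ge_inf => //; case: hS.
    by move=> iy; apply/andP; split; lra.
  by rewrite -(closure_id _).1//; exact: cl.
have below y : a <= y < inf S -> ~ E x0 y.
  move=> /andP[ay yc] Ey; have : inf S <= y by apply: ge_inf; [case: hS|split].
  by rewrite leNgt yc.
have ac : a < inf S.
  by rewrite lt_neqAle aS andbT; apply/eqP => ac; apply: nxa; rewrite ac.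
(* Otherwise every point of [[a, inf S)] is equivalent to [a], and so is [inf S] because classes are
   closed; but [inf S] is equivalent to [x0]. *)
apply: contrapT => nb; apply: nxa; apply: tr Ec _; apply: sy.
have : closure [set y | E a y] (inf S).
  move=> B /nbhs_ballP[d /= d0 hd].
  pose y := Num.max a (inf S - d / 2).
  have yc : y < inf S by rewrite gt_max ac; lra.
  have ay : a <= y by rewrite le_max lexx.
  have yd : inf S - d / 2 <= y by rewrite le_max lexx orbT.
  exists y; split; last by apply: hd; rewrite -ball_normE /= ltr_norml; apply/andP; split; lra.
  apply: contrapT => nE; apply: nb; exists y; split => //.
    by rewrite ay (ltW (lt_le_trans yc (le_trans Sxc xb))).
  by move=> z /andP[az zy]; apply: below; rewrite az (le_lt_trans zy yc).
by rewrite -(closure_id _).1//; exact: cl.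
Qed.

Lemma countable_closed_classes (E : R -> R -> Prop) (sigma : R -> nat) :
  (forall x y z, E x y -> E y z -> E x z) -> (forall x y, E x y -> E y x) ->
  (forall x, closed [set y | E x y]) -> (forall x y, sigma x = sigma y -> E x y) ->
  forall a b, a <= b -> E a b.
Proof.
move=> tr sy cl hs a0 b0 ab0; apply: contrapT => nE0.
(* Invariant of the nesting: inequivalent ends are what allows the next label to be removed in
   turn. *)
pose ok (k : nat) (p q : R * R) := p.1 <= p.2 -> ~ E p.1 p.2 ->
  [/\ p.1 <= q.1, q.1 <= q.2, q.2 <= p.2, ~ E q.1 q.2 &
      forall y, q.1 <= y <= q.2 -> sigma y <> k].
have step (k : nat) (p : R * R) : exists q, ok k p q.
  case: p => a b; rewrite /ok /=.
  have [ab|] := pselect (a <= b /\ ~ E a b); last first.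
    by move=> h; exists (a, b) => h1 h2; exfalso; apply: h.
  case: ab => ab nE.
  have [[x0 [x0ab x0k]]|nx] := pselect (exists x, a <= x <= b /\ sigma x = k); last first.
    exists (a, b) => _ _; split => // y yab yk; apply: nx; by exists y.
  have avoid y : ~ E x0 y -> sigma y <> k.
    by move=> nEy yk; apply: nEy; apply: hs; rewrite x0k.
  have xx : E x0 x0 by exact: hs.
  have [nxa|xa] := pselect (~ E x0 a).
    have [b' [/andP[ab' b'b] nab' hb']] := half_step tr sy cl x0ab xx nxa.
    exists (a, b') => _ _; split => //= y /hb'; exact: avoid.
  (* The class of [x0] cannot contain both ends. If it contains [a], the half step is applied to the
     relation reflected by [x |-> - x]. *)
  have nxb : ~ E x0 b.
    by move=> xb; apply: xa => xa; apply: nE; apply: tr (sy _ _ xa) xb.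
  pose E' x y := E (- x) (- y).
  have cl' x : closed [set y | E' x y].
    rewrite (_ : [set y | _] = -%R @^-1` [set y | E (- x) y])//.
    by apply: closed_comp => // y _; exact: opp_continuous.
  have [|||b' [/andP[ab' b'b] nab' hb']] := @half_step E' (- b) (- a) (- x0)
    (fun x y z => tr _ _ _) (fun x y => sy _ _) cl' _ _ _.
  - by case/andP: x0ab => ? ?; rewrite !lerN2; apply/andP.
  - by rewrite /E' opprK.
  - by rewrite /E' !opprK.
  exists (- b', b) => _ _; split => //=; [by rewrite lerNr|by rewrite lerNl| |].
    by move=> Eb; apply: nab'; rewrite /E' opprK; exact: sy.
  move=> y /andP[y1 y2]; apply: avoid; have := hb' (- y); rewrite /E' !opprK; apply.
  by rewrite lerN2 y2 lerNl.
have /choice[F hF] : forall kp : nat * (R * R), exists q, ok kp.1 kp.2 q.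
  by move=> [k p]; exact: step.
pose p := fix p k := if k is k'.+1 then F (k', p k') else (a0, b0).
have pk k : (p k).1 <= (p k).2 /\ ~ E (p k).1 (p k).2.
  by elim: k => [//|k [h1 h2]]; have [] := hF (k, p k) h1 h2.
have nest k : [/\ (p k).1 <= (p k.+1).1, (p k.+1).2 <= (p k).2 &
    forall y, (p k.+1).1 <= y <= (p k.+1).2 -> sigma y <> k].
  by have [h1 h2] := pk k; have [] := hF (k, p k) h1 h2.
have mono1 j k : (j <= k)%N -> (p j).1 <= (p k).1.
  elim: k => [|k ih]; first by rewrite leqn0 => /eqP ->.
  rewrite leq_eqVlt => /orP[/eqP ->//|/ih h].
  by apply: le_trans h _; have [] := nest k.
have mono2 j k : (j <= k)%N -> (p k).2 <= (p j).2.
  elim: k => [|k ih]; first by rewrite leqn0 => /eqP ->.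
  rewrite leq_eqVlt => /orP[/eqP ->//|/ih h].
  by apply: le_trans h; have [] := nest k.
have le12 j k : (p j).1 <= (p k).2.
  have [h _] := pk (maxn j k).
  by rewrite (le_trans (mono1 _ _ (leq_maxl j k)))// (le_trans h)// mono2// leq_maxr.
(* The supremum of the left ends lies in every interval, yet its own label was removed at some
   step. *)
pose S := [set (p k).1 | k in [set: nat]].
have bS k : ubound S (p k).2 by move=> _ [j _ <-].
have S0 : S !=set0 by exists (p 0%N).1, 0%N.
have inS k : (p k).1 <= sup S <= (p k).2.
  apply/andP; split; last exact: ge_sup.
  by apply: ub_le_sup; [exists (p 0%N).2; exact: bS | exists k].
by have [_ _ /(_ (sup S) (inS _))] := nest (sigma (sup S)).
Qed.

End IntervalClasses.

(** * Plaques of the subgroup [M] *)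

Section Plaques.
Context {R : realType} {H : topologicalGroupType}.
Variables (M P0 R0 U0 : set H) (m : nat -> H).
Hypotheses (cR0 : closed R0) (R0V : forall x, R0 x -> R0 x^-1%g)
  (P0R0 : forall a b, P0 a -> P0 b -> R0 (a^-1 * b)%g)
  (R0U0 : forall a b, R0 a -> R0 b -> U0 (a * b)%g -> R0 (a * b)%g)
  (cover : forall x, M x -> exists k, P0 ((m k)^-1 * x)%g).

(** Lying in [R0] after left division is an equivalence relation on times, transitive because the
    path varies only within [U0]. Times whose values lie in the same translate of [P0] are
    equivalent, so classes are countably many, and closed, hence there is just one. *)
Lemma path_in_plaque (gam : R -> H) : continuous gam -> (forall t, M (gam t)) ->
  (forall s t, U0 ((gam s)^-1 * gam t)%g) -> gam 0 = 1%g -> R0 (gam 1).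
Proof.
move=> gc gM gU g0.
have /choice[sigma hs] : forall t, exists k, P0 ((m k)^-1 * gam t)%g by move=> t; exact: cover.
have := @countable_closed_classes R (fun s t => R0 ((gam s)^-1 * gam t)%g) sigma _ _ _ _ 0 1 ler01.
rewrite g0 invg1 mul1g; apply.
- move=> x y z xy yz; have := R0U0 xy yz.
  have -> : ((gam x)^-1 * gam y * ((gam y)^-1 * gam z) = (gam x)^-1 * gam z)%g.
    by rewrite !mulgA mulgK.
  by apply; exact: gU.
- by move=> x y /R0V; rewrite invgM invgK.
- move=> x; rewrite (_ : [set y | _] = (fun y => (gam x)^-1 * gam y)%g @^-1` R0)//.
  apply: closed_comp => // y _; apply: cvgMg_at; last exact: gc.
  exact: cvg_cst.
- move=> x y xy; have := P0R0 (hs x) (hs y); rewrite xy.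
  by rewrite invgM invgK !mulgA mulgK.
Qed.

End Plaques.

Lemma lie_compact_nbhs (R : realType) (N : topologicalGroupType) (LN : lie_structure R N)
    (V : set N) : nbhs 1%g V -> exists K, [/\ compact K, nbhs 1%g K & K `<=` V].
Proof.
move=> nV; have [c cA c1] := lie_atlas_cover LN 1%g.
have [_ _ ic] := nbhs_singleton (chart_invK c1).
have nV' : \forall w \near c 1%g, V (chart_inv c w).
  by apply: (ic V); rewrite chartK.
have /nbhs_ballP[d /= d0 hd] := near_and (chart_invK c1) nV'.
have d2 : 0 < d / 2 by rewrite divr_gt0.
pose B := [set w : 'rV[R]_(lie_dim LN) | `|c 1%g - w| <= d / 2].
have hB w : B w -> [/\ {for w, continuous (chart_inv c)} & V (chart_inv c w)].
  move=> Bw; have [|[_ _ ?] ?] := hd w; last by split.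
  by rewrite -ball_normE /=; apply: le_lt_trans Bw _; lra.
have cB : compact B.
  apply: bounded_closed_compact.
    exists (`|c 1%g| + d / 2); split; first exact: num_real.
    move=> D CD w /= Bw; have := ler_normB (c 1%g) (c 1%g - w); rewrite subKr.
    by rewrite /B /= in Bw; move: Bw CD; lra.
  rewrite (_ : B = (fun w => `|c 1%g - w|) @^-1` [set x | x <= d / 2])//.
  apply: closed_comp => [w _|]; last exact: closed_le.
  apply: (@continuous_comp _ _ _ (fun w => c 1%g - w) Num.norm); last exact: norm_continuous.
  by apply: (@continuousB _ _ _ (fun=> c 1%g) id); [exact: cst_continuous | exact: cvg_id].
exists (chart_inv c @` B); split.
- apply: continuous_compact cB; apply: continuous_in_subspaceT => w.
  by rewrite inE => /hB[].
- have nB : \forall x \near (1%g : N), B (c x).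
    have cc := chart_continuous c1; apply: (cc B); apply/nbhs_ballP; exists (d / 2) => //= w.
    by rewrite -ball_normE /= => /ltW.
  apply: filterS2 nB (chart_dom_near c1) => x Bx dx.
  by exists (c x) => //; exact: chartK.
- by move=> _ [w /hB[_ ?] <-].
Qed.

Section SubgroupPlaques.
Context {R : realType} {H : polishGroupType R} {S : pred H} (N : polishSubgroupType S).
Variable LN : lie_structure R N.

Let hH : hausdorff_space H. Proof. exact: (polish_hausdorff (polishP (s := H))). Qed.

Let valM' (x y : N) : val (x * y)%g = (val x * val y)%g. Proof. exact: valM. Qed.
Let val1' : val (1%g : N) = 1%g. Proof. exact: val1. Qed.
Let valV' (x : N) : val (x^-1)%g = (val x)^-1%g.
Proof. by apply: (@mulgI _ (val x)); rewrite -valM' !mulgV val1'. Qed.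

Lemma val_compact_closed (K : set N) : compact K -> closed ((val : N -> H) @` K).
Proof.
move=> cK; apply: compact_closed => //; apply: continuous_compact cK.
by apply: continuous_subspaceT; exact: val_continuous.
Qed.

(* On a compact set the topology of [N] is the one induced by [H]. *)
Lemma compact_finer (K V : set N) : compact K -> nbhs 1%g V ->
  exists2 U, nbhs (1%g : H) U & forall x, K x -> U (val x) -> V x.
Proof.
move=> cK nV; have cKV : compact (K `\` V°).
  rewrite setDE; apply: compact_closedI => //.
  by apply: open_closedC; exact: open_interior.
exists (~` ((val : N -> H) @` (K `\` V°))).
  apply: open_nbhs_nbhs; split; first by apply: closed_openC; exact: val_compact_closed.
  move=> [x [Kx nVx] x1]; apply: nVx.
  have -> : x = 1%g by apply: val_inj; rewrite x1 val1'.
  exact: nV.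
move=> x Kx nx; apply: contrapT => nVx; apply: nx; exists x => //; split => //.
by move=> /interior_subset.
Qed.

(* [P0] and [R0] are images of compact identity neighborhoods of [N], [R0] being symmetric;
   in a small neighborhood [U0] of the identity of [H], [R0] is a local subgroup. *)
Lemma plaques : exists (P0 R0 U0 : set H) (m : nat -> H),
  [/\ closed P0 /\ closed R0,
      [/\ R0 1%g, (forall x, R0 x -> x \in S) & (forall x, R0 x -> R0 x^-1%g)],
      (forall a b, P0 a -> P0 b -> R0 (a^-1 * b)%g),
      nbhs 1%g U0 /\ (forall a b, R0 a -> R0 b -> U0 (a * b)%g -> R0 (a * b)%g) &
      (forall x, x \in S -> exists k, P0 ((m k)^-1 * x)%g) /\
      (forall V : set N, nbhs 1%g V -> exists2 U, nbhs 1%g U &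
         forall x : N, R0 (val x) -> U (val x) -> V x)].
Proof.
have div2 (V : set N) : nbhs 1%g V -> exists2 W, nbhs 1%g W &
    forall a b, W a -> W b -> V (a * b)%g /\ V (a^-1 * b)%g.
  move=> nV.
  have c1 : (fun p : N * N => p.1 * p.2)%g @ nbhs ((1%g, 1%g) : N * N) --> (1%g : N).
    by rewrite -[X in _ --> X]mulg1; exact: (mulg_continuous (s := N) (1%g, 1%g)).
  have c2 : (fun p : N * N => p.1^-1 * p.2)%g @ nbhs ((1%g, 1%g) : N * N) --> (1%g : N).
    rewrite -[X in _ --> X]mulg1 -[X in (X * _)%g]invg1; apply: cvgMg_at; last exact: cvg_snd.
    by apply: cvgVg_at; exact: cvg_fst.
  have [[A B] /= [nA nB] AB] := near_and (c1 _ nV) (c2 _ nV).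
  exists (A `&` B); first exact: filterI.
  by move=> a b [Aa _] [_ Bb]; exact: (AB (a, b)).
(* The compact set [C] receives the products of two elements of [K]. On [C] the topology of [H]
   detects membership in [K], which gives the local subgroup property. *)
have [C [cC nC _]] := lie_compact_nbhs LN (@filterT _ (nbhs (1%g : N)) _).
have [W nW hW] := div2 C nC.
have nWV : nbhs 1%g (W `&` [set x | W x^-1%g]).
  apply: filterI => //; have := @invg_continuous N 1%g; rewrite /continuous_at invg1; exact.
have [K1 [cK1 nK1 K1W]] := lie_compact_nbhs LN nWV.
pose K := K1 `|` (fun x : N => x^-1)%g @` K1.
have cK : compact K.
  apply: compactU => //; apply: continuous_compact cK1.
  by apply: continuous_subspaceT; exact: invg_continuous.
have nK : nbhs 1%g K by apply: filterS nK1 => x Kx; left.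
have KV x : K x -> K x^-1%g.
  by move=> [Kx|[y Ky <-]]; [right; exists x | left; rewrite invgK].
have KW x : K x -> W x by move=> [/K1W[]//|[y /K1W[_ ?] <-]].
have [W' nW' hW'] := div2 K nK.
have [P [cP nP PW']] := lie_compact_nbhs LN nW'.
have [U nU hU] := compact_finer cC nK.
have [[D cD dD] _] := polishP (s := N).
have [u hu] : exists u : nat -> N, forall O, O !=set0 -> open O -> exists n, O (u n).
  by apply: dense_sequence cD dD _; exists 1%g.
exists (val @` P), (val @` K), U, (fun k => val (u k)); split.
- by split; exact: val_compact_closed.
- split.
  + by exists 1%g; [exact: nbhs_singleton | exact: val1'].
  + by move=> _ [x _ <-]; exact: valP.
  + by move=> _ [x Kx <-]; exists x^-1%g; [exact: KV | exact: valV'].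
- move=> _ _ [a Pa <-] [b Pb <-]; exists (a^-1 * b)%g; last by rewrite valM' valV'.
  by have [] := hW' a b (PW' _ Pa) (PW' _ Pb).
- split=> // _ _ [a Ka <-] [b Kb <-] Uab; exists (a * b)%g => //.
  apply: hU; last by rewrite valM'.
  by have [] := hW a b (KW _ Ka) (KW _ Kb).
- split.
  + move=> x Sx; pose y : N := Sub x Sx.
    have yx : val y = x by exact: SubK.
    have c : (fun z => z^-1 * y)%g @ nbhs y --> (1%g : N).
      by rewrite -[X in _ --> X](mulVg y); apply: cvgMg_at; [apply: cvgVg_at;
        exact: cvg_id | exact: cvg_cst].
    (* These [z] form a neighborhood of [y], so one of them is a term of the dense sequence [u]. *)
    have nZ : nbhs y [set z | P (z^-1 * y)%g] by exact: (c _ nP).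
    have [|k hk] := hu (interior [set z | P (z^-1 * y)%g]) _ (@open_interior _ _).
      by exists y.
    exists k, ((u k)^-1 * y)%g; first exact: (interior_subset hk).
    by rewrite valM' valV' yx.
  + move=> V nV; have [Z nZ hZ] := compact_finer cK nV; exists Z => //.
    by move=> x [y Ky /val_inj yx]; apply: hZ; rewrite -yx.
Qed.

End SubgroupPlaques.

Lemma one_parameter_lift (R : realType) (H : polishGroupType R) (S : pred H)
    (N : polishSubgroupType S) (LN : lie_structure R N) n (e : 'rV[R]_n -> H) l
    (f : R -> H) rho :
  (forall x g, x \in S -> (x ^ g)%g \in S) -> exp_coordinates e l -> borel_fun f -> 0 < rho ->
  (forall s t, 0 <= s -> 0 <= t -> s + t < rho -> (f s * f t * (f (s + t))^-1)%g \in S) ->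
  exists Z delta, 0 < delta /\ forall u, 0 <= u < delta -> ((f u)^-1 * e (u *: Z))%g \in S.
Proof.
move=> norm ex bf rho0 fM.
have [P0 [R0 [U0 [m [[cP0 cR0] [R01 R0M R0V] P0R0 [U0n R0U0] [cover _]]]]]] := plaques LN.
pose M := [set x | x \in S].
have S1 (x : H) : x \in S -> exists y : N, val y = x by move=> Sx; exists (Sub x Sx); exact: SubK.
have MM x y : M x -> M y -> M (x * y)%g.
  move=> /S1[a <-] /S1[b <-]; rewrite /M /= -[(val a * val b)%g](valM a b); exact: valP.
have MV x : M x -> M x^-1%g.
  move=> /S1[a <-]; rewrite /M /=.
  have -> : (val a)^-1%g = val (a^-1)%g.
    by apply: (@mulgI _ (val a)); rewrite -[RHS](valM a) !mulgV [RHS]val1.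
  exact: valP.
have MJ x g : M x -> M (g^-1 * (x * g))%g by move=> Mx; exact: norm.
have [B [oB bB]] := polish_base (polishP (s := H)) (ex_intro _ 1%g I : [set: H] !=set0).
have [A cA fA] := borel_continuous_comeager oB bB bf.
have fM' s t : 0 <= s -> 0 <= t -> s + t < rho -> M (f s * f t * (f (s + t))^-1)%g by exact: fM.
have [|x0 [y0 [eps [k [eps0 epsx epsy xyrho box]]]]] := defect_box cA fA cP0 rho0 (m := m).
  by move=> s t s0 t0 st; apply: cover; apply: fM => //; exact: ltW.
have eps4 : 0 < eps / 4 by rewrite divr_gt0.
have [z1 zz Az] := comeager_meet cA (nbhsx_ballx (x0 + y0) _ eps4).
rewrite -ball_normE /= in zz.
(* Continuity of [p * q^-1 * r^-1] at [(f z1, 1, f z1)], where the value is 1, supplies [W2] and the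
   window on which [jU] holds; [z1] is generic so that [f] is continuous there along [A]. *)
have c : (fun p : H * H * H => p.1.1 * p.1.2^-1 * p.2^-1)%g @ nbhs ((f z1, 1%g), f z1) -->
  (1%g : H).
  have -> : nbhs (1%g : H) = nbhs (f z1 * 1^-1 * (f z1)^-1)%g by rewrite invg1 mulg1 mulgV.
  apply: cvgMg_at; [apply: cvgMg_at|apply: cvgVg_at; exact: cvg_snd].
    by apply: (@cvg_comp _ _ _ fst fst _ (nbhs (f z1, 1%g))); exact: cvg_fst.
  apply: cvgVg_at; apply: (@cvg_comp _ _ _ fst snd _ (nbhs (f z1, 1%g))); first exact: cvg_fst.
  exact: cvg_snd.
have [[V1 V2] /= [[[W1 W2] /= [nW1 nW2] W12] nV2] V12] := c _ U0n.
have /nbhs_ballP[d /= d0 hd] : nbhs z1 (fun s => A s -> W1 (f s) /\ V2 (f s)).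
  exact: (fA _ Az _ (filterI nW1 nV2)).
pose eta := Num.min d (eps / 4).
have eta0 : 0 < eta by rewrite lt_min d0.
have jz s : `|s - z1| < eta -> `|s - (x0 + y0)| < eps / 2.
  rewrite lt_min => /andP[_ sz]; have := ler_normD (s - z1) (z1 - (x0 + y0)).
  by rewrite addrA subrK => h; rewrite distrC in zz; apply: le_lt_trans h _; lra.
have jd s : `|s - z1| < eta -> A s -> W1 (f s) /\ V2 (f s).
  rewrite lt_min => /andP[sz _]; apply: hd.
  by rewrite -ball_normE /= distrC.
have jU s s' v : `|s - z1| < eta -> `|s' - z1| < eta -> A s -> A s' -> W2 v ->
    U0 (f s' * v^-1 * (f s)^-1)%g.
  move=> sz sz' As As' Wv; have [_ h2] := jd _ sz As; have [h1 _] := jd _ sz' As'.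
  by apply: (V12 ((f s', v), f s)); split => //; exact: W12.
pose q := translate R0 f A z1 eta.
have [||||||Z [delta [delta0 hZ]]] := @cartan_one_parameter R H n e l ex q W2.
- exact: nW2.
- by move=> t_ h_ t h; exact: (translate_closed cR0 cA fA).
- move=> t t' h h' t0 t0' Qt Qt' Wh.
  exact: (translate_add cR0 R0U0 cA fA jU t0 t0' Qt Qt' Wh).
- exact: translate_zero.
- exact: translate_inv.
- by move=> V tau nV tau0; exact: (translate_small cR0 P0R0 cA fA eps0 box jz).
exists Z, (Num.min delta eta); split; first by rewrite lt_min delta0.
move=> u /andP[u0]; rewrite lt_min => /andP[ud ueta].
have u1 : 0 <= u < eta by rewrite u0.
have u2 : 0 <= u < delta by rewrite u0.
exact: (translate_lift MM MV MJ R0M cA fM' eps0 epsx epsy xyrho jz u1 (hZ u u2)).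
Qed.

(** * Analytic local lifts *)

Section ExpWords.
Context {R : realType} {G : topologicalGroupType} {p n : nat}.
Variables (e : 'rV[R]_p -> G) (l : G -> 'rV[R]_p) (ex : exp_coordinates e l).
Variable Z : 'I_n -> 'rV[R]_p.

(* Canonical coordinates of the second kind. *)
Fixpoint exp_word (s : seq 'I_n) (t : 'rV[R]_n) : G :=
  if s is i :: s' then (e (t ord0 i *: Z i) * exp_word s' t)%g else 1%g.

(** Logarithm of [exp_word], formed one factor at a time so that each step is a composition of
    germs. *)
Fixpoint log_word (s : seq 'I_n) (t : 'rV[R]_n) : 'rV[R]_p :=
  if s is i :: s' then l (e (t ord0 i *: Z i) * e (log_word s' t))%g else 0.

Lemma germ_log_word s :
  germ 2 (fun t => log_word s t - \sum_(i <- s) t ord0 i *: Z i) /\ germ 1 (log_word s).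
Proof.
have sum1 s' : germ 1 (fun t : 'rV[R]_n => \sum_(i <- s') t ord0 i *: Z i).
  by apply: germ_sum => i; exact: germ_coord.
suff H : germ 2 (fun t => log_word s t - \sum_(i <- s) t ord0 i *: Z i).
  split => //; have := germD (germ_le (leqnSn 1) H) (sum1 s).
  by apply: germ_ext => t; rewrite subrK.
elim: s => [|i s ih] /=.
  by apply: germ_ext (germ0 _ _) => t; rewrite big_nil subrr.
have g1 : germ 1 (log_word s).
  have := germD (germ_le (leqnSn 1) ih) (sum1 s).
  by apply: germ_ext => t; rewrite subrK.
have := germD (germ_law_comp (mu := fun w => l (e (lsubmx w) * e (rsubmx w))%g)
  (exp_product ex) (germ_coord i (Z i)) g1) ih.
apply: germ_ext => t; rewrite row_mxKl row_mxKr big_cons.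
by rewrite !opprD -!addrA addKr.
Qed.

Lemma exp_wordE s : \forall t \near (0 : 'rV[R]_n), e (log_word s t) = exp_word s t.
Proof.
elim: s => [|i s ih] /=; first by apply: near_all => t; exact: (exp0 ex).
have ecv (u : 'rV[R]_n -> 'rV[R]_p) : germ 1 u -> e \o u @ (0 : 'rV[R]_n) --> (1%g : G).
  move=> /germ_cvg gu; have := nbhs_singleton (exp_continuous ex); rewrite -(exp0 ex) => ec.
  exact: (continuous_cvg _ ec gu).
have c : (fun t : 'rV[R]_n => e (t ord0 i *: Z i) * e (log_word s t))%g @ (0 : 'rV[R]_n) -->
  (1%g : G).
  rewrite -[1%g]mulg1; apply: cvgMg_at; first exact: (ecv _ (germ_coord i (Z i))).
  by apply: ecv; have [] := germ_log_word s.
have h : \forall t \near (0 : 'rV[R]_n),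
  e (l (e ((t : 'rV[R]_n) ord0 i *: Z i) * e (log_word s t))%g) =
    (e (t ord0 i *: Z i) * e (log_word s t))%g by exact: (c _ (logK ex)).
by apply: filterS2 h ih => t /= -> ->.
Qed.

End ExpWords.

(** As [g] is continuous only on [U], the induction over Borel sets concerns [U] intersected with
    the preimage, complements being taken relative to [U]. *)
Lemma borel_patch (S T : topologicalType) (U : set S) (f g : S -> T) : open U ->
  (forall x, U x -> {for x, continuous g}) -> borel_fun f ->
  borel_fun (fun x => if `[< U x >] then g x else f x).
Proof.
move=> oU gc bf B sB; pose Bo := <<s [set V : set S | open V] >>.
have [Bo0 BoC BoU] : sigma_algebra setT Bo by exact: smallest_sigma_algebra.
have BoO V : open V -> Bo V by move=> oV; exact: sub_sigma_algebra.
have BoCC V : Bo V -> Bo (~` V) by rewrite -setTD; exact: BoC.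
have BoUU V W : Bo V -> Bo W -> Bo (V `|` W).
  move=> hV hW; rewrite (_ : V `|` W = \bigcup_n (if n == 0%N then V else W)).
    by apply: BoU => -[].
  apply/seteqP; split => [x [Vx|Wx]|x [[|n] _ /= h]];
    [by exists 0%N|by exists 1%N|by left|by right].
have BoI V W : Bo V -> Bo W -> Bo (V `&` W).
  by move=> hV hW; rewrite -[V `&` W]setCK setCI;
    exact: (BoCC _ (BoUU _ _ (BoCC _ hV) (BoCC _ hW))).
have Ug : Bo (U `&` g @^-1` B).
  move: B sB; apply: smallest_sub.
    split => [|A hA|F hF].
    - by rewrite preimage_set0 setI0.
    - rewrite setTD (_ : U `&` _ = U `&` ~` (U `&` g @^-1` A)).
        by apply: BoI; [exact: BoO | exact: BoCC].
      by apply/seteqP; split => x [Ux h]; split => //; [case | move=> gA; apply: h].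
    - rewrite (_ : U `&` _ = \bigcup_n (U `&` g @^-1` F n)); first exact: BoU.
      by apply/seteqP; split => [x [Ux [n _ h]]|x [n _ [Ux h]]]; [exists n | split => //; exists n].
  move=> A /= oA; apply: BoO; rewrite openE => x [Ux gx].
  apply: filterI; first exact: open_nbhs_nbhs.
  by apply: (gc x Ux A); exact: open_nbhs_nbhs.
rewrite (_ : _ @^-1` B = (U `&` g @^-1` B) `|` (~` U `&` f @^-1` B)).
  by apply: (BoUU) => //; apply: BoI; [apply: (BoCC); exact: BoO | exact: bf].
apply/seteqP; split => x /=.
  by case: asboolP => [Ux h|nUx h]; [left | right].
by case: asboolP => [Ux [[]|[]]//|nUx [[]|[]]].
Qed.

Section LieAnalytic.
Context {R : realType} {G H : topologicalGroupType}.
Variables (LG : lie_structure R G) (LH : lie_structure R H).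

Lemma chart_inv_near n (c : chart R G n) x (P : G -> Prop) : chart_dom c x ->
  (\forall y \near x, P y) -> \forall w \near c x, P (chart_inv c w).
Proof.
move=> dx hP; have [_ _ ic] := nbhs_singleton (chart_invK dx).
by apply: (ic P); rewrite chartK.
Qed.

Lemma lie_analytic_eq (f g : G -> H) x : (\forall y \near x, f y = g y) ->
  lie_analytic_at LG LH f x -> lie_analytic_at LG LH g x.
Proof.
move=> fg [fc fa]; have fgx := nbhs_singleton fg; split.
  move=> V; rewrite -fgx => /fc fV.
  have h : nbhs x (fun y => V (f y)) by exact: fV.
  have : nbhs x (fun y => V (g y)) by apply: filterS2 fg h => y ->.
  by [].
move=> c d cA dA cx; rewrite -fgx => dx.
apply: analytic_eq (fa c d cA dA cx dx).
by apply: filterS (chart_inv_near cx fg) => w /= ->.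
Qed.

(** One pair of charts suffices: analytic transition maps carry the property to all others. *)
Lemma lie_analytic_chart (f : G -> H) x (c : chart R G (lie_dim LG)) (d : chart R H (lie_dim LH)) :
  lie_atlas LG c -> lie_atlas LH d -> chart_dom c x -> chart_dom d (f x) ->
  {for x, continuous f} -> analytic_at (d \o f \o chart_inv c) (c x) ->
  lie_analytic_at LG LH f x.
Proof.
move=> cA dA cx dfx fc fa; split => // c' d' cA' dA' cx' dfx'.
have a1 := lie_atlas_compatible cA' cA cx' cx.
have a3 := lie_atlas_compatible dA dA' dfx dfx'.
have a2 : analytic_at (d' \o f \o chart_inv c) (c x).
  have : analytic_at ((d' \o chart_inv d) \o (d \o f \o chart_inv c)) (c x).
    by apply: analytic_comp fa _; rewrite /= chartK.
  apply: analytic_eq.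
  have nf : \forall y \near x, chart_dom d (f y) by exact: (fc _ (chart_dom_near dfx)).
  by apply: filterS (chart_inv_near cx nf) => w /= dw; rewrite chartK.
have : analytic_at ((d' \o f \o chart_inv c) \o (c \o chart_inv c')) (c' x).
  by apply: analytic_comp a1 _; rewrite /= chartK.
apply: analytic_eq.
by apply: filterS (chart_inv_near cx' (chart_dom_near cx)) => w /= dw; rewrite chartK.
Qed.

End LieAnalytic.

Lemma borel_comp (S T U : topologicalType) (f : T -> U) (g : S -> T) :
  continuous g -> borel_fun f -> borel_fun (f \o g).
Proof.
move=> gc bf B /bf sB; rewrite comp_preimage.
pose Bo := <<s [set V : set S | open V] >>.
have [Bo0 BoC BoU] : sigma_algebra setT Bo by exact: smallest_sigma_algebra.
move: (f @^-1` B) sB; apply: smallest_sub.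
  split => [|A hA|F hF].
  - by rewrite preimage_set0.
  - by rewrite setTD preimage_setC -setTD; exact: BoC.
  - by rewrite preimage_bigcup; exact: BoU.
move=> A /= oA; apply: sub_sigma_algebra => /=.
by apply: open_comp => // x _; exact: gc.
Qed.

Section Clip.
Context {R : realType}.

(** Truncation to [[-b, b]], which extends a local curve continuously to the whole line, as
    [borel_comp] and [path_in_plaque] require. *)
Definition clip (b t : R) : R := Num.min b (Num.max (- b) t).

Lemma clip_continuous b : continuous (clip b).
Proof.
move=> t; apply: (@continuous_min _ _ (fun=> b) (fun t => Num.max (- b) t)).
  exact: cst_continuous.
apply: (@continuous_max _ _ (fun=> - b) id); first exact: cst_continuous.
exact: cvg_id.
Qed.

Lemma clip_id b t : - b <= t <= b -> clip b t = t.
Proof. by case/andP => h1 h2; rewrite /clip max_r// min_r. Qed.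

Lemma clip_bound b t : 0 <= b -> - b <= clip b t <= b.
Proof.
move=> b0; rewrite /clip le_min ge_min lexx /= le_max lexx andbT.
by rewrite (le_trans _ b0)// oppr_le0.
Qed.

End Clip.

Section LocalLift.
Context {R : realType} {C D : real_lie_cover R}.
Variable phi : {multiplicative cover_quotient C -> cover_quotient D}.
Notation G := (cover_group C).
Notation H := (cover_group D).

Let hG : hausdorff_space G. Proof. exact: (polish_hausdorff (polishP (s := G))). Qed.
Let hH : hausdorff_space H. Proof. exact: (polish_hausdorff (polishP (s := H))). Qed.

Let liftM (x x' : G) (y y' : H) : phi (coset_proj x) = coset_proj y ->
  phi (coset_proj x') = coset_proj y' -> phi (coset_proj (x * x')%g) = coset_proj (y * y')%g.
Proof. by move=> h h'; rewrite !coset_projM gmulfM h h'. Qed.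

Let lift1 : phi (coset_proj (1%g : G)) = coset_proj (1%g : H).
Proof.
apply: (@mulgI _ (phi (coset_proj 1%g))).
by rewrite -gmulfM -coset_projM mulg1; exact: esym (mulg1 _).
Qed.

Let liftV (x : G) (y : H) : phi (coset_proj x) = coset_proj y ->
  phi (coset_proj x^-1%g) = coset_proj y^-1%g.
Proof.
move=> h; apply: (@mulgI _ (phi (coset_proj x))).
by rewrite -gmulfM -coset_projM mulgV lift1 h -coset_projM mulgV.
Qed.

Lemma curve_lift n (eG : 'rV[R]_n -> G) lG p (eH : 'rV[R]_p -> H) lH v :
  borel_definable phi -> exp_coordinates eG lG -> exp_coordinates eH lH ->
  exists Z, \forall t \near (0 : R), phi (coset_proj (eG (t *: v))) = coset_proj (eH (t *: Z)).
Proof.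
move=> [f lf bf] exG exH.
have [r r0 eGadd] := exp_add exG.
have scal q (w : 'rV[R]_q) (P : 'rV[R]_q -> Prop) : (\forall y \near (0 : 'rV[R]_q), P y) ->
    \forall t \near (0 : R), P (t *: w).
  move=> hP; have c : (fun t : R => t *: w) @ (0 : R) --> (0 : 'rV[R]_q).
    by rewrite -[X in _ --> X](scale0r w); apply: cvgZr_tmp; exact: cvg_id.
  exact: (c _ hP).
have small : \forall t \near (0 : R), `|t *: v| < r /\
    ({for t *: v, continuous eG} /\ eG (- (t *: v)) = (eG (t *: v))^-1%g).
  apply: near_and; last exact: scal (near_and (exp_continuous exG) (exp_opp exG)).
  apply: (scal _ v (fun y => `|y| < r)); apply/nbhs_ballP; exists r => //= y.
  by rewrite -ball_normE /= sub0r normrN.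
have /nbhs_ballP[b' /= b'0 hb'] := small.
pose b := b' / 2; have b0 : 0 < b by rewrite divr_gt0.
have {hb'} hb t : - b <= t <= b -> `|t *: v| < r /\
    ({for t *: v, continuous eG} /\ eG (- (t *: v)) = (eG (t *: v))^-1%g).
  move=> tb; apply: hb'; rewrite -ball_normE /= sub0r normrN.
  by apply: le_lt_trans (_ : b < _); [rewrite ler_norml | rewrite /b; lra].
(* Clipping makes the curve continuous on all of [R], so [f \o c] is Borel; for nonnegative times
   with sum below [b] the curve is still additive, and its defects are defects of [f]. *)
pose c t := eG (clip b t *: v).
have cc : continuous c.
  move=> t; have [_ [ec _]] := hb _ (clip_bound t (ltW b0)).
  have zc : {for t, continuous (fun t : R => clip b t *: v)}.
    by apply: cvgZr_tmp; exact: clip_continuous.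
  exact: (@continuous_comp R 'rV[R]_n G (fun t => clip b t *: v) eG t zc ec).
have [|Z [delta [delta0 hZ]]] := one_parameter_lift (lie_cover_sub D) (f := f \o c) (rho := b)
   (@cover_normal _ D) exH (borel_comp cc bf) b0.
  move=> s t s0 t0 st.
  have cadd : c (s + t) = (c s * c t)%g.
    have [e1 e2 e3] : [/\ clip b (s + t) = s + t, clip b s = s & clip b t = t].
      by split; apply: clip_id; apply/andP; split; lra.
    rewrite /c e1 e2 e3; apply: eGadd => //.
    by have [|] := hb (s + t) _; first by apply/andP; split; lra.
  rewrite /= cadd; exact: defect_subproof lf _ _.
exists Z.
have pos u : 0 <= u < Num.min delta b -> phi (coset_proj (eG (u *: v))) = coset_proj (eH (u *: Z)).
  rewrite lt_min => /andP[u0 /andP[ud ub]].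
  have ce : c u = eG (u *: v) by rewrite /c clip_id//; apply/andP; split; lra.
  rewrite -ce lf; apply/coset_eq; apply: hZ.
  by rewrite u0.
have nm : \forall t \near (0 : R), `|t| < Num.min delta b.
  apply/nbhs_ballP; exists (Num.min delta b); first by rewrite /= lt_min delta0.
  by move=> t; rewrite -ball_normE /= sub0r normrN.
apply: filterS2 nm (scal _ Z _ (exp_opp exH)) => t tm eHt.
have [t0|t0] := leP 0 t.
  by apply: pos; rewrite t0 /= -[t]ger0_norm.
(* Negative times come from positive ones by inversion on both sides. *)
have tp : phi (coset_proj (eG (- t *: v))) = coset_proj (eH (- t *: Z)).
  by apply: pos; rewrite -(ltr0_norm t0) normr_ge0.
have [|_ [_ eGt]] := hb t _.
  by move: tm; rewrite lt_min => /andP[_]; rewrite ltr_norml => /andP[? ?]; rewrite !ltW.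
by have := liftV tp; rewrite !scaleNr eHt eGt !invgK.
Qed.

Lemma analytic_local_lift : borel_definable phi -> exists g : G -> H, g 1%g = 1%g /\
  \forall x \near (1%g : G), phi (coset_proj x) = coset_proj (g x) /\
    ({for x, continuous g} /\ lie_analytic_at (lie_cover_group C) (lie_cover_group D) g x).
Proof.
move=> bphi; set LG := lie_cover_group C; set LH := lie_cover_group D.
have [cG [eG [lG [cGA cG1 exG _ aG]]]] := lie_exponential LG hG.
have [cH [eH [lH [cHA cH1 exH aH _]]]] := lie_exponential LH hH.
set n := lie_dim LG in cG eG lG cGA cG1 exG aG *.
pose b (i : 'I_n) : 'rV[R]_n := delta_mx 0 i.
have /choice[Z hZ] := fun i => curve_lift (b i) bphi exG exH.
pose s := index_enum 'I_n.
have [gG gG1] := germ_log_word exG b s.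
have [_ gH1] := germ_log_word exH Z s.
have gG2 : germ 2 (fun t => log_word eG lG b s t - t).
  apply: germ_ext gG => t; congr (_ - _).
  by rewrite [RHS]row_sum_delta.
have [k gk kE] := germ_inverse gG2.
(* [T] passes from coordinates of the first kind to those of the second kind: it inverts [log_word],
   whose linear part is the identity for the standard basis [b]. *)
pose T x := x + k x.
have gT1 : germ 1 T by exact: germD germ_id (germ_le (leqnSn 1) gk).
have gHT : germ 1 (fun x => log_word eH lH Z s (T x)) by exact: germ_comp gH1 gT1.
have lG1 : lG 1%g = 0 by rewrite -(exp0 exG); exact: (nbhs_singleton (expK exG)).
have lG0 P : (\forall v \near (0 : 'rV[R]_n), P v) -> \forall x \near (1%g : G), P (lG x).
  by move=> hP; have lc := nbhs_singleton (log_continuous exG); apply: (lc P); rewrite lG1.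
(* Near 1, [g] sends the word in the [b i] with parameters [t] to the word in the [Z i] with the
   same parameters. *)
pose g x := eH (log_word eH lH Z s (T (lG x))).
have g1 : g 1%g = 1%g by rewrite /g lG1 (germ1_at0 gHT) (exp0 exH).
exists g; split => //.
have gcont : \forall x \near (1%g : G), {for x, continuous g}.
  have h1 := lG0 _ (germ_continuous gHT).
  have h2 := lG0 _ (germ1_near gHT (exp_continuous exH)).
  apply: filterS3 (log_continuous exG) h1 h2 => x lc uc ec.
  apply: (@continuous_comp _ _ _ (fun x => log_word eH lH Z s (T (lG x))) eH) => //.
  exact: (@continuous_comp _ _ _ lG (fun y => log_word eH lH Z s (T y))).
have glift : \forall x \near (1%g : G), phi (coset_proj x) = coset_proj (g x).
  have words s' : \forall t \near (0 : 'rV[R]_n),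
      phi (coset_proj (exp_word eG b s' t)) = coset_proj (exp_word eH Z s' t).
    elim: s' => [|i s' ih] /=; first by apply: near_all => t; exact: lift1.
    have hi : \forall t \near (0 : 'rV[R]_n), phi (coset_proj (eG ((t : 'rV[R]_n) ord0 i *: b i))) =
        coset_proj (eH (t ord0 i *: Z i)).
      have cc : (fun t : 'rV[R]_n => t ord0 i) @ (0 : 'rV[R]_n) --> (0 : R).
        have := @coord_continuous R 1 n ord0 i (0 : 'rV[R]_n).
        by rewrite /continuous_at mxE.
      exact: (cc _ (hZ i)).
    by apply: filterS2 hi ih => t /=; exact: liftM.
  have w1 := lG0 _ (germ1_near gT1 (near_and (words s) (near_and (exp_wordE exG b s) (exp_wordE
    exH Z s)))).
  have w2 := lG0 _ kE.
  apply: filterS3 (logK exG) w1 w2 => x lx [w [wG wH]] [k1 _].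
  have TE : log_word eG lG b s (T (lG x)) = lG x by rewrite -[RHS]k1 /T [RHS]addrC subrK.
  by rewrite -wG -wH TE lx in w; exact: w.
apply: near_and glift (near_and gcont _).
pose gh := cH \o g \o chart_inv cG.
have agh : analytic_at gh (cG 1%g).
  have a1 : analytic_at (fun x => log_word eH lH Z s (T x)) 0.
    by apply/analytic_germ; apply: germ_ext (germ_le (leq0n 1) gHT) => h; rewrite add0r.
  have a2 : analytic_at ((cH \o eH) \o (fun x => log_word eH lH Z s (T x))) 0.
    by apply: analytic_comp a1 _; rewrite (germ1_at0 gHT).
  have lc1 : (lG \o chart_inv cG) (cG 1%g) = 0 by rewrite /= chartK.
  rewrite -lc1 in a2; exact: (analytic_comp aG a2).
have n1 : \forall x \near (1%g : G), analytic_at gh (cG x).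
  exact: (chart_map_near cG1 (analytic_near agh)).
have n2 : \forall x \near (1%g : G), chart_dom cH (g x).
  by have gc := nbhs_singleton gcont; apply: (gc (chart_dom cH)); rewrite g1; exact: chart_dom_near.
apply: filterS2 (near_and n1 n2) (near_and gcont (chart_dom_near cG1)) => x [a dHx] [gc dGx].
exact: (lie_analytic_chart cGA cHA).
Qed.

End LocalLift.

(** * Continuity of the defect at the identity *)

Lemma approximately_multiplicative_continuous (R : realType) (C D : real_lie_cover R)
    (phi : {multiplicative cover_quotient C -> cover_quotient D})
    (f : cover_group C -> cover_group D) (lf : is_lift phi f) (U : set (cover_group C)) :
  f 1%g = 1%g -> open_nbhs 1%g U -> (forall x, U x -> {for x, continuous f}) ->
  approximately_multiplicative lf.
Proof.
move=> f1 [oU U1] fc; split => //.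
set G := cover_group C; set H := cover_group D.
have hG : hausdorff_space G by exact: (polish_hausdorff (polishP (s := G))).
pose dl (x y : G) : H := (f x * f y * (f (x * y))^-1)%g.
have dl11 : dl 1%g 1%g = 1%g by rewrite /dl mulg1 f1 mulg1 mulgV.
have nU x : U x -> nbhs x U by move=> Ux; exact: open_nbhs_nbhs.
have dl_cvg (T : topologicalType) (t : T) (a b : T -> G) : U (a t) -> U (b t) -> U (a t * b t)%g ->
    {for t, continuous a} -> {for t, continuous b} ->
    (fun s => dl (a s) (b s)) @ nbhs t --> dl (a t) (b t).
  move=> Ua Ub Uab ac bc; apply: cvgMg_at.
    apply: cvgMg_at; first by apply: (@continuous_comp _ _ _ a f) => //; exact: fc.
    by apply: (@continuous_comp _ _ _ b f) => //; exact: fc.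
  apply: cvgVg_at; apply: (@continuous_cvg _ _ _ _ _ _ f); first exact: fc.
  exact: cvgMg_at.
have [P0 [R0 [U0 [m [[_ cR0] [R01 R0M R0V] P0R0 [U0n R0U0] [cover finer]]]]]] :=
  plaques (lie_cover_sub D).
(* Values of the defect in [W] differ pairwise by elements of [U0], as [path_in_plaque] asks of a
   path. *)
have [W nW WU0] : exists2 W : set H, nbhs 1%g W & forall a b, W a -> W b -> U0 (a^-1 * b)%g.
  have c : (fun p : H * H => p.1^-1 * p.2)%g @ nbhs ((1%g, 1%g) : H * H) --> (1%g : H).
    rewrite -[X in _ --> X]mulg1 -[X in (X * _)%g]invg1; apply: cvgMg_at; last exact: cvg_snd.
    by apply: cvgVg_at; exact: cvg_fst.
  have [[A B] /= [nA nB] AB] := c _ U0n.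
  by exists (A `&` B); [exact: filterI | move=> a b [Aa _] [_ Bb]; exact: (AB (a, b))].
have [cG [e [l [_ _ ex _ _]]]] := lie_exponential (lie_cover_group C) hG.
set n := lie_dim _ in cG e l ex.
have ecv (u : 'rV[R]_(n + n) -> 'rV[R]_n) : germ 1 u -> {for 0,
  continuous (e \o u)} /\ e (u 0) = 1%g.
  move=> gu; have ec := nbhs_singleton (exp_continuous ex).
  have u0 := germ1_at0 gu; rewrite u0 (exp0 ex); split => //.
  apply: continuous_comp; first exact: (nbhs_singleton (germ_continuous gu)).
  by rewrite u0.
(* A pair near [(1, 1)] is encoded by one vector [w], so that the segment from 0 to [w] joins
   [(1, 1)] to the pair. *)
pose a0 (w : 'rV[R]_(n + n)) := e (lsubmx w); pose b0 (w : 'rV[R]_(n + n)) := e (rsubmx w).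
have [ac a01] : {for 0, continuous a0} /\ a0 0 = 1%g := ecv _ germ_lsubmx.
have [bc b01] : {for 0, continuous b0} /\ b0 0 = 1%g := ecv _ germ_rsubmx.
have near0 : \forall w \near (0 : 'rV[R]_(n + n)),
    ({for lsubmx w, continuous e} /\ {for rsubmx w, continuous e}) /\
    ((U (a0 w) /\ U (b0 w)) /\ (U (a0 w * b0 w)%g /\ W (dl (a0 w) (b0 w)))).
  apply: near_and; first apply: near_and.
  - exact: (germ1_near germ_lsubmx (exp_continuous ex)).
  - exact: (germ1_near germ_rsubmx (exp_continuous ex)).
  apply: near_and; apply: near_and.
  - by apply: (ac U); rewrite a01; exact: nU.
  - by apply: (bc U); rewrite b01; exact: nU.
  - have c : (fun w => a0 w * b0 w)%g @ nbhs (0 : 'rV[R]_(n + n)) -->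
    (a0 0 * b0 0)%g by exact: cvgMg_at.
    by apply: (c U); rewrite a01 b01 mulg1; exact: nU.
  - have c := @dl_cvg _ 0 a0 b0; rewrite a01 b01 mulg1 dl11 in c.
    exact: (c U1 U1 U1 ac bc _ nW).
have /nbhs_ballP[rho /= rho0 hrho] := near0.
have inR0 w : `|w| < rho -> R0 (dl (e (lsubmx w)) (e (rsubmx w))).
  move=> wr.
  have hc t : let w' := clip 1 t *: w in
    ({for lsubmx w', continuous e} /\ {for rsubmx w', continuous e}) /\
    ((U (a0 w') /\ U (b0 w')) /\ (U (a0 w' * b0 w')%g /\ W (dl (a0 w') (b0 w')))).
    apply: hrho; rewrite -ball_normE /= sub0r normrN normrZ.
    apply: le_lt_trans wr; rewrite ler_piMl// ler_norml.
    exact: clip_bound.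
  (* The segment is extended to the whole line by clipping; [clip 1 t *: w] never exceeds [w] in
     norm, so the estimates of [near0] hold at every time. *)
  pose gam t := dl (e (clip 1 t *: lsubmx w)) (e (clip 1 t *: rsubmx w)).
  have cz (v : 'rV[R]_n) t : {for t, continuous (fun t => clip 1 t *: v)}.
    by apply: cvgZr_tmp; exact: clip_continuous.
  have gamE t : gam t = dl (a0 (clip 1 t *: w)) (b0 (clip 1 t *: w)).
    by rewrite /gam /a0 /b0 !linearZ.
  have c1 : clip 1 (1 : R) = 1 by apply: clip_id; lra.
  have c0 : clip 1 (0 : R) = 0 by apply: clip_id; lra.
  have <- : gam 1 = dl (e (lsubmx w)) (e (rsubmx w)) by rewrite /gam c1 !scale1r.
  apply: (@path_in_plaque R H [set x | x \in cover_pred D] P0 R0 U0 m cR0 R0V P0R0 R0U0 cover gam).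
  - move=> t; have [[ec1 ec2] [[Ua Ub] [Uab _]]] := hc t.
    rewrite /a0 /b0 !linearZ /= in ec1 ec2 Ua Ub Uab.
    apply: (@dl_cvg _ t (fun t => e (clip 1 t *: lsubmx w)) (fun t =>
      e (clip 1 t *: rsubmx w))) => //.
      exact: (@continuous_comp _ _ _ (fun t => clip 1 t *: lsubmx w) e).
    exact: (@continuous_comp _ _ _ (fun t => clip 1 t *: rsubmx w) e).
  - by move=> t; exact: defect_subproof.
  - move=> s t; rewrite !gamE; apply: WU0.
      by have [_ [_ []]] := hc s.
    by have [_ [_ []]] := hc t.
  - by rewrite /gam c0 !scale0r (exp0 ex).
rewrite /prop_for /continuous_at.
have d11 : defect lf (1%g, 1%g) = 1%g.
  by apply: val_inj; rewrite SubK /= [RHS]val1 -dl11 /dl.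
rewrite d11 => V nV; have [U' nU' hU'] := finer V nV.
have nl : nbhs (1%g : G) [set x | e (l x) = x /\ `|l x| < rho].
  apply: near_and (logK ex) _.
  have lc := nbhs_singleton (log_continuous ex).
  have l1 : l 1%g = 0 by rewrite -(exp0 ex); exact: (nbhs_singleton (expK ex)).
  apply: (lc [set v | `|v| < rho]); rewrite l1; apply/nbhs_ballP; exists rho => //= v.
  by rewrite -ball_normE /= sub0r normrN.
have nR : nbhs ((1%g, 1%g) : G * G) [set p | R0 (dl p.1 p.2)].
  exists ([set x | e (l x) = x /\ `|l x| < rho], [set x | e (l x) = x /\ `|l x| < rho]);
    first by split.
  move=> [x y] /= [[ex1 lx] [ey ly]].
  have := inR0 (row_mx (l x) (l y)); rewrite row_mxKl row_mxKr ex1 ey; apply.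
  apply: (@le_lt_trans _ _ (Num.max `|l x| `|l y|)); last by rewrite gt_max lx ly.
  apply/rV_normP; first by rewrite le_max normr_ge0.
  move=> j; case: (split_ordP j) => k ->; rewrite ?row_mxEl ?row_mxEr le_max.
    by have /rV_normP -> := lexx `|l x|.
  by have /rV_normP -> := lexx `|l y|; rewrite ?orbT.
have nU2 : nbhs ((1%g, 1%g) : G * G) [set p | U' (dl p.1 p.2)].
  have c := @dl_cvg _ ((1%g, 1%g) : G * G) fst snd; rewrite /= mulg1 dl11 in c.
  by apply: (c U1 U1 U1 _ _ U' nU'); [exact: cvg_fst | exact: cvg_snd].
have : nbhs ((1%g, 1%g) : G * G) [set p | V (defect lf p)].
  by apply: filterS2 nR nU2 => -[x y] /= h1 h2; apply: hU'; rewrite SubK.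
by [].
Qed.

Theorem corollary5p6 (R : realType) (C D : real_lie_cover R)
    (phi : {multiplicative cover_quotient C -> cover_quotient D}) :
  borel_definable phi <->
  exists (f : cover_group C -> cover_group D) (lf : is_lift phi f),
    [/\ borel_fun f, approximately_multiplicative lf & analytic_near_one f].
Proof.
split=> [bphi|[f [lf [bf _ _]]]]; last by exists f.
have [g [g1 ng]] := analytic_local_lift bphi.
have [f0 lf0 bf0] := bphi.
(* Taking the interior gives an open set, so replacing the Borel lift by [g] on it preserves
   measurability and leaves the germ of [g] intact at each of its points. *)
pose U := interior [set x | phi (coset_proj x) = coset_proj (g x) /\
  ({for x, continuous g} /\
   lie_analytic_at (lie_cover_group C) (lie_cover_group D) g x)].
have oU : open U by exact: open_interior.
have UP x : U x -> phi (coset_proj x) = coset_proj (g x) /\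
  ({for x, continuous g} /\ lie_analytic_at (lie_cover_group C) (lie_cover_group D) g x).
  by move=> /interior_subset.
pose f x := if `[< U x >] then g x else f0 x.
have fU x : U x -> f x = g x by move=> Ux; rewrite /f asboolT.
have nfU x : U x -> \forall y \near x, g y = f y.
  by move=> Ux; apply: filterS (open_nbhs_nbhs (conj oU Ux)) => y /fU.
have lf : is_lift phi f.
  move=> x; rewrite /f; case: asboolP => [/UP[]//|_]; exact: lf0.
have U1 : U 1%g by exact: ng.
exists f, lf; split.
- by apply: borel_patch => // x /UP[_ []].
- apply: (@approximately_multiplicative_continuous _ _ _ _ _ lf U) => //.
    by rewrite fU.
  move=> x Ux; have [_ [_ ga]] := UP x Ux.
  by have [] := lie_analytic_eq (nfU x Ux) ga.
- exists U => // x Ux; have [_ [_ ga]] := UP x Ux.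
  exact: lie_analytic_eq (nfU x Ux) ga.
Qed.
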